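(* The following decision problem is NP-complete: given a nondeterministic asynchronous finite automaton (NAA) $\mathsf{A}=\langle \Sigma, K, S, S_0, \Delta, S_F\rangle$ with $K=\{1,\dots,k\}$ and a finite set $\mathbf{w}\subseteq\Sigma^*$ of words, decide whether the match set $\mathcal{M}(\mathsf{A},\mathbf{w})$ is nonempty.
   Context: An NAA is a tuple $\mathsf{A}=\langle \Sigma, K, S, S_0, \Delta, S_F\rangle$ where $\Sigma$ is a finite alphabet, $K=\{1,\dots,k\}$ is a finite set of directions, $S$ is a finite set of states, $S_0\subseteq S$ the initial states, $S_F\subseteq S$ the accepting states, and $\Delta\subseteq S\times\Sigma\times K\times S$ the transition relation. Its underlying NFA $\mathcal{A}$ is the ordinary nondeterministic finite automaton over the alphabet $\Sigma\times K$ with states $S$, initial states $S_0$, accepting states $S_F$ and transitions $\Delta$; $\mathcal{L}(\mathcal{A})$ denotes its language. For a word $\tilde w\in(\Sigma\times K)^*$ and $x\in K$, $\pi_x(\tilde w)\in\Sigma^*$ is obtained by deleting all letters $(a,x')$ with $x'\neq x$ and then replacing each remaining letter $(a,x)$ by $a$. The NAA accepts a $k$-tuple $(w_1,\dots,w_k)$ of words over $\Sigma$ if there exists $\tilde w\in\mathcal{L}(\mathcal{A})$ with $\pi_x(\tilde w)=w_x$ for every $x\in K$; $\mathfrak{L}(\mathsf{A})$ is the set of accepted $k$-tuples. For a word $w=\sigma_1\cdots\sigma_n$, $w[i..j]$ denotes the subword $\sigma_i\sigma_{i+1}\cdots\sigma_j$. The match set is $\mathcal{M}(\mathsf{A},\mathbf{w})=\{((w_1,i^1,j^1),\dots,(w_k,i^k,j^k))\in(\mathbf{w}\times\mathbb{N}\times\mathbb{N})^k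 \mid (w_1[i^1..j^1],\dots,w_k[i^k..j^k])\in\mathfrak{L}(\mathsf{A})\}$. *)

(* Defs.v *)
From mathcomp Require Import all_boot.
Set Implicit Arguments. Unset Strict Implicit. Unset Printing Implicit Defensive.

(* Directions K = {1,...,k} are represented by 'I_k (direction x+1 <-> x).   *)

Record NAA (Sigma : finType) (k : nat) := Naa {
  St : finType;
  S0 : {set St};
  SF : {set St};
  Delta : {set St * Sigma * 'I_k * St}
}.

Section NAA_sem.
Variables (Sigma : finType) (k : nat) (A : NAA Sigma k).

Fixpoint nfa_run (s : St A) (w : seq (Sigma * 'I_k)) : bool :=
  match w with
  | [::] => s \in SF A
  | (a, x) :: w' => [exists s' : St A, ((s, a, x, s') \in Delta A) && nfa_run s' w']
  end.

Definition nfa_lang (w : seq (Sigma * 'I_k)) : bool :=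
  [exists s in S0 A, nfa_run s w].

Definition proj (x : 'I_k) (w : seq (Sigma * 'I_k)) : seq Sigma :=
  [seq p.1 | p <- w & p.2 == x].

Definition naa_accepts (ws : 'I_k -> seq Sigma) : Prop :=
  exists w, nfa_lang w /\ forall x, proj x w = ws x.
End NAA_sem.

(* w[i..j] = σ_i ... σ_j (1-indexed, inclusive; empty when i = j+1) *)
Definition subword (T : Type) (w : seq T) (i j : nat) : seq T :=
  drop i.-1 (take j w).

Definition in_match_set (Sigma : finType) (k : nat) (A : NAA Sigma k)
    (W : seq (seq Sigma)) (m : 'I_k -> seq Sigma * nat * nat) : Prop :=
  (forall x, [/\ (m x).1.1 \in W, 1 <= (m x).1.2 & (m x).1.2 <= (m x).2.+1 <= (size (m x).1.1).+1])
  /\ naa_accepts A (fun x => subword (m x).1.1 (m x).1.2 (m x).2).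

Definition match_set_nonempty (Sigma : finType) (k : nat) (A : NAA Sigma k)
    (W : seq (seq Sigma)) : Prop :=
  exists m, in_match_set A W m.

(* Σ = {0..nsig-1}, directions {0..nk-1}, states {0..nst-1}.                 *)

Record naa_inst := NaaInst {
  nsig : nat; nk : nat; nst : nat;
  i_init : seq nat; i_fin : seq nat;
  i_trans : seq (nat * nat * nat * nat);   (* (s, a, x, s') *)
  i_words : seq (seq nat)
}.

Definition inst_wf (I : naa_inst) : bool :=
  [&& all (fun s => s < nst I) (i_init I), all (fun s => s < nst I) (i_fin I),
      all (fun t => [&& t.1.1.1 < nst I, t.1.1.2 < nsig I, t.1.2 < nk I & t.2 < nst I])
          (i_trans I)
    & all (all (fun a => a < nsig I)) (i_words I)].

Definition inst_naa (I : naa_inst) : NAA 'I_(nsig I) (nk I) :=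
  @Naa 'I_(nsig I) (nk I) 'I_(nst I)
    [set s : 'I_(nst I) | val s \in i_init I]
    [set s : 'I_(nst I) | val s \in i_fin I]
    [set t : 'I_(nst I) * 'I_(nsig I) * 'I_(nk I) * 'I_(nst I) |
       (val t.1.1.1, val t.1.1.2, val t.1.2, val t.2) \in i_trans I].

Definition inst_words (I : naa_inst) : seq (seq 'I_(nsig I)) :=
  map (pmap insub) (i_words I).

Definition enc_nat (n : nat) : seq bool := nseq n true ++ [:: false].
Definition enc_list (T : Type) (e : T -> seq bool) (s : seq T) : seq bool :=
  enc_nat (size s) ++ flatten (map e s).
Definition enc_trans (t : nat * nat * nat * nat) : seq bool :=
  enc_nat t.1.1.1 ++ enc_nat t.1.1.2 ++ enc_nat t.1.2 ++ enc_nat t.2.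
Definition enc_inst (I : naa_inst) : seq bool :=
  enc_nat (nsig I) ++ enc_nat (nk I) ++ enc_nat (nst I) ++
  enc_list enc_nat (i_init I) ++ enc_list enc_nat (i_fin I) ++
  enc_list enc_trans (i_trans I) ++ enc_list (enc_list enc_nat) (i_words I).

Definition NAA_MATCH_NONEMPTY (z : seq bool) : Prop :=
  exists I, [/\ inst_wf I, z = enc_inst I & match_set_nonempty (inst_naa I) (inst_words I)].

(* Input alphabet: option bool (Some b = bit b, None = separator).          *)

Inductive move := MoveL | MoveR | Stay.

Record TM := MkTM {
  tQ : finType; tG : finType;
  tblank : tG;
  tin : option bool -> tG;
  tout : tG -> option bool;
  tq0 : tQ;
  tdelta : tQ -> tG -> option (tQ * tG * move);   (* None = halt *)
  tacc : pred tQ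
}.

Section TMsem.
Variable M : TM.
(* state, left part (nearest cell first), head cell, right part *)
Definition config := (tQ M * seq (tG M) * tG M * seq (tG M))%type.

Definition init_config (z : seq (option bool)) : config :=
  match map (@tin M) z with
  | [::] => (tq0 M, [::], tblank M, [::])
  | g :: r => (tq0 M, [::], g, r)
  end.

Definition do_move (d : move) (c : config) : config :=
  let: (q, l, g, r) := c in
  match d with
  | Stay => c
  | MoveL => match l with [::] => (q, [::], tblank M, g :: r)
                        | a :: l' => (q, l', a, g :: r) end
  | MoveR => match r with [::] => (q, g :: l, tblank M, [::])
                        | a :: r' => (q, g :: l, a, r') end
  end.

Definition step (c : config) : option config :=
  let: (q, l, g, r) := c in
  match @tdelta M q g with
  | None => None
  | Some (q', g', d) => Some (do_move d (q', l, g', r))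
  end.

Fixpoint exec (n : nat) (c : config) : option config :=
  match n with
  | 0 => Some c
  | n'.+1 => match step c with Some c' => exec n' c' | None => None end
  end.

Definition halts_within (z : seq (option bool)) (t : nat) (c : config) : Prop :=
  exists n, [/\ n <= t, exec n (init_config z) = Some c & step c = None].

Definition accepting (c : config) : bool := @tacc M c.1.1.1.

Definition tape_output (c : config) : seq bool :=
  let: (_, l, g, r) := c in pmap (@tout M) (rev l ++ g :: r).
End TMsem.

Definition bits (x : seq bool) : seq (option bool) := map Some x.
Definition pair_input (x y : seq bool) : seq (option bool) := bits x ++ None :: bits y.

Definition in_NP (L : seq bool -> Prop) : Prop :=
  exists (M : TM) (d : nat),
    (forall x y, exists c, @halts_within M (pair_input x y) (d * (size x + size y) ^ d + d) c) /\
    (forall x, L x <-> exists y c, [/\ size y <= d * size x ^ d + d,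
                         @halts_within M (pair_input x y) (d * (size x + size y) ^ d + d) c
                       & accepting c]).

Definition poly_computable (f : seq bool -> seq bool) : Prop :=
  exists (M : TM) (d : nat), forall x, exists c,
    @halts_within M (bits x) (d * size x ^ d + d) c /\ tape_output c = f x.

Definition poly_reduces (L1 L2 : seq bool -> Prop) : Prop :=
  exists f, poly_computable f /\ forall x, L1 x <-> L2 (f x).

Definition NP_hard (L : seq bool -> Prop) : Prop :=
  forall L', in_NP L' -> poly_reduces L' L.

Definition NP_complete (L : seq bool -> Prop) : Prop := in_NP L /\ NP_hard L.

(* Main.v *)
(** Membership: programs over counters with values bounded by a polynomial [N] are run by
    a Turing machine that keeps each counter as a mark on its tape; a bounded loop nest
    then takes polynomial time whatever it computes.  The verifier is such a program: it
    reads its input as a stream of unary numbers, follows the list lengths to find the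
    components of the instance, and checks a certificate that consists of an accepting
    run, and of a word and an offset for every direction.

    Hardness: if the words are all the powers [a ^ m], a direction behaves like a variable
    that is assigned a single letter, and an automaton that passes through one state per
    clause expresses the satisfiability of a conjunction of disjunctions of equations
    "variable = letter".  The computation tableau of a verifier (Cook and Levin) is such a
    conjunction: the letter at each position is a function of three letters of the
    previous row, and the first row contains a guessed certificate. *)

Require Import Defs.
From mathcomp Require Import all_boot zify.
Set Implicit Arguments. Unset Strict Implicit. Unset Printing Implicit Defensive.

(** * Counter programs and their execution by a Turing machine *)

(** A certificate is short because every transition consumes a letter: what one direction reads is
    an infix of a word, so a run has at most (number of directions) * (longest word) steps. The
    unary encoding bounds both factors, and every number of the instance, by the input length.

    The obstacle is that both halves ask for concrete Turing machines with explicit time bounds, and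
    that a verifier has to halt in time on all pairs of strings, malformed ones included. Counters
    are therefore clamped rather than assumed to fit; the price is that each construct must commute
    with clamping or act on values known to be [small]. Decoding is total for the same reason: every
    stream of numbers denotes some instance, and it remains to check where that instance ends.

    In the reduction, states enforce one true literal per clause, whereas the words enforce that a
    variable keeps its letter across clauses; asynchrony lets clauses mention variables in any
    order. Some numbers of the produced instance exceed the counter bound by a factor that depends
    on the simulated machine; they are printed piecewise and never stored. *)

Notation word := (seq (option bool)).

(** Positions count from 1 because cell 0 of the tape is the home cell, which carries no input. *)
Definition sym (z : word) (i : nat) : option (option bool) :=
  if i is j.+1 then onth z j else None.

(* [PSymNe r a] tests that the input symbol at position [r], counted from 1, is not [a]. *)
Inductive prim :=
| PInc of nat | PZero of nat | POut of bool
| PLt of nat & nat | PSymNe of nat & option (option bool).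

Inductive cmd :=
| Prim of prim | Seq of cmd & cmd | If of cmd & cmd & cmd | While of cmd & cmd.

Definition store := ((nat -> nat) * seq bool)%type.

Definition setr (s : store) r v : store := (fun r' => if r' == r then v else s.1 r', s.2).

Definition psem (z : word) (p : prim) (s : store) : bool * store :=
  match p with
  | PInc r => (true, setr s r (s.1 r).+1)
  | PZero r => (true, setr s r 0)
  | POut b => (true, (s.1, rcons s.2 b))
  | PLt r r' => (s.1 r < s.1 r', s)
  | PSymNe r a => (sym z (s.1 r) != a, s)
  end.

(** The number counts executed primitives. Conditions are commands, so every command has a truth
    value, that of its last primitive. *)
Inductive bs (z : word) : cmd -> store -> nat -> bool -> store -> Prop :=
| BsPrim p s : bs z (Prim p) s 1 (psem z p s).1 (psem z p s).2
| BsSeq c1 c2 s n1 b1 s1 n2 b2 s2 :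
    bs z c1 s n1 b1 s1 -> bs z c2 s1 n2 b2 s2 -> bs z (Seq c1 c2) s (n1 + n2) b2 s2
| BsIf c c1 c2 s n1 b1 s1 n2 b2 s2 :
    bs z c s n1 b1 s1 -> bs z (if b1 then c1 else c2) s1 n2 b2 s2 ->
    bs z (If c c1 c2) s (n1 + n2) b2 s2
| BsWhileF c c1 s n s1 : bs z c s n false s1 -> bs z (While c c1) s n false s1
| BsWhileT c c1 s n1 s1 n2 b2 s2 n3 b3 s3 :
    bs z c s n1 true s1 -> bs z c1 s1 n2 b2 s2 -> bs z (While c c1) s2 n3 b3 s3 ->
    bs z (While c c1) s (n1 + n2 + n3) b3 s3.

Definition prim_lt (m : nat) (p : prim) : bool :=
  match p with
  | PInc r | PZero r | PSymNe r _ => r < m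
  | POut _ => true
  | PLt r r' => (r < m) && (r' < m)
  end.

Fixpoint regs_lt (m : nat) (c : cmd) : bool :=
  match c with
  | Prim p => prim_lt m p
  | Seq c1 c2 | While c1 c2 => regs_lt m c1 && regs_lt m c2
  | If c c1 c2 => [&& regs_lt m c, regs_lt m c1 & regs_lt m c2]
  end.

Lemma prim_ltW m m' p : m <= m' -> prim_lt m p -> prim_lt m' p.
Proof. by case: p => //= *; lia. Qed.

Lemma regs_ltW m m' c : m <= m' -> regs_lt m c -> regs_lt m' c.
Proof.
move=> le_m; elim: c => [p|c1 IH1 c2 IH2|c IH c1 IH1 c2 IH2|c1 IH1 c2 IH2] /=.
- exact: prim_ltW.
- by case/andP=> /IH1-> /IH2->.
- by case/and3P=> /IH-> /IH1-> /IH2->.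
- by case/andP=> /IH1-> /IH2->.
Qed.

Lemma regs_lt_ex c : exists m, regs_lt m.+1 c.
Proof.
elim: c => [p|c1 [m1 H1] c2 [m2 H2]|c [m H] c1 [m1 H1] c2 [m2 H2]|c1 [m1 H1] c2 [m2 H2]].
- by case: p => [r|r|b|r r'|r a]; [exists r|exists r|exists 0|exists (r + r')|exists r] => /=; lia.
- by exists (m1 + m2) => /=; rewrite (regs_ltW _ H1) ?(regs_ltW _ H2) //; lia.
- by exists (m + m1 + m2) => /=; rewrite (regs_ltW _ H) ?(regs_ltW _ H1) ?(regs_ltW _ H2) //; lia.
- by exists (m1 + m2) => /=; rewrite (regs_ltW _ H1) ?(regs_ltW _ H2) //; lia.
Qed.

(** * Machine fragments, their composition, and counters as tape marks *)

Section Machine.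
Variable R : nat.
Notation reg := 'I_R.+1.

(* home flag, input track, output track, registers whose value is this position *)
Definition cell := (bool * option (option bool) * option bool * {set reg})%type.
Definition blank : cell := (false, None, None, set0).
Notation home g := (g.1.1.1) (only parsing).
Notation csym g := (g.1.1.2) (only parsing).
Notation cout g := (g.1.2) (only parsing).
Notation marks g := (g.2) (only parsing).

Definition tape := (seq cell * cell * seq cell)%type.

Definition tmove (d : move) (t : tape) (g : cell) : tape :=
  let: (l, _, r) := t in
  match d with
  | Stay => (l, g, r)
  | MoveL => if l is a :: l' then (l', a, g :: r) else ([::], blank, g :: r)
  | MoveR => if r is a :: r' then (g :: l, a, r') else (g :: l, blank, [::])
  end.

Record frag := Frag {
  fQ : finType;
  fentry : fQ;
  fdelta : fQ -> cell -> (fQ + bool) * cell * move }.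

Inductive freach (f : frag) : fQ f -> tape -> nat -> bool -> tape -> Prop :=
| FrExit q t b g d : @fdelta f q t.1.2 = (inr b, g, d) -> freach q t 1 b (tmove d t g)
| FrStep q t q' g d n b t' : @fdelta f q t.1.2 = (inl q', g, d) ->
    freach q' (tmove d t g) n b t' -> freach q t n.+1 b t'.

Definition redirect Q Q' (inj : Q -> Q') (k : bool -> Q' + bool)
    (x : (Q + bool) * cell * move) : (Q' + bool) * cell * move :=
  let: (r, g, d) := x in (match r with inl q => inl (inj q) | inr b => k b end, g, d).

Definition seq_frag (f1 f2 : frag) : frag :=
  @Frag (fQ f1 + fQ f2)%type (inl (fentry f1)) (fun q g =>
    match q with
    | inl q => redirect inl (fun=> inl (inr (fentry f2))) (fdelta q g)
    | inr q => redirect inr inr (fdelta q g)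
    end).

Definition if_frag (f f1 f2 : frag) : frag :=
  @Frag (fQ f + (fQ f1 + fQ f2))%type (inl (fentry f)) (fun q g =>
    match q with
    | inl q => redirect inl
        (fun b => inl (inr (if b then inl (fentry f1) else inr (fentry f2)))) (fdelta q g)
    | inr (inl q) => redirect (fun q => inr (inl q)) inr (fdelta q g)
    | inr (inr q) => redirect (fun q => inr (inr q)) inr (fdelta q g)
    end).

Definition while_frag (f f1 : frag) : frag :=
  @Frag (fQ f + fQ f1)%type (inl (fentry f)) (fun q g =>
    match q with
    | inl q => redirect inl
        (fun b => if b then inl (inr (fentry f1)) else inr false) (fdelta q g)
    | inr q => redirect inr (fun=> inl (inl (fentry f))) (fdelta q g)
    end).

(** [POut] stops at the first cell after home with a free output track, so the output is contiguous
    from cell 1 on. *)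
Definition pstop (p : prim) (g : cell) : bool :=
  match p with
  | PInc r | PZero r | PSymNe r _ => inord r \in marks g
  | POut _ => ~~ home g && (cout g == None)
  | PLt r r' => (inord r \in marks g) || (inord r' \in marks g)
  end.

(** The walk for [PLt] ends at the lesser of the two marks, so [r < r'] holds exactly when [r'] is
    absent there; a tie shows both marks and gives false. *)
Definition pres (p : prim) (g : cell) : bool :=
  match p with
  | PLt _ r' => inord r' \notin marks g
  | PSymNe _ a => csym g != a
  | _ => true
  end.

Definition pupd (p : prim) (g : cell) : cell :=
  match p with
  | PInc r | PZero r => (g.1, marks g :\ inord r)
  | POut b => (g.1.1, Some b, g.2)
  | _ => g
  end.

Definition pupd_next (p : prim) (g : cell) : cell :=
  if p is PInc r then (g.1, inord r |: marks g) else g.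

Definition pupd_home (p : prim) (g : cell) : cell :=
  if p is PZero r then (g.1, inord r |: marks g) else g.

(* [None]: walk right to the stop cell; [Some (false, b)]: update its right neighbour;
   [Some (true, b)]: walk back home and return [b]. *)
Definition prim_frag (p : prim) : frag :=
  @Frag (option (bool * bool)) None (fun q g =>
    match q with
    | None => if pstop p g then (inl (Some (false, pres p g)), pupd p g, MoveR)
              else (inl None, g, MoveR)
    | Some (false, b) => (inl (Some (true, b)), pupd_next p g, MoveL)
    | Some (true, b) => if home g then (inr b, pupd_home p g, Stay)
                        else (inl (Some (true, b)), g, MoveL)
    end).

Fixpoint compile (c : cmd) : frag :=
  match c with
  | Prim p => prim_frag p
  | Seq c1 c2 => seq_frag (compile c1) (compile c2)
  | If c c1 c2 => if_frag (compile c) (compile c1) (compile c2)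
  | While c c1 => while_frag (compile c) (compile c1)
  end.

(** This lemma treats exits of a component that remain exits of the composite, [freach_cont] those
    that enter another component; together they serve all program constructs. *)
Lemma freach_exit (f f' : frag) (inj : fQ f -> fQ f') k :
  (forall q g, fdelta (inj q) g = redirect inj k (fdelta q g)) ->
  forall q t n b t', freach q t n b t' -> forall b', k b = inr b' -> freach (inj q) t n b' t'.
Proof.
move=> Hd q t n b t'; elim=> {q t n b t'} [q t b g d E b' kb|q t q' g d n b t' E _ IH b' kb].
  by apply: FrExit; rewrite Hd E /= kb.
by apply: FrStep (IH _ kb); rewrite Hd E.
Qed.

Lemma freach_cont (f f' : frag) (inj : fQ f -> fQ f') k :
  (forall q g, fdelta (inj q) g = redirect inj k (fdelta q g)) ->
  forall q t n b t', freach q t n b t' -> forall q' m b' t'', k b = inl q' ->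
  freach q' t' m b' t'' -> freach (inj q) t (n + m) b' t''.
Proof.
move=> Hd q t n b t'; elim=> {q t n b t'}
  [q t b g d E q' m b' t'' kb H|q t q' g d n b t' E _ IH q'' m b' t'' kb H].
  by apply: FrStep H; rewrite Hd E /= kb.
by apply: FrStep (IH _ _ _ _ kb H); rewrite Hd E.
Qed.

(** Left of the head the list is exact, because cell 0 is home and the head never passes it; right
    of the head it matters only up to trailing blanks. *)
Definition rep (F : nat -> cell) (h : nat) (t : tape) : Prop :=
  [/\ t.1.1 = rev (mkseq F h), t.1.2 = F h & forall i, nth blank t.2 i = F (h.+1 + i)].

Definition upd (F : nat -> cell) (h : nat) (g : cell) : nat -> cell :=
  fun i => if i == h then g else F i.

Lemma rep_eq F F' h t : F =1 F' -> rep F h t -> rep F' h t.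
Proof.
move=> E [H1 H2 H3]; split.
- by rewrite H1; congr rev; apply: eq_map.
- by rewrite H2 E.
- by move=> i; rewrite H3 E.
Qed.

Lemma mkseq_upd F h g n : n <= h -> mkseq (upd F h g) n = mkseq F n.
Proof.
move=> le_nh; apply/eq_in_map => i; rewrite mem_iota /upd => /andP[_ lt_in].
by case: eqP => // ?; lia.
Qed.

Lemma rep_stay F h t g : rep F h t -> rep (upd F h g) h (tmove Stay t g).
Proof.
case: t => [[l g0] r] [/= H1 H2 H3]; split => /=.
- by rewrite mkseq_upd.
- by rewrite /upd eqxx.
- by move=> i; rewrite H3 /upd; case: eqP => // ?; lia.
Qed.

Lemma rep_right F h t g : rep F h t -> rep (upd F h g) h.+1 (tmove MoveR t g).
Proof.
case: t => [[l g0] r] [/= H1 H2 H3].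
have E1 : g :: l = rev (mkseq (upd F h g) h.+1).
  by rewrite mkseqS rev_rcons mkseq_upd // /upd eqxx H1.
have E2 i : upd F h g (h.+1 + i) = nth blank r i by rewrite H3 /upd; case: eqP => // ?; lia.
case: r H3 E2 => [|a r] H3 E2; split => //=.
- by rewrite -[h.+1]addn0 E2.
- by move=> i; rewrite addSnnS E2 !nth_nil.
- by rewrite -[h.+1]addn0 E2.
- by move=> i; rewrite addSnnS E2.
Qed.

Lemma rep_left F h t g : rep F h.+1 t -> rep (upd F h.+1 g) h (tmove MoveL t g).
Proof.
case: t => [[l g0] r] [/= H1 H2 H3].
move: H1; rewrite mkseqS rev_rcons => ->.
split => /=.
- by rewrite mkseq_upd.
- by rewrite /upd; case: eqP => // ?; lia.
- case=> [|i] /=; first by rewrite addn0 /upd eqxx.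
  by rewrite H3 /upd addSnnS; case: eqP => // ?; lia.
Qed.

Section Prim.
Variable p : prim.

Lemma pupd_homeE g : home (pupd p g) = home g.
Proof. by case: p. Qed.
Lemma pupd_next_homeE g : home (pupd_next p g) = home g.
Proof. by case: p. Qed.

Lemma prim_back F h t b : (forall j, home (F j) = (j == 0)) -> rep F h t ->
  exists2 t', freach (f := prim_frag p) (Some (true, b)) t h.+1 b t'
    & rep (upd F 0 (pupd_home p (F 0))) 0 t'.
Proof.
move=> HF; elim: h t => [|h IH] t Ht; have [_ E _] := Ht.
  exists (tmove Stay t (pupd_home p (F 0))); last exact: rep_stay.
  by apply: FrExit => /=; rewrite E HF.
have [t' H1 H2] : exists2 t', freach (f := prim_frag p) (Some (true, b))
     (tmove MoveL t (F h.+1)) h.+1 b t' & rep (upd F 0 (pupd_home p (F 0))) 0 t'.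
  apply: IH; apply: rep_eq (rep_left (F h.+1) Ht) => i.
  by rewrite /upd; case: eqP => // ->.
exists t' => //; apply: FrStep H1 => /=.
by rewrite E HF.
Qed.

Definition prim_upd F i :=
  let F1 := upd F i (pupd p (F i)) in
  let F2 := upd F1 i.+1 (pupd_next p (F1 i.+1)) in upd F2 0 (pupd_home p (F2 0)).

(** The time is [i.+1] steps up to and including the stop cell, one on its right neighbour and
    [i.+1] on the way back. *)
Lemma prim_run F i t : (forall j, home (F j) = (j == 0)) ->
  (forall j, j < i -> ~~ pstop p (F j)) -> pstop p (F i) -> rep F 0 t ->
  exists2 t', freach (f := prim_frag p) None t (2 * i + 3) (pres p (F i)) t'
    & rep (prim_upd F i) 0 t'.
Proof.
move=> HF Hlt Hi.
(* Induction on the distance [k] that is left to the stop cell. *)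
suff Hk k : k <= i -> forall t, rep F (i - k) t ->
    exists2 t', freach (f := prim_frag p) None t (k + i + 3) (pres p (F i)) t'
    & rep (prim_upd F i) 0 t'.
  by move=> Ht; rewrite mulSn mul1n; apply: Hk; rewrite ?leqnn ?subnn.
elim: k => [_ {}t|k IH lt_ki {}t] Ht; have [_ E _] := Ht.
  rewrite subn0 in Ht E.
  have H1 := rep_right (pupd p (F i)) Ht; have [_ E1 _] := H1.
  set F1 := upd F i _ in H1 E1.
  have H2 := rep_left (pupd_next p (F1 i.+1)) H1.
  have HF1 j : home (F1 j) = (j == 0).
    by rewrite /F1 /upd; case: eqP => // ->; rewrite pupd_homeE HF.
  have [j|t' R1 R2] := prim_back (pres p (F i)) _ H2.
    by rewrite /upd; case: eqP => // ->; rewrite pupd_next_homeE HF1.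
  exists t' => //; rewrite add0n addn3; apply: FrStep; first by rewrite /= E Hi.
  by apply: FrStep R1; rewrite /= E1.
have [|t' R1 R2] := IH (ltnW lt_ki) (tmove MoveR t (F (i - k.+1))).
  have -> : i - k = (i - k.+1).+1 by lia.
  by apply: rep_eq (rep_right (F (i - k.+1)) Ht) => j; rewrite /upd; case: eqP => // ->.
exists t' => //; rewrite !addSn; apply: FrStep R1; rewrite /= E.
by rewrite (negbTE (Hlt _ _)) //; lia.
Qed.

End Prim.

Definition cellof (z : word) (s : store) (i : nat) : cell :=
  (i == 0, sym z i, if i is j.+1 then onth s.2 j else None, [set r : reg | s.1 r == i]).

Definition bnd (m : nat) (s : store) : Prop :=
  (forall r, r <= R -> s.1 r <= m) /\ size s.2 <= m.

Definition stop_at (p : prim) (s : store) : nat :=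
  match p with
  | PInc r | PZero r | PSymNe r _ => s.1 r
  | POut _ => (size s.2).+1
  | PLt r r' => minn (s.1 r) (s.1 r')
  end.

Lemma stop_at_bnd p s m : prim_lt R.+1 p -> bnd m s -> stop_at p s <= m.+1.
Proof.
case: p => [r|r|b|r r'|r a] /= Hr [H1 H2]; rewrite ?ltnS //.
- exact: leqW (H1 _ Hr).
- exact: leqW (H1 _ Hr).
- by case/andP: Hr => Hr _; have := H1 r Hr; lia.
- exact: leqW (H1 _ Hr).
Qed.

Lemma psem_bnd z p s m : bnd m s -> bnd m.+1 (psem z p s).2.
Proof.
move=> [H1 H2]; have H1' r : r <= R -> s.1 r <= m.+1 by move/H1/leqW.
case: p => [r|r|b|r r'|r a] /=; split => //=; rewrite ?size_rcons //; try exact: leqW.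
- by move=> r' Hr'; case: eqP => [<-|_]; [exact: H1|exact: H1'].
- by move=> r' Hr'; case: ifP => // _; exact: H1'.
Qed.

Lemma in_cellof z s i r : r <= R -> (inord r \in marks (cellof z s i)) = (s.1 r == i).
Proof. by move=> Hr; rewrite inE inordK. Qed.

Lemma pstop_at z p s : prim_lt R.+1 p -> pstop p (cellof z s (stop_at p s)).
Proof.
case: p => [r|r|b|r r'|r a] /= Hr.
- by rewrite in_cellof.
- by rewrite in_cellof.
- by rewrite onth_default.
- by case/andP: Hr => *; rewrite !in_cellof //; lia.
- by rewrite in_cellof.
Qed.

Lemma pstop_lt z p s j : prim_lt R.+1 p -> j < stop_at p s -> ~~ pstop p (cellof z s j).
Proof.
case: p => [r|r|b|r r'|r a] /= Hr.
- by rewrite in_cellof //; lia.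
- by rewrite in_cellof //; lia.
- by case: j => //= j; rewrite ltnS -onthTE; case: (onth _ _).
- by case/andP: Hr => *; rewrite !in_cellof //; lia.
- by rewrite in_cellof //; lia.
Qed.

Lemma pres_at z p s : prim_lt R.+1 p -> pres p (cellof z s (stop_at p s)) = (psem z p s).1.
Proof.
case: p => [r|r|b|r r'|r a] //= Hr.
by case/andP: Hr => *; rewrite in_cellof //; lia.
Qed.

(** The home cell is updated last; resetting a register that is already 0 removes its mark from home
    and then puts it back. *)
Lemma prim_upd_cellof z p s : prim_lt R.+1 p ->
  prim_upd p (cellof z s) (stop_at p s) =1 cellof z (psem z p s).2.
Proof.
have mk r (Hr : r < R.+1) (r' : reg) : (r' == inord r) = (nat_of_ord r' == r).
  by rewrite -val_eqE /= inordK.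
case: p => [r|r|b|r r'|r a] Hr j; rewrite /prim_upd /upd /=.
- rewrite /cellof /=; case: (j =P 0) => [->|j0].
    case: (0 =P s.1 r) => E; rewrite -?E; congr (_, _); apply/setP => r'; rewrite !inE ?mk //;
      case: (nat_of_ord r' =P r) => [->|] //=; lia.
  case: (j =P (s.1 r).+1) => [->|nj].
    have -> : ((s.1 r).+1 == s.1 r) = false by lia.
    congr (_, _); apply/setP => r'; rewrite !inE mk //; case: (nat_of_ord r' =P r) => [->|] //=; lia.
  have j0' : (j == 0) = false by lia.
  case: (j =P s.1 r) => [E|nj']; rewrite -?E ?j0'; congr (_, _); apply/setP => r'; rewrite !inE ?mk //;
    case: (nat_of_ord r' =P r) => [->|] //=; lia.
- rewrite /cellof /=; case: (j =P 0) => [->|j0].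
    case: (0 =P s.1 r) => E; rewrite -?E; congr (_, _); apply/setP => r'; rewrite !inE ?mk //;
      case: (nat_of_ord r' =P r) => [->|] //=; lia.
  case: (j =P (s.1 r).+1) => [->|nj].
    have -> : ((s.1 r).+1 == s.1 r) = false by lia.
    congr (_, _); apply/setP => r'; rewrite !inE; case: (nat_of_ord r' =P r) => [->|] //=; lia.
  have j0' : (j == 0) = false by lia.
  case: (j =P s.1 r) => [E|nj']; rewrite -?E ?j0'; congr (_, _); apply/setP => r'; rewrite !inE ?mk //;
    case: (nat_of_ord r' =P r) => [->|] //=; lia.
- rewrite /cellof /=; case: (j =P 0) => [->|j0] //.
  case: (j =P (size s.2).+2) => [->|nj].
    have -> : ((size s.2).+2 == (size s.2).+1) = false by lia.
    congr (_, _, _); rewrite -/(onth s.2 (size s.2).+1) !onth_default ?size_rcons //.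
  case: (j =P (size s.2).+1) => [->|nj'].
    by rewrite -cats1 onth_cat ltnn subnn.
  case: j j0 nj nj' => // j _ nj nj'; rewrite -cats1 onth_cat.
  case: ltnP => // le_j; rewrite !onth_default //= ; lia.
- by case: (j =P 0) => [->|j0] //=; case: eqP => [->|_] //; case: eqP => [->|_] //; case: eqP => [->|_].
- by case: (j =P 0) => [->|j0] //=; case: eqP => [->|_] //; case: eqP => [->|_] //; case: eqP => [->|_].
Qed.

(** A primitive raises the largest value by at most one, so no stop cell lies beyond [m + n + 1],
    and each of the [n] primitives costs at most [2 * (m + n) + 5] steps. *)
Lemma compile_run z c s n b s' : bs z c s n b s' -> forall m t, regs_lt R.+1 c -> bnd m s ->
  rep (cellof z s) 0 t ->
  [/\ bnd (m + n) s' & exists k t', [/\ k <= n * (2 * (m + n) + 5),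
      freach (fentry (compile c)) t k b t' & rep (cellof z s') 0 t']].
Proof.
elim=> {c s n b s'}.
- move=> p s m t Hp Hm Ht; rewrite addn1; split; first exact: psem_bnd.
  have [j||t' H1 H2] := prim_run (p := p) (i := stop_at p s) _ _ (pstop_at z s Hp) Ht => //.
    by move=> ?; exact: pstop_lt.
  exists (2 * stop_at p s + 3), t'; split; last exact: rep_eq (prim_upd_cellof z s Hp) H2.
    by have := stop_at_bnd Hp Hm; lia.
  by rewrite -pres_at.
- move=> c1 c2 s n1 b1 s1 n2 b2 s2 _ IH1 _ IH2 m t /= /andP[Hc1 Hc2] Hm Ht.
  have [Hm1 [k1 [t1 [Hk1 R1 Ht1]]]] := IH1 _ _ Hc1 Hm Ht.
  have [Hm2 [k2 [t2 [Hk2 R2 Ht2]]]] := IH2 _ _ Hc2 Hm1 Ht1.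
  split; first by rewrite addnA.
  exists (k1 + k2), t2; split => //; first nia.
  apply: (freach_cont (f' := seq_frag _ _) (inj := inl) (fun _ _ => erefl _) R1 (erefl _) _).
  exact: (freach_exit (f' := seq_frag _ _) (inj := inr) (fun _ _ => erefl _) R2 (erefl _)).
- move=> c c1 c2 s n1 b1 s1 n2 b2 s2 _ IH1 _ IH2 m t /= /and3P[Hc Hc1 Hc2] Hm Ht.
  have [Hm1 [k1 [t1 [Hk1 R1 Ht1]]]] := IH1 _ _ Hc Hm Ht.
  have Hcb : regs_lt R.+1 (if b1 then c1 else c2) by case: (b1).
  have [Hm2 [k2 [t2 [Hk2 R2 Ht2]]]] := IH2 _ _ Hcb Hm1 Ht1.
  split; first by rewrite addnA.
  exists (k1 + k2), t2; split => //; first nia.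
  case: (b1) R1 R2 => R1 R2;
    apply: (freach_cont (f' := if_frag _ _ _) (inj := inl) (fun _ _ => erefl _) R1 (erefl _) _).
    exact: (freach_exit (f' := if_frag _ _ _) (inj := fun q => inr (inl q)) (fun _ _ => erefl _) R2 (erefl _)).
  exact: (freach_exit (f' := if_frag _ _ _) (inj := fun q => inr (inr q)) (fun _ _ => erefl _) R2 (erefl _)).
- move=> c c1 s n s1 _ IH m t /= /andP[Hc Hc1] Hm Ht.
  have [Hm1 [k1 [t1 [Hk1 R1 Ht1]]]] := IH _ _ Hc Hm Ht.
  split=> //; exists k1, t1; split => //.
  exact: (freach_exit (f' := while_frag _ _) (inj := inl) (fun _ _ => erefl _) R1 (erefl _)).
- move=> c c1 s n1 s1 n2 b2 s2 n3 b3 s3 _ IH1 _ IH2 _ IH3 m t Hw Hm Ht.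
  have /andP[Hc Hc1] := Hw.
  have [Hm1 [k1 [t1 [Hk1 R1 Ht1]]]] := IH1 _ _ Hc Hm Ht.
  have [Hm2 [k2 [t2 [Hk2 R2 Ht2]]]] := IH2 _ _ Hc1 Hm1 Ht1.
  have [Hm3 [k3 [t3 [Hk3 R3 Ht3]]]] := IH3 _ _ Hw Hm2 Ht2.
  split; first by rewrite !addnA.
  exists (k1 + (k2 + k3)), t3; split => //; first nia.
  apply: (freach_cont (f' := while_frag _ _) (inj := inl) (fun _ _ => erefl _) R1 (erefl _) _).
  exact: (freach_cont (f' := while_frag _ _) (inj := inr) (fun _ _ => erefl _) R2 (erefl _) R3).
Qed.

Section TopLevel.
Variable f : frag.

(* The first two steps put the home cell, carrying every register mark, left of the input. *)
Definition top_delta (q : option (option (fQ f + bool))) (g : cell) :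
    option (option (option (fQ f + bool)) * cell * move) :=
  match q with
  | None => Some (Some None, g, MoveL)
  | Some None => Some (Some (Some (inl (fentry f))), (true, None, None, setT), Stay)
  | Some (Some (inl q)) => let: (r, g', d) := fdelta q g in Some (Some (Some r), g', d)
  | Some (Some (inr _)) => None
  end.

Definition tm_of : TM :=
  @MkTM (option (option (fQ f + bool))) cell blank
    (fun a => (false, Some a, None, set0)) (fun g => cout g) None top_delta
    (fun q => if q is Some (Some (inr b)) then b else false).

Definition cfg (q : fQ f + bool) (t : tape) : config tm_of :=
  (Some (Some q), t.1.1, t.1.2, t.2).

Lemma tm_of_exec q t n b t' : freach q t n b t' ->
  exec n (cfg (inl q) t) = Some (cfg (inr b) t').
Proof.
elim=> {q t n b t'} [q t b g d E|q t q' g d n b t' E _ IH].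
  case: t E => [[l g0] r] /= ->; by case: d; [case: l|case: r|].
rewrite -{}IH; case: t E => [[l g0] r] /= ->; by case: d; [case: l|case: r|].
Qed.

End TopLevel.

Definition store0 : store := (fun=> 0, [::]).

Lemma tm_of_run z c n b s : bs z c store0 n b s -> regs_lt R.+1 c ->
  exists c', [/\ @halts_within (tm_of (compile c)) z (n * (2 * n + 5) + 2) c',
     accepting c' = b & tape_output c' = s.2].
Proof.
move=> Hbs Hc.
pose M := tm_of (compile c).
have [t0 E0 Ht0] : exists2 t, exec 2 (init_config M z) = Some (cfg (inl (fentry (compile c))) t)
     & rep (cellof z store0) 0 t.
  have cell0 i : [set r : reg | store0.1 r == i] = if i == 0 then setT else set0.
    by apply/setP => r; case: i => [|i]; rewrite !inE.
  case: z {Hbs} => [|a z].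
    exists ([::], (true, None, None, setT), [:: blank]) => //.
    split; rewrite // /cellof ?cell0 // => -[|i]; rewrite add1n cell0 //.
    by rewrite [sym _ _]onth0n /= nth_nil.
  exists ([::], (true, None, None, setT), [seq ((false, Some b, None, set0) : cell) | b <- a :: z]) => //.
  split; rewrite // /cellof ?cell0 // => i; rewrite add1n cell0 onth0n.
  have -> : sym (a :: z) i.+1 = onth (a :: z) i by [].
  move: (a :: z) => w; rewrite [(_, _).2]/=.
  case: (ltnP i (size w)) => Hi; last by rewrite nth_default ?size_map // onth_default.
  by rewrite (nth_map a) // onthE (nth_map a).
have [_ [k [t [Hk R1 [/= E1 E2 E3]]]]] :=
  compile_run Hbs (m := 0) Hc (conj (fun _ _ => leqnn 0) (leqnn 0)) Ht0.
exists (cfg (inr b) t : config M); split => //.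
  exists (k + 2); split => //; first lia.
  have execD n1 n2 (c1 c2 c3 : config M) : exec n1 c1 = Some c2 -> exec n2 c2 = Some c3 ->
      exec (n1 + n2) c1 = Some c3.
    by elim: n1 c1 => [|n1 IH] c1 /=; [case=> -> |case: (step c1) => // c1' /IH].
  by rewrite addnC; apply: execD E0 _; exact: tm_of_exec R1.
rewrite -[LHS]/(pmap (@tout M) (rev t.1.1 ++ t.1.2 :: t.2)) E1 E2.
rewrite -[LHS]/(pmap (@tout M) t.2).
(* The right part is known only up to trailing blanks, which output nothing. *)
suff H (r : seq cell) (o : seq bool) : (forall i, cout (nth blank r i) = onth o i) -> 
     pmap (@tout M) r = o.
  by apply: H => i; rewrite E3.
elim: r o => [|g r IH] [|b' o] H //=.
- by have := H 0.
- have /= -> := H 0; by apply: (IH [::]) => i; rewrite onth0n; exact: (H i.+1).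
- by have /= -> := H 0; rewrite -[LHS]/(b' :: pmap (@tout M) r) (IH o) // => i; exact: (H i.+1).
Qed.

End Machine.

(** * Functions computable with polynomially bounded counters *)

(** The base [n.+2] is at least 2, so constants, sums and products are all absorbed by the
    exponent. *)
Definition polyb (g : nat -> nat) := exists p, forall n, g n <= n.+2 ^ p.

Lemma polybW f g : (forall n, f n <= g n) -> polyb g -> polyb f.
Proof. by move=> Hfg [p Hp]; exists p => n; apply: leq_trans (Hfg n) (Hp n). Qed.

Lemma polyb_const c : polyb (fun=> c).
Proof.
exists c => n; apply: leq_trans (ltnW (ltn_expl c (isT : 1 < 2))) _.
by case: c => // c; rewrite leq_exp2r.
Qed.

Lemma polyb_id : polyb id.
Proof. by exists 1 => n; rewrite expn1; lia. Qed.

Lemma polybD f g : polyb f -> polyb g -> polyb (fun n => f n + g n).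
Proof.
move=> [p Hp] [q Hq]; exists (p + q).+1 => n; rewrite expnS.
have H a b : n.+2 ^ a <= n.+2 ^ (a + b) by rewrite leq_pexp2l // leq_addr.
have := H p q; have := H q p; rewrite [q + p]addnC.
by have := Hp n; have := Hq n; nia.
Qed.

Lemma polybM f g : polyb f -> polyb g -> polyb (fun n => f n * g n).
Proof.
by move=> [p Hp] [q Hq]; exists (p + q) => n; rewrite expnD leq_mul.
Qed.

Lemma polybX f k : polyb f -> polyb (fun n => f n ^ k).
Proof.
move=> Hf; elim: k => [|k IH]; first exact: (polyb_const 1).
by apply: polybW (polybM Hf IH) => n; rewrite expnS.
Qed.

Lemma polyb_comp f g : polyb f -> polyb g -> polyb (fun n => f (g n)).
Proof.
move=> [p Hp] Hg; apply: polybW (fun n => Hp (g n)) _; apply: polybX.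
by apply: polybW (polybD Hg (polyb_const 2)) => n; rewrite addn2.
Qed.

Ltac polyb := repeat first
  [ exact: polyb_id | exact: polyb_const | assumption
  | apply: polybD | apply: polybM | apply: polybX ].

Definition runs (z : word) c s T s' := exists n b, n <= T /\ bs z c s n b s'.

Lemma runsW z c s T T' s' : T <= T' -> runs z c s T s' -> runs z c s T' s'.
Proof. by move=> le_T [n [b [le_n H]]]; exists n, b; split => //; exact: leq_trans le_T. Qed.

Lemma runs_prim z p s : runs z (Prim p) s 1 (psem z p s).2.
Proof. by exists 1, (psem z p s).1; split => //; exact: BsPrim. Qed.

Lemma runs_seq z c1 c2 s T1 s1 T2 s2 :
  runs z c1 s T1 s1 -> runs z c2 s1 T2 s2 -> runs z (Seq c1 c2) s (T1 + T2) s2.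
Proof.
move=> [n1 [b1 [H1 R1]]] [n2 [b2 [H2 R2]]]; exists (n1 + n2), b2.
by split; [exact: leq_add | exact: BsSeq R1 R2].
Qed.

Lemma runs_if z p c1 c2 s T s' :
  runs z (if (psem z p s).1 then c1 else c2) (psem z p s).2 T s' ->
  runs z (If (Prim p) c1 c2) s T.+1 s'.
Proof.
move=> [n [b [H1 R1]]]; exists (1 + n), b; split; first by rewrite add1n.
exact: BsIf (BsPrim _ _ _) R1.
Qed.

(** The invariant fixes the counter and the limit, so the number of rounds is known beforehand
    whatever the body computes. *)
Lemma runs_while_lt z i d c (P : nat -> store -> Prop) m T s :
  (forall j s, P j s -> s.1 i = j /\ s.1 d = m) ->
  (forall j s, j < m -> P j s -> exists2 s', runs z c s T s' & P j.+1 s') -> P 0 s ->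
  exists2 s', runs z (While (Prim (PLt i d)) c) s (m * T.+1 + 1) s' & P m s'.
Proof.
move=> Hid Hc H0.
suff H k : k <= m -> forall s, P (m - k) s ->
    exists2 s', runs z (While (Prim (PLt i d)) c) s (k * T.+1 + 1) s' & P m s'.
  by apply: H => //; rewrite subnn.
elim: k => [_ {H0}s H0|k IH lt_km {H0}s H0]; have [Ei Ed] := Hid _ _ H0.
  exists s; last by rewrite subn0 in H0.
  have R1 := BsPrim z (PLt i d) s; rewrite /= Ei Ed subn0 ltnn in R1.
  by exists 1, false; split => //; exact: BsWhileF R1.
have [|s1 [n1 [b1 [H1 R1]]] P1] := Hc _ _ _ H0; first by lia.
have [||s2 [n2 [b2 [H2 R2]]] P2] := IH _ s1; first by lia.
  by have -> : m - k = (m - k.+1).+1 by lia.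
exists s2 => //; exists (1 + n1 + n2), b2; split; first by lia.
apply: BsWhileT R1 R2; have := BsPrim z (PLt i d) s; rewrite /= Ei Ed.
by have -> : m - k.+1 < m by lia.
Qed.

Definition keep (d : nat) (s s' : store) := forall r, r < d -> s'.1 r = s.1 r.

Lemma keep_trans d d' s s' s'' : d <= d' -> keep d s s' -> keep d' s' s'' -> keep d s s''.
Proof. by move=> le_d H1 H2 r Hr; rewrite H2 ?H1 //; lia. Qed.

Lemma keep_setr d s r v : d <= r -> keep d s (setr s r v).
Proof. by move=> le_d r' Hr' /=; case: eqP => // ?; lia. Qed.

Definition skip := Prim (PLt 0 0).
Definition copy r r' := Seq (Prim (PZero r)) (While (Prim (PLt r r')) (Prim (PInc r))).

Lemma runs_copy z r r' s : r != r' ->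
  exists s', [/\ runs z (copy r r') s (2 * s.1 r' + 2) s', s'.2 = s.2, s'.1 r = s.1 r'
    & forall q, q != r -> s'.1 q = s.1 q].
Proof.
move=> Hr; pose P j (s' : store) :=
  [/\ s'.1 r = j, s'.2 = s.2 & forall q, q != r -> s'.1 q = s.1 q].
have [|||s' R1 [E1 E2 E3]] := @runs_while_lt z r r' (Prim (PInc r)) P (s.1 r') 1 (setr s r 0).
- by move=> j s1 [E1 E2 E3]; rewrite E1 E3 // eq_sym.
- move=> j s1 _ [E1 E2 E3]; eexists; first exact: runs_prim.
  split=> //=; first by rewrite eqxx E1.
  by move=> q Hq; rewrite (negbTE Hq) E3.
- by split=> //= [|q Hq]; rewrite ?eqxx // (negbTE Hq).
exists s'; split => //; apply: runsW (runs_seq (runs_prim z (PZero r) s) R1); lia.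
Qed.

(** An environment in the style of de Bruijn, with the newest variable last; the same type lists the
    registers of the variables. *)
Fixpoint ctx k : Type := if k is k'.+1 then (ctx k' * nat)%type else unit.

Fixpoint ctx_le N k : ctx k -> Prop :=
  match k with
  | 0 => fun=> True
  | k'.+1 => fun e => ctx_le N e.1 /\ e.2 <= N
  end.

(* [e] gives the values of the variables, [v] the registers that hold them. *)
Fixpoint holds (s : store) (d N k : nat) : ctx k -> ctx k -> Prop :=
  match k with
  | 0 => fun _ _ => True
  | k'.+1 => fun v e => holds s d N v.1 e.1 /\ [/\ v.2 < d, s.1 v.2 = e.2 & e.2 <= N]
  end.

Lemma holds_le s d N k (v e : ctx k) : holds s d N v e -> ctx_le N e.
Proof. by elim: k v e => [|k IH] v e //= [/IH H [_ _ ?]]. Qed.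

Lemma holds_keep s s' d d' N k (v e : ctx k) :
  d <= d' -> keep d s s' -> holds s d N v e -> holds s' d' N v e.
Proof.
move=> le_d Hk; elim: k v e => [|k IH] v e //= [H [H1 H2 H3]].
by split; [exact: IH|split => //; [exact: leq_trans le_d|rewrite Hk]].
Qed.

(** * Clamped computation of functions of several variables *)

Section Computable.
Variable Bd : nat -> nat.
Hypothesis Bd_gt : forall n, n + 1 < Bd n.

Definition ready (z : word) (N d : nat) (s : store) :=
  [/\ Bd (size z) <= N, 0 < d & s.1 0 = N].

Lemma ready_keep z N d d' s s' : d <= d' -> keep d s s' -> ready z N d s -> ready z N d' s'.
Proof. by move=> le_d Hk [H1 H2 H3]; split => //; [lia | rewrite Hk]. Qed.

(* Register 0 holds [N] and all values are clamped to it, so that the running time of a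
   loop nest is polynomial in [N] by construction. *)
Definition cpt k (f : word -> ctx k -> nat) :=
  exists (code : ctx k -> nat -> cmd) (T : nat -> nat), polyb T /\
  forall z N v e d s, ready z N d s -> holds s d N v e ->
  exists s', [/\ runs z (code v d) s (T N) s', s'.2 = s.2, keep d s s'
    & s'.1 d = minn N (f z e)].

Definition cgen k (G : word -> ctx k -> seq bool) :=
  exists (code : ctx k -> nat -> cmd) (T : nat -> nat), polyb T /\
  forall z N v e d s, ready z N d s -> holds s d N v e ->
  exists s', [/\ runs z (code v d) s (T N) s', s'.2 = s.2 ++ G z e & keep d s s'].

(** These are the functions that no admissible clamp alters. *)
Definition small k (f : word -> ctx k -> nat) :=
  forall z N e, Bd (size z) <= N -> ctx_le N e -> f z e <= N.

Definition cptb k (P : word -> ctx k -> bool) := cpt (fun z e => P z e : nat).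

Lemma cpt_ext k (f g : word -> ctx k -> nat) : (forall z e, f z e = g z e) -> cpt f -> cpt g.
Proof.
move=> E [c [T [HT H]]]; exists c, T; split=> // z N v e d s Hs He.
by have [s' ?] := H _ _ _ _ _ _ Hs He; exists s'; rewrite -E.
Qed.

Lemma cgen_ext k (f g : word -> ctx k -> seq bool) : (forall z e, f z e = g z e) -> cgen f -> cgen g.
Proof.
move=> E [c [T [HT H]]]; exists c, T; split=> // z N v e d s Hs He.
by have [s' ?] := H _ _ _ _ _ _ Hs He; exists s'; rewrite -E.
Qed.

Lemma cpt_var k : cpt (fun z (e : ctx k.+1) => e.2).
Proof.
exists (fun v d => copy d v.2), (fun N => 2 * N + 2); split; first by polyb.
move=> z N v e d s _ /= [_ [lt_d E le_N]].
have [|s' [R E1 E2 H]] := runs_copy z s (r := d) (r' := v.2); first by lia.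
exists s'; split => //; first by apply: runsW R; lia.
- by move=> r Hr; apply: H; lia.
- by rewrite E2 E; lia.
Qed.

Lemma cpt_weak k (f : word -> ctx k -> nat) : cpt f -> cpt (fun z (e : ctx k.+1) => f z e.1).
Proof.
move=> [c [T [HT H]]]; exists (fun v d => c v.1 d), T; split => // z N v e d s Hs /= [He _].
exact: H.
Qed.

Lemma cpt_succ k (f : word -> ctx k -> nat) : cpt f -> cpt (fun z e => (f z e).+1).
Proof.
move=> [c [T [HT H]]].
exists (fun v d => Seq (c v d) (If (Prim (PLt d 0)) (Prim (PInc d)) skip)), (fun N => T N + 2).
split; first by polyb.
move=> z N v e d s Hs He; have [s1 [R1 E1 K1 V1]] := H _ _ _ _ _ _ Hs He.
have [_ d0 EN] := ready_keep (leqnn d) K1 Hs.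
case: (ltnP (f z e) N) => HN.
  exists (setr s1 d (s1.1 d).+1); split => //.
  - apply: runs_seq R1 _; apply: runs_if.
    by rewrite /= ifT; [exact: (runs_prim z (PInc d) s1) | rewrite EN V1; lia].
  - exact: keep_trans (leqnn d) K1 (keep_setr _ _ (leqnn d)).
  - by rewrite /= eqxx V1; lia.
exists s1; split => //; last by rewrite V1; lia.
apply: runs_seq R1 _; apply: runs_if.
by rewrite /= ifF; [exact: (runs_prim z (PLt 0 0) s1) | rewrite EN V1; lia].
Qed.

Lemma cpt0 k : cpt (fun z (e : ctx k) => 0).
Proof.
exists (fun v d => Prim (PZero d)), (fun N => 1); split; first by polyb.
move=> z N v e d s _ _; exists (setr s d 0); split => //.
- exact: (runs_prim z (PZero d)).
- exact: keep_setr.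
- by rewrite /= eqxx minn0.
Qed.

Lemma cpt_const k c : cpt (fun z (e : ctx k) => c).
Proof. by elim: c => [|c IH]; [exact: cpt0 | exact: cpt_succ IH]. Qed.

Definition setb d b := if b then Seq (Prim (PZero d)) (Prim (PInc d)) else Prim (PZero d).

Lemma runs_setb z d b s : exists s', [/\ runs z (setb d b) s 2 s', s'.2 = s.2, keep d s s'
  & s'.1 d = b].
Proof.
case: b.
  exists (psem z (PInc d) (setr s d 0)).2; split=> //.
  - exact: runs_seq (runs_prim z (PZero d) s) (runs_prim z (PInc d) _).
  - exact: keep_trans (leqnn d) (keep_setr _ _ (leqnn d)) (keep_setr _ _ (leqnn d)).
  - by rewrite /= !eqxx.
exists (setr s d 0); split => //.
- by apply: runsW (runs_prim z (PZero d) s).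
- exact: keep_setr.
- by rewrite /= eqxx.
Qed.

Lemma N_gt0 z N d s : ready z N d s -> size z + 1 < N.
Proof. by case=> H _ _; apply: leq_trans H; exact: Bd_gt. Qed.

Lemma sym_minn z N p : size z < N -> sym z (minn N p) = sym z p.
Proof.
move=> HN; case: (leqP p N) => // lt_p; case: N p HN lt_p => // N [//|p] HN lt_p.
by rewrite /= !onth_default //; lia.
Qed.

Lemma cptb_sym k (f : word -> ctx k -> nat) a : cpt f -> cptb (fun z e => sym z (f z e) == a).
Proof.
move=> [c [T [HT H]]].
exists (fun v d => Seq (c v d) (If (Prim (PSymNe d a)) (setb d false) (setb d true))),
  (fun N => T N + 3); split; first by polyb.
move=> z N v e d s Hs He; have [s1 [R1 E1 K1 V1]] := H _ _ _ _ _ _ Hs He.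
have HN := N_gt0 Hs.
have [s2 [R2 E2 K2 V2]] := runs_setb z d (sym z (f z e) == a) s1.
exists s2; split.
- apply: runs_seq R1 _; apply: runs_if => /=; rewrite V1 sym_minn; last by lia.
  by case: eqP R2.
- by rewrite E2.
- exact: keep_trans K1 K2.
- by rewrite V2; case: eqP; lia.
Qed.

(** Only the right-hand side has to be small: if [g <= N], clamping [f] at [N] cannot change the
    truth of [f < g]. *)
Lemma cptb_lt k (f g : word -> ctx k -> nat) : small g -> cpt f -> cpt g ->
  cptb (fun z e => f z e < g z e).
Proof.
move=> Hg [c [T [HT H]]] [c' [T' [HT' H']]].
exists (fun v d => Seq (c v d) (Seq (c' v d.+1)
   (If (Prim (PLt d d.+1)) (setb d true) (setb d false)))),
  (fun N => T N + (T' N + 3)); split; first by polyb.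
move=> z N v e d s Hs He; have [s1 [R1 E1 K1 V1]] := H _ _ _ _ _ _ Hs He.
have [] := H' _ _ _ _ _ _ (ready_keep (leqnSn d) K1 Hs) (holds_keep (leqnSn d) K1 He).
move=> s2 [R2 E2 K2 V2].
have HN := N_gt0 Hs.
have [s3 [R3 E3 K3 V3]] := runs_setb z d (f z e < g z e) s2.
have gN : g z e <= N by apply: Hg; [case: Hs | exact: holds_le He].
exists s3; split.
- apply: runs_seq R1 _; apply: runs_seq R2 _; apply: runs_if => /=.
  rewrite V2 K2 // V1; have -> : (minn N (f z e) < minn N (g z e)) = (f z e < g z e) by lia.
  by case: ltnP R3.
- by rewrite E3 E2.
- by apply: keep_trans (leqnn _) _ K3; apply: keep_trans K1 K2.
- by rewrite V3; case: ltnP; lia.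
Qed.

Lemma cpt_if k P (f g : word -> ctx k -> nat) : cptb P -> cpt f -> cpt g ->
  cpt (fun z e => if P z e then f z e else g z e).
Proof.
move=> [c0 [T0 [HT0 H0]]] [c [T [HT H]]] [c' [T' [HT' H']]].
exists (fun v d => Seq (c0 v d) (Seq (Prim (PZero d.+1)) (If (Prim (PLt d.+1 d)) (c v d) (c' v d)))),
  (fun N => T0 N + (1 + (T N + T' N + 1))); split; first by polyb.
move=> z N v e d s Hs He; have [s1 [R1 E1 K1 V1]] := H0 _ _ _ _ _ _ Hs He.
have HN := N_gt0 Hs.
pose s2 := setr s1 d.+1 0.
have K2 : keep d s s2 by apply: keep_trans K1 _; [exact: leqnn | exact: keep_setr].
have V2 : (s2.1 d.+1 < s2.1 d) = P z e.
  by rewrite /= eqxx ltn_eqF // V1; case: (P z e) => /=; lia.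
have Hs2 := ready_keep (leqnn d) K2 Hs; have He2 := holds_keep (leqnn d) K2 He.
have [s3 [R3 E3 K3 V3]] : exists s3, [/\ runs z (if P z e then c v d else c' v d) s2 (T N + T' N) s3,
    s3.2 = s2.2, keep d s2 s3 & s3.1 d = minn N (if P z e then f z e else g z e)].
  case: (P z e).
    have [s3 [R3 ? ? ?]] := H _ _ _ _ _ _ Hs2 He2; exists s3; split => //; apply: runsW R3; lia.
  have [s3 [R3 ? ? ?]] := H' _ _ _ _ _ _ Hs2 He2; exists s3; split => //; apply: runsW R3; lia.
exists s3; split => //.
- apply: runs_seq R1 _; apply: runs_seq (runs_prim z (PZero d.+1) _) _.
  by rewrite addn1; apply: runs_if => /=; rewrite -/s2 V2.
- by rewrite E3.
- exact: keep_trans K2 K3.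
Qed.

Lemma cgen_if k P (f g : word -> ctx k -> seq bool) : cptb P -> cgen f -> cgen g ->
  cgen (fun z e => if P z e then f z e else g z e).
Proof.
move=> [c0 [T0 [HT0 H0]]] [c [T [HT H]]] [c' [T' [HT' H']]].
exists (fun v d => Seq (c0 v d) (Seq (Prim (PZero d.+1)) (If (Prim (PLt d.+1 d)) (c v d) (c' v d)))),
  (fun N => T0 N + (1 + (T N + T' N + 1))); split; first by polyb.
move=> z N v e d s Hs He; have [s1 [R1 E1 K1 V1]] := H0 _ _ _ _ _ _ Hs He.
have HN := N_gt0 Hs.
pose s2 := setr s1 d.+1 0.
have K2 : keep d s s2 by apply: keep_trans K1 _; [exact: leqnn | exact: keep_setr].
have V2 : (s2.1 d.+1 < s2.1 d) = P z e.
  by rewrite /= eqxx ltn_eqF // V1; case: (P z e) => /=; lia.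
have Hs2 := ready_keep (leqnn d) K2 Hs; have He2 := holds_keep (leqnn d) K2 He.
have [s3 [R3 E3 K3]] : exists s3, [/\ runs z (if P z e then c v d else c' v d) s2 (T N + T' N) s3,
    s3.2 = s2.2 ++ (if P z e then f z e else g z e) & keep d s2 s3].
  case: (P z e).
    have [s3 [R3 ? ?]] := H _ _ _ _ _ _ Hs2 He2; exists s3; split => //; apply: runsW R3; lia.
  have [s3 [R3 ? ?]] := H' _ _ _ _ _ _ Hs2 He2; exists s3; split => //; apply: runsW R3; lia.
exists s3; split => //.
- apply: runs_seq R1 _; apply: runs_seq (runs_prim z (PZero d.+1) _) _.
  by rewrite addn1; apply: runs_if => /=; rewrite -/s2 V2.
- by rewrite E3 /= E1.
- exact: keep_trans K2 K3.
Qed.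

(** The program for [f] receives the clamped value of [a]; the hypothesis says that this does not
    show in the clamped result. *)
Lemma cpt_let k (a : word -> ctx k -> nat) (f : word -> ctx k.+1 -> nat) :
  (forall z N e, Bd (size z) <= N -> ctx_le N e ->
     minn N (f z (e, minn N (a z e))) = minn N (f z (e, a z e))) ->
  cpt a -> cpt f -> cpt (fun z e => f z (e, a z e)).
Proof.
move=> Hf [c [T [HT H]]] [c' [T' [HT' H']]].
exists (fun v d => Seq (c v d) (Seq (c' (v, d) d.+1) (copy d d.+1))),
  (fun N => T N + (T' N + (2 * N + 2))); split; first by polyb.
move=> z N v e d s Hs He; have [s1 [R1 E1 K1 V1]] := H _ _ _ _ _ _ Hs He.
have [] := H' z N (v, d) (e, minn N (a z e)) _ _ (ready_keep (leqnSn d) K1 Hs) _.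
  by split; [exact: holds_keep K1 He | split => //=; lia].
move=> s2 [R2 E2 K2]; rewrite Hf; [move=> V2|by case: Hs|exact: holds_le He].
have [|s3 [R3 E3 V3 K3]] := runs_copy z s2 (r := d) (r' := d.+1); first by lia.
exists s3; split.
- by apply: runs_seq R1 (runs_seq R2 (runsW _ R3)); lia.
- by rewrite E3 E2.
- by move=> r Hr; rewrite K3 ?K2 ?K1 //; lia.
- by rewrite V3.
Qed.

(** Primitive recursion, from which the arithmetic is derived. Register [d] holds the limit, [d.+1]
    the accumulator, [d.+2] the counter, and [f] is evaluated from [d.+3] on. The accumulator is
    clamped in every round, which the second hypothesis makes harmless. *)
Lemma cpt_iteri k (m a : word -> ctx k -> nat) (f : word -> ctx k.+2 -> nat) :
  small m ->
  (forall z N e i x, Bd (size z) <= N -> ctx_le N e -> i < m z e ->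
     minn N (f z (e, i, minn N x)) = minn N (f z (e, i, x))) ->
  cpt m -> cpt a -> cpt f ->
  cpt (fun z e => iteri (m z e) (fun i x => f z (e, i, x)) (a z e)).
Proof.
move=> Hm Hf [c1 [T1 [HT1 H1]]] [c2 [T2 [HT2 H2]]] [c3 [T3 [HT3 H3]]].
exists (fun v d => Seq (c1 v d) (Seq (c2 v d.+1) (Seq (Prim (PZero d.+2))
   (Seq (While (Prim (PLt d.+2 d))
       (Seq (c3 (v, d.+2, d.+1) d.+3) (Seq (copy d.+1 d.+3) (Prim (PInc d.+2)))))
     (copy d d.+1))))),
  (fun N => T1 N + (T2 N + (1 + (N * (T3 N + (2 * N + 2 + 1) + 1) + 1 + (2 * N + 2))))).
split; first by polyb.
move=> z N v e d s Hs He; have [s1 [R1 E1 K1 V1]] := H1 _ _ _ _ _ _ Hs He.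
have [] := H2 _ _ _ _ _ _ (ready_keep (leqnSn d) K1 Hs) (holds_keep (leqnSn d) K1 He).
move=> s2 [R2 E2 K2 V2].
have HB : Bd (size z) <= N by case: Hs.
have eN := holds_le He; have mN : m z e <= N by exact: Hm.
rewrite (minn_idPr mN) in V1.
pose F i := iteri i (fun i x => f z (e, i, x)) (a z e).
pose P j (t : store) := [/\ keep d s t, t.1 d = m z e, t.1 d.+2 = j,
   t.1 d.+1 = minn N (F j) & t.2 = s.2].
have [|||s4 R4 [K4 _ _ V4 E4]] := @runs_while_lt z d.+2 d
   (Seq (c3 (v, d.+2, d.+1) d.+3) (Seq (copy d.+1 d.+3) (Prim (PInc d.+2)))) P (m z e)
   (T3 N + (2 * N + 2 + 1)) (setr s2 d.+2 0).
- by move=> j t [].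
- move=> j t lt_jm [Kt Et1 Et2 Et3 Et4].
  have [] := H3 z N (v, d.+2, d.+1) (e, j, minn N (F j)) d.+3 t.
  + by apply: ready_keep Hs; rewrite ?leqW.
  + by split; [split; [apply: holds_keep He; rewrite ?leqW // |]|]; split=> //=; lia.
  move=> t1 [Rt1 Ot1 Kt1]; rewrite Hf // => Vt1.
  have [|t2 [Rt2 Ot2 Vt2 Kt2]] := runs_copy z t1 (r := d.+1) (r' := d.+3); first by lia.
  exists (setr t2 d.+2 (t2.1 d.+2).+1).
    apply: runs_seq Rt1 (runs_seq (runsW _ Rt2) (runs_prim z (PInc d.+2) t2)); lia.
  have lt1 r : r < d.+3 -> t1.1 r = t.1 r by move/Kt1.
  split; rewrite /= ?eqxx ?Ot2 ?Ot1 //.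
  + by move=> r Hr /=; rewrite ltn_eqF 1?Kt2 ?Kt1 ?Kt //; lia.
  + by rewrite ltn_eqF // Kt2 ?lt1 //; lia.
  + by rewrite Kt2 ?lt1 ?Et2 //; lia.
  + by rewrite ltn_eqF // Vt2 Vt1.
- split; rewrite /= ?eqxx ?E2 //.
  + by move=> r Hr /=; rewrite ltn_eqF 1?K2 ?K1 //; lia.
  + by rewrite ltn_eqF // K2.
  + by rewrite ltn_eqF // V2.
have [|s5 [R5 E5 V5 K5]] := runs_copy z s4 (r := d) (r' := d.+1); first by lia.
exists s5; split.
- apply: runs_seq R1 (runs_seq R2 (runs_seq (runs_prim z (PZero d.+2) s2) (runs_seq (runsW _ R4) (runsW _ R5)))).
    by rewrite leq_add2r leq_mul //; lia.
  by rewrite V4; lia.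
- by rewrite E5.
- by move=> r Hr; rewrite K5 ?K4 //; lia.
- by rewrite V5 V4.
Qed.

Lemma cgen_bit k b : cgen (fun z (e : ctx k) => [:: b]).
Proof.
exists (fun v d => Prim (POut b)), (fun N => 1); split; first by polyb.
move=> z N v e d s _ _; exists (s.1, rcons s.2 b); split => //; last by rewrite cats1.
exact: (runs_prim z (POut b)).
Qed.

Lemma cgen_nil k : cgen (fun z (e : ctx k) => [::]).
Proof.
exists (fun v d => skip), (fun N => 1); split; first by polyb.
move=> z N v e d s _ _; exists s; split => //; last by rewrite cats0.
exact: (runs_prim z (PLt 0 0)).
Qed.

Lemma cgen_cat k (f g : word -> ctx k -> seq bool) :
  cgen f -> cgen g -> cgen (fun z e => f z e ++ g z e).
Proof.
move=> [c [T [HT H]]] [c' [T' [HT' H']]].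
exists (fun v d => Seq (c v d) (c' v d)), (fun N => T N + T' N); split; first by polyb.
move=> z N v e d s Hs He; have [s1 [R1 E1 K1]] := H _ _ _ _ _ _ Hs He.
have [s2 [R2 E2 K2]] := H' _ _ _ _ _ _ (ready_keep (leqnn d) K1 Hs) (holds_keep (leqnn d) K1 He).
exists s2; split; first exact: runs_seq R1 R2.
- by rewrite E2 E1 catA.
- exact: keep_trans K1 K2.
Qed.

Lemma cgen_for k (m : word -> ctx k -> nat) (G : word -> ctx k.+1 -> seq bool) :
  small m -> cpt m -> cgen G ->
  cgen (fun z e => flatten [seq G z (e, i) | i <- iota 0 (m z e)]).
Proof.
move=> Hm [c1 [T1 [HT1 H1]]] [c3 [T3 [HT3 H3]]].
exists (fun v d => Seq (c1 v d) (Seq (Prim (PZero d.+1))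
   (While (Prim (PLt d.+1 d)) (Seq (c3 (v, d.+1) d.+2) (Prim (PInc d.+1)))))),
  (fun N => T1 N + (1 + (N * (T3 N + 1 + 1) + 1))).
split; first by polyb.
move=> z N v e d s Hs He; have [s1 [R1 E1 K1 V1]] := H1 _ _ _ _ _ _ Hs He.
have HB : Bd (size z) <= N by case: Hs.
have eN := holds_le He; have mN : m z e <= N by exact: Hm.
rewrite (minn_idPr mN) in V1.
pose F i := flatten [seq G z (e, i) | i <- iota 0 i].
pose P j (t : store) := [/\ keep d s t, t.1 d = m z e, t.1 d.+1 = j & t.2 = s.2 ++ F j].
have [|||s4 R4 [K4 _ _ E4]] := @runs_while_lt z d.+1 d
   (Seq (c3 (v, d.+1) d.+2) (Prim (PInc d.+1))) P (m z e)
   (T3 N + 1) (setr s1 d.+1 0).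
- by move=> j t [].
- move=> j t lt_jm [Kt Et1 Et2 Et4].
  have [] := H3 z N (v, d.+1) (e, j) d.+2 t.
  + by apply: ready_keep Hs; rewrite ?leqW.
  + by split; [apply: holds_keep He; rewrite ?leqW // |]; split=> //=; lia.
  move=> t1 [Rt1 Ot1 Kt1].
  exists (setr t1 d.+1 (t1.1 d.+1).+1).
    exact: runs_seq Rt1 (runs_prim z (PInc d.+1) t1).
  have lt1 r : r < d.+2 -> t1.1 r = t.1 r by move/Kt1.
  split; rewrite /= ?eqxx ?Ot1 //.
  + by move=> r Hr /=; rewrite ltn_eqF 1?Kt1 ?Kt //; lia.
  + by rewrite ltn_eqF // lt1.
  + by rewrite lt1 ?Et2.
  + by rewrite Et4 -catA /F -[j.+1]addn1 iotaD map_cat flatten_cat /= cats0.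
- split; rewrite /= ?eqxx ?E1 ?cats0 //.
  + by move=> r Hr /=; rewrite ltn_eqF 1?K1 //; lia.
  + by rewrite ltn_eqF.
exists s4; split => //.
apply: runs_seq R1 (runs_seq (runs_prim z (PZero d.+1) s1) (runsW _ R4)).
by rewrite leq_add2r leq_mul //; lia.
Qed.

End Computable.

(** * Computing the bound, and complete machines *)

Definition read_len r := Seq (Prim (PZero r)) (Seq (Prim (PInc r))
  (While (Prim (PSymNe r None)) (Prim (PInc r)))).

(** The scan ends only past the input: the separator is the symbol [Some None], which differs from
    [None]. *)
Lemma runs_read_len z r s : exists s', [/\ runs z (read_len r) s (2 * size z + 3) s',
  s'.2 = s.2, s'.1 r = (size z).+1 & forall q, q != r -> s'.1 q = s.1 q].
Proof.
have H k : k <= size z -> forall t, t.1 r = (size z - k).+1 -> exists t',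
    [/\ runs z (While (Prim (PSymNe r None)) (Prim (PInc r))) t (2 * k + 1) t',
     t'.2 = t.2, t'.1 r = (size z).+1 & forall q, q != r -> t'.1 q = t.1 q].
  elim: k => [_ t Et|k IH lt_k t Et].
    exists t; split => //; last by rewrite subn0 in Et.
    have R1 := BsPrim z (PSymNe r None) t.
    rewrite /= Et subn0 [sym _ _]onth_default // eqxx in R1.
    by exists 1, false; split=> //; exact: BsWhileF R1.
  have [||t' [[n [b [Hn R1]]] H2 H3 H4]] := IH _ (psem z (PInc r) t).2.
  - exact: ltnW.
  - by rewrite /= eqxx Et; lia.
  exists t'; split => //; last by move=> q Hq; rewrite H4 //= (negbTE Hq).
  exists (1 + 1 + n), b; split; first by lia.
  apply: BsWhileT (BsPrim z (PInc r) t) R1.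
  have := BsPrim z (PSymNe r None) t.
  have : onth z (size z - k.+1) by rewrite onthTE; lia.
  by rewrite [_.1]/= Et [sym _ _]/=; case: onth.
have [|t' [R1 H1 H2 H3]] := H _ (leqnn _) (psem z (PInc r) (psem z (PZero r) s).2).2.
  by rewrite /= !eqxx subnn.
exists t'; split => //; last by move=> q Hq; rewrite H3 //= (negbTE Hq).
apply: runsW (runs_seq (runs_prim z (PZero r) s) (runs_seq (runs_prim z (PInc r) _) R1)).
lia.
Qed.

Definition mul_len := Seq (copy 2 0) (Seq (Prim (PZero 0)) (Seq (Prim (PZero 3))
  (While (Prim (PLt 3 2)) (Seq (Prim (PZero 4))
    (Seq (While (Prim (PLt 4 1)) (Seq (Prim (PInc 0)) (Prim (PInc 4)))) (Prim (PInc 3))))))).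

Lemma runs_mul_len z s : exists s', [/\
  runs z mul_len s (2 * s.1 0 + 5 + s.1 0 * (s.1 1 * 3 + 4)) s',
  s'.2 = s.2, s'.1 0 = s.1 0 * s.1 1 & s'.1 1 = s.1 1].
Proof.
have [//|s1 [R1 E1 V1 K1]] := runs_copy z s (r := 2) (r' := 0).
pose s2 := (psem z (PZero 3) (psem z (PZero 0) s1).2).2.
pose P j (t : store) := [/\ t.2 = s.2, t.1 3 = j, t.1 2 = s.1 0, t.1 1 = s.1 1
  & t.1 0 = j * s.1 1].
have [|||s3 R3 [E3 _ _ V3 V3']] := @runs_while_lt z 3 2 (Seq (Prim (PZero 4))
    (Seq (While (Prim (PLt 4 1)) (Seq (Prim (PInc 0)) (Prim (PInc 4)))) (Prim (PInc 3))))
    P (s.1 0) (s.1 1 * 3 + 3) s2.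
- by move=> j t [].
- move=> j t lt_j [Et0 Et1 Et2 Et3 Et4].
  pose Q i (u : store) := [/\ u.2 = s.2, u.1 4 = i, [/\ u.1 3 = j, u.1 2 = s.1 0 & u.1 1 = s.1 1]
    & u.1 0 = j * s.1 1 + i].
  have [|||u Ru [Eu0 Eu1 [Eu2 Eu3 Eu4] Eu5]] := @runs_while_lt z 4 1
     (Seq (Prim (PInc 0)) (Prim (PInc 4))) Q (s.1 1) 2 (psem z (PZero 4) t).2.
  + by move=> i u [? ? []].
  + move=> i u lt_i [F0 F1 [F2 F3 F4] F5].
    exists (psem z (PInc 4) (psem z (PInc 0) u).2).2.
      exact: runs_seq (runs_prim z (PInc 0) u) (runs_prim z (PInc 4) _).
    by split=> //=; rewrite ?F1 ?F5 ?addnS.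
  + by split=> //=; rewrite Et4 addn0.
  exists (psem z (PInc 3) u).2.
    apply: runsW (runs_seq (runs_prim z (PZero 4) t) (runs_seq Ru (runs_prim z (PInc 3) u))).
    lia.
  by split=> //=; rewrite ?Eu2 ?Eu5; lia.
- by split=> //=; rewrite ?E1 ?K1.
exists s3; split => //.
apply: runsW (runs_seq R1 (runs_seq (runs_prim z (PZero 0) s1)
  (runs_seq (runs_prim z (PZero 3) _) R3))).
lia.
Qed.

(** The machine has to produce the bound itself: register 1 gets [size z + 2] and register 0 its
    power [e], the exponent that [polyb Bd] provides. *)
Fixpoint set_bound e := if e is e'.+1 then Seq (set_bound e') mul_len
  else Seq (read_len 1) (Seq (Prim (PInc 1)) (Seq (Prim (PZero 0)) (Prim (PInc 0)))).

Lemma runs_set_bound e : exists2 T, polyb T & forall z, exists s,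
  [/\ runs z (set_bound e) store0 (T (size z)) s, s.2 = [::], s.1 0 = (size z).+2 ^ e
    & s.1 1 = (size z).+2].
Proof.
elim: e => [|e [T HT IH]].
  exists (fun n => 2 * n + 3 + 3); first by polyb.
  move=> z; have [s [R1 E1 V1 V2]] := runs_read_len z 1 store0.
  exists (psem z (PInc 0) (psem z (PZero 0) (psem z (PInc 1) s).2).2).2.
  split => //=; last by rewrite V1.
  exact: runs_seq R1 (runs_seq (runs_prim z (PInc 1) s)
    (runs_seq (runs_prim z (PZero 0) _) (runs_prim z (PInc 0) _))).
exists (fun n => T n + (2 * n.+2 ^ e + 5 + n.+2 ^ e * (n.+2 * 3 + 4))).
  have H2 : polyb (fun n => n.+2).
    by apply: polybW (polybD polyb_id (polyb_const 2)) => n; rewrite addn2.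
  by polyb.
move=> z; have [s [R1 E1 V1 V2]] := IH z.
have [s' [R2 E2 V3 V4]] := runs_mul_len z s.
exists s'; split; rewrite ?E2 ?V3 ?V4 //.
  by apply: runs_seq R1 _; rewrite -V1 -V2.
by rewrite V1 V2 expnSr.
Qed.

Lemma tm_of_runs z R c n b s : bs z c store0 n b s -> regs_lt R.+1 c -> forall T, n <= T ->
  exists c', [/\ @halts_within (tm_of (compile R c)) z (T * (2 * T + 5) + 2) c',
     accepting c' = b & tape_output c' = s.2].
Proof.
move=> Hbs Hc T le_n; have [c' [[m [Hm E1 E2]] H2 H3]] := tm_of_run Hbs Hc.
by exists c'; split => //; exists m; split=> //; nia.
Qed.

Section TopLevel.
Variable Bd : nat -> nat.
Hypotheses (Bd_gt : forall n, n + 1 < Bd n) (Bd_poly : polyb Bd).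

Lemma decider (P : word -> ctx 0 -> bool) : cptb Bd P -> exists (M : TM) p, forall z,
  exists c, @halts_within M z ((size z).+2 ^ p) c /\ accepting c = P z tt.
Proof.
move=> [code [T [HT H]]]; have [e He] := Bd_poly.
(* Registers 0 and 1 are reserved, so the program works from register 2 on, and its result is
   compared with 0 at the end. *)
pose c := Seq (set_bound e) (Seq (code tt 2) (Seq (Prim (PZero 3)) (Prim (PLt 3 2)))).
have [R HR] := regs_lt_ex c.
have [T0 HT0 Hset] := runs_set_bound e.
pose T1 n := T0 n + (T (n.+2 ^ e) + 2).
have [p Hp] : polyb (fun n => T1 n * (2 * T1 n + 5) + 2).
  have HT' : polyb (fun n => T (n.+2 ^ e)).
    apply: polyb_comp => //; apply: polybX.
    by apply: polybW (polybD polyb_id (polyb_const 2)) => n; rewrite addn2.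
  have : polyb T1 by rewrite /T1; polyb.
  by move=> ?; polyb.
exists (tm_of (compile R c)), p => z.
have [s1 [[n1 [b1 [H1 R1]]] E1 V1 _]] := Hset z.
have Hs : ready Bd z ((size z).+2 ^ e) 2 s1 by split.
have [s2 [[n2 [b2 [H2 R2]]] E2 K2 V2]] := H z _ tt tt _ _ Hs I.
pose s3 := (psem z (PZero 3) s2).2.
have R3 := BsSeq R1 (BsSeq R2 (BsSeq (BsPrim z (PZero 3) s2) (BsPrim z (PLt 3 2) s3))).
have [|c' [Hc' A' _]] := tm_of_runs R3 HR (T := T1 (size z)); first by rewrite /T1; lia.
exists c'; split; first by case: Hc' => m [? ? ?]; exists m; split=> //; apply: leq_trans (Hp _).
rewrite A' /= V2; case: (P z tt) => /=; last by lia.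
by have := Bd_gt (size z); have := He (size z); lia.
Qed.

Lemma generator (G : word -> ctx 0 -> seq bool) : cgen Bd G -> exists (M : TM) p, forall z,
  exists c, @halts_within M z ((size z).+2 ^ p) c /\ tape_output c = G z tt.
Proof.
move=> [code [T [HT H]]]; have [e He] := Bd_poly.
pose c := Seq (set_bound e) (code tt 2).
have [R HR] := regs_lt_ex c.
have [T0 HT0 Hset] := runs_set_bound e.
pose T1 n := T0 n + T (n.+2 ^ e).
have [p Hp] : polyb (fun n => T1 n * (2 * T1 n + 5) + 2).
  have HT' : polyb (fun n => T (n.+2 ^ e)).
    apply: polyb_comp => //; apply: polybX.
    by apply: polybW (polybD polyb_id (polyb_const 2)) => n; rewrite addn2.
  have : polyb T1 by rewrite /T1; polyb.
  by move=> ?; polyb.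
exists (tm_of (compile R c)), p => z.
have [s1 [[n1 [b1 [H1 R1]]] E1 V1 _]] := Hset z.
have Hs : ready Bd z ((size z).+2 ^ e) 2 s1 by split.
have [s2 [[n2 [b2 [H2 R2]]] E2 K2]] := H z _ tt tt _ _ Hs I.
have [|c' [Hc' _ A']] := tm_of_runs (BsSeq R1 R2) HR (T := T1 (size z)); first by rewrite /T1; lia.
exists c'; split; first by case: Hc' => m [? ? ?]; exists m; split=> //; apply: leq_trans (Hp _).
by rewrite A' E2 E1.
Qed.

End TopLevel.

(** * Closure under arithmetic, logic and counting *)

Section Closure.
Variable Bd : nat -> nat.
Hypothesis Bd_gt : forall n, n + 1 < Bd n.
Notation cpt := (cpt Bd).
Notation cptb := (cptb Bd).
Notation cgen := (cgen Bd).
Notation small := (small Bd).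

Lemma small_var k : small (fun z (e : ctx k.+1) => e.2).
Proof. by move=> z N e _ []. Qed.

Lemma small_weak k (f : word -> ctx k -> nat) :
  small f -> small (fun z (e : ctx k.+1) => f z e.1).
Proof. by move=> Hf z N e HN [He _]; exact: Hf. Qed.

Lemma small_bool k (P : word -> ctx k -> bool) : small (fun z e => P z e).
Proof. by move=> z N e HN _; have := Bd_gt (size z); case: (P z e) => /=; lia. Qed.

Lemma cpt_add k (f g : word -> ctx k -> nat) : small f -> cpt f -> cpt g ->
  cpt (fun z e => f z e + g z e).
Proof.
move=> sf Hf Hg.
have H := cpt_iteri (f := fun z (e : ctx k.+2) => e.2.+1) sf _ Hf Hg (cpt_succ (cpt_var _ _)).
apply: cpt_ext (H _) => /= [z e|]; last by move=> *; lia.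
by elim: (f z e) => //= m ->.
Qed.

Lemma cpt_mul k (f g : word -> ctx k -> nat) : small f -> small g -> cpt f -> cpt g ->
  cpt (fun z e => f z e * g z e).
Proof.
move=> sf sg Hf Hg.
have H := cpt_iteri (f := fun z (e : ctx k.+2) => g z e.1.1 + e.2) sf _ Hf (cpt0 _ _)
   (cpt_add (small_weak (small_weak sg)) (cpt_weak (cpt_weak Hg)) (cpt_var _ _)).
apply: cpt_ext (H _) => /= [z e|]; last by move=> *; lia.
by elim: (f z e) => //= m ->; rewrite mulSn.
Qed.

(** An iteration that returns its own index ends with the last index, which is the predecessor of
    the number of rounds. *)
Lemma cpt_pred k (f : word -> ctx k -> nat) : small f -> cpt f -> cpt (fun z e => (f z e).-1).
Proof.
move=> sf Hf.
have H := cpt_iteri (f := fun z (e : ctx k.+2) => e.1.2) sf _ Hf (cpt0 _ _)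
  (cpt_weak (cpt_var _ _)).
by apply: cpt_ext (H _) => //= z e; case: (f z e).
Qed.

Lemma cptb_const k b : cptb (fun z (e : ctx k) => b).
Proof. exact: cpt_const. Qed.

Lemma cptb_if k (P Q Q' : word -> ctx k -> bool) : cptb P -> cptb Q -> cptb Q' ->
  cptb (fun z e => if P z e then Q z e else Q' z e).
Proof.
by move=> HP HQ HQ'; apply: cpt_ext (cpt_if Bd_gt HP HQ HQ') => z e; case: (P z e).
Qed.

Lemma cptb_not k (P : word -> ctx k -> bool) : cptb P -> cptb (fun z e => ~~ P z e).
Proof.
move=> HP; apply: cpt_ext (cptb_if HP (cptb_const _ false) (cptb_const _ true)) => z e.
by case: (P z e).
Qed.

Lemma cptb_and k (P Q : word -> ctx k -> bool) :
  cptb P -> cptb Q -> cptb (fun z e => P z e && Q z e).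
Proof.
move=> HP HQ; apply: cpt_ext (cptb_if HP HQ (cptb_const _ false)) => z e.
by case: (P z e).
Qed.

Lemma cptb_le k (f g : word -> ctx k -> nat) : small f -> cpt f -> cpt g ->
  cptb (fun z e => f z e <= g z e).
Proof.
move=> sf Hf Hg; apply: cpt_ext (cptb_not (cptb_lt Bd_gt sf Hg Hf)) => z e.
by rewrite -leqNgt.
Qed.

Lemma cptb_eq k (f g : word -> ctx k -> nat) : small f -> small g -> cpt f -> cpt g ->
  cptb (fun z e => f z e == g z e).
Proof.
move=> sf sg Hf Hg; apply: cpt_ext (cptb_and (cptb_le sf Hf Hg) (cptb_le sg Hg Hf)) => z e.
by rewrite -eqn_leq.
Qed.

Lemma cpt_count k (m : word -> ctx k -> nat) (P : word -> ctx k.+1 -> bool) :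
  small m -> cpt m -> cptb P ->
  cpt (fun z e => count (fun i => P z (e, i)) (iota 0 (m z e))).
Proof.
move=> sm Hm HP.
have H := cpt_iteri (f := fun z (e : ctx k.+2) => P z e.1 + e.2) sm _ Hm (cpt0 _ _)
  (cpt_add (small_weak (@small_bool _ P)) (cpt_weak HP) (cpt_var _ _)).
apply: cpt_ext (H _) => /= [z e|]; last by move=> *; lia.
by elim: (m z e) => // n IH; rewrite [LHS]/= IH -[n.+1]addn1 iotaD count_cat /= addn0 addnC.
Qed.

Lemma cptb_all k (m : word -> ctx k -> nat) (P : word -> ctx k.+1 -> bool) :
  small m -> cpt m -> cptb P ->
  cptb (fun z e => all (fun i => P z (e, i)) (iota 0 (m z e))).
Proof.
move=> sm Hm HP.
have sc : small (fun z e => count (fun i => P z (e, i)) (iota 0 (m z e))).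
  move=> z N e HN He; apply: leq_trans (count_size _ _) _; rewrite size_iota; exact: sm.
apply: cpt_ext (cptb_eq sc sm (cpt_count sm Hm HP) Hm) => z e.
by rewrite all_count size_iota.
Qed.

Lemma cptb_has k (m : word -> ctx k -> nat) (P : word -> ctx k.+1 -> bool) :
  small m -> cpt m -> cptb P ->
  cptb (fun z e => has (fun i => P z (e, i)) (iota 0 (m z e))).
Proof.
move=> sm Hm HP; apply: cpt_ext (cptb_not (cptb_all sm Hm (cptb_not HP))) => z e.
by rewrite -has_predC; congr nat_of_bool; apply: eq_has => i /=; rewrite negbK.
Qed.

(** The difference is the number of [i < f] with [g <= i]. *)
Lemma cpt_sub k (f g : word -> ctx k -> nat) : small f -> small g -> cpt f -> cpt g ->
  cpt (fun z e => f z e - g z e).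
Proof.
move=> sf sg Hf Hg.
have H := cpt_count sf Hf (cptb_le (small_weak sg) (cpt_weak Hg) (cpt_var _ _)).
apply: cpt_ext H => z e /=; elim: (f z e) => // n IH.
by rewrite -[n.+1]addn1 iotaD count_cat IH /=; case: leqP; lia.
Qed.

Lemma small_size k : small (fun z (e : ctx k) => size z).
Proof. by move=> z N e HN _; have := Bd_gt (size z); lia. Qed.

Lemma cpt_size k : cpt (fun z (e : ctx k) => size z).
Proof.
suff H : cpt (fun z (e : ctx k) => (size z).+1).
  by apply: cpt_ext (cpt_pred _ H) => // z N e HN _; have := Bd_gt (size z); lia.
exists (fun v d => read_len d), (fun N => 2 * N + 3); split; first by polyb.
move=> z N v e d s Hs _; have [s' [R E V K]] := runs_read_len z d s.
have HN := N_gt0 Bd_gt Hs.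
exists s'; split => //; first by apply: runsW R; lia.
- by move=> r Hr; apply: K; lia.
- by rewrite V; lia.
Qed.

Lemma cgen_num k (f : word -> ctx k -> nat) : small f -> cpt f ->
  cgen (fun z e => nseq (f z e) true).
Proof.
move=> sf Hf; apply: cgen_ext (cgen_for sf Hf (cgen_bit _ _ true)) => z e.
by elim: (f z e) 0 => //= n IH i; rewrite IH.
Qed.

End Closure.

(** * The verifier *)

(* A word is read as a stream of unary numbers: every symbol other than [Some true], the
   separator included, ends a number. *)
Definition val_at (z : word) (p : nat) : nat := find (predC1 (Some true)) (drop p z).
Definition next_num (z : word) (p : nat) : nat := (val_at z p + p).+1.
Definition num (z : word) (j : nat) : nat := val_at z (iter j (next_num z) 0).

Lemma val_at_size z p : val_at z p <= size z - p.
Proof. by rewrite -size_drop find_size. Qed.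

Lemma val_at_minn z N p : size z <= N -> val_at z (minn N p) = val_at z p.
Proof.
by move=> HN; case: (leqP p N) => // ?; rewrite /val_at !drop_oversize //; lia.
Qed.

Lemma onth_val_at z p a : a <= val_at z p ->
  (onth z (p + a) == Some (Some true)) = (a < val_at z p).
Proof.
move=> le_a; have -> : onth z (p + a) = onth (drop p z) a by rewrite !onthE map_drop nth_drop.
rewrite /val_at in le_a *; set s := drop p z in le_a *.
have E : a < size s -> onth s a = Some (nth (Some true) s a).
  by move=> Ha; rewrite onthE (nth_map (Some true)).
case: ltnP => [lt_a|ge_a].
  have lt_as : a < size s by apply: leq_trans lt_a (find_size _ _).
  by rewrite E // (inj_eq Some_inj) -[_ == _]negbK -[~~ (_ == _)]/(predC1 _ _) before_find.
have -> : a = find (predC1 (Some true)) s by apply/eqP; rewrite eqn_leq le_a.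
case: (boolP (has (predC1 (Some true)) s)) => Hs; last first.
  by rewrite (hasNfind Hs) onth_default.
rewrite onthE (nth_map (Some true)) -?has_find // (inj_eq Some_inj).
exact: negbTE (nth_find _ Hs).
Qed.

Section Cpt.
Variable Bd : nat -> nat.
Hypothesis Bd_gt : forall n, n + 1 < Bd n.
Notation cpt := (cpt Bd).
Notation cptb := (cptb Bd).
Notation cgen := (cgen Bd).
Notation small := (small Bd).

Lemma Bd_size (z : word) N : Bd (size z) <= N -> size z < N.
Proof. by have := Bd_gt (size z); lia. Qed.

Lemma cptb_onth k (f : word -> ctx k -> nat) a :
  cpt f -> cptb (fun z e => onth z (f z e) == a).
Proof. by move=> Hf; apply: cpt_ext (cptb_sym Bd_gt a (cpt_succ Hf)). Qed.

(** The accumulator grows as long as the symbol it points at is a one, so after [n] rounds it is the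
    minimum of [n] and the value, and [size z] rounds suffice. *)
Lemma cpt_val_at k (f : word -> ctx k -> nat) : cpt f -> cpt (fun z e => val_at z (f z e)).
Proof.
move=> Hf; apply: (cpt_let (f := fun z (e : ctx k.+1) => val_at z e.2) _ Hf).
  by move=> z N e HN _ /=; rewrite val_at_minn // ltnW ?Bd_size.
have sx : small (fun z (e : ctx k.+3) => e.1.1.2) by move=> z N e _ [[[]]].
have H := cpt_iteri (f := fun z (e : ctx k.+3) =>
  if onth z (e.1.1.2 + e.2) == Some (Some true) then e.2.+1 else e.2)
  (@small_size _ Bd_gt k.+1) _ (cpt_size Bd_gt _) (cpt0 _ _) (cpt_if Bd_gt (cptb_onth _
    (cpt_add sx (cpt_weak (cpt_weak (cpt_var _ _))) (cpt_var _ _))) (cpt_succ (cpt_var _ _)) (cpt_var _ _)).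
apply: cpt_ext (H _) => /= [z e|z N e i x HN _ _]; last first.
  (* A clamped accumulator points past the input, where no symbol is a one. *)
  have := Bd_size HN => lt_zN; case: (leqP x N) => // lt_xN.
  by rewrite !onth_default ?lt_xN //=; lia.
have -> : val_at z e.2 = minn (size z) (val_at z e.2) by have := val_at_size z e.2; lia.
elim: (size z) => [|n IH]; rewrite ?min0n // iteriS IH onth_val_at ?geq_minr //.
by move: (val_at z e.2) => v; clear; case: ifP; lia.
Qed.

Lemma small_val_at k (f : word -> ctx k -> nat) : small (fun z e => val_at z (f z e)).
Proof.
by move=> z N e /Bd_size HN _; have := val_at_size z (f z e); lia.
Qed.

(* Pointers move strictly to the right, hence clamping a pointer commutes with moving it. *)
Lemma cpt_iter k (m a : word -> ctx k -> nat) (f : word -> nat -> nat) :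
  (forall z x, x < f z x) -> small m -> cpt m -> cpt a ->
  cpt (fun z (e : ctx k.+2) => f z e.2) -> cpt (fun z e => iter (m z e) (f z) (a z e)).
Proof.
move=> Hf sm Hm Ha Hfc.
have H := cpt_iteri (f := fun z (e : ctx k.+2) => f z e.2) sm _ Hm Ha Hfc.
apply: cpt_ext (H _) => /= [z e|z N e i x HN _ _].
  by elim: (m z e) => //= n ->.
case: (leqP x N) => // lt_xN; have := Hf z x; have := Hf z N; lia.
Qed.

Lemma cpt_next_num k (f : word -> ctx k -> nat) : cpt f -> cpt (fun z e => next_num z (f z e)).
Proof. by move=> Hf; apply: cpt_succ (cpt_add (@small_val_at _ f) (cpt_val_at Hf) Hf). Qed.

Lemma next_num_gt z x : x < next_num z x.
Proof. by rewrite /next_num ltnS leq_addl. Qed.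

Lemma iter_next_num z i : i <= iter i (next_num z) 0.
Proof. by elim: i => // i IH; exact: leq_ltn_trans IH (next_num_gt _ _). Qed.

(** Each number takes at least one cell, so from index [size z] on the stream is constantly 0, and
    clamping an index is harmless. *)
Lemma num_minn z N j : size z <= N -> num z (minn N j) = num z j.
Proof.
move=> HN; case: (leqP j N) => // lt_N.
have H := iter_next_num z.
have := val_at_size z (iter j (next_num z) 0); have := val_at_size z (iter N (next_num z) 0).
rewrite /num; have := H j; have := H N; lia.
Qed.

Lemma cpt_num k (f : word -> ctx k -> nat) : cpt f -> cpt (fun z e => num z (f z e)).
Proof.
move=> Hf; apply: (cpt_let (f := fun z (e : ctx k.+1) => num z e.2) _ Hf).
  by move=> z N e HN _ /=; rewrite num_minn // ltnW ?Bd_size.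
apply: cpt_val_at; apply: cpt_iter (@small_var _ _) (cpt_var _ _) (cpt0 _ _) _.
  exact: next_num_gt.
exact: cpt_next_num (cpt_var _ _).
Qed.

Lemma small_num k (f : word -> ctx k -> nat) : small (fun z e => num z (f z e)).
Proof. exact: small_val_at. Qed.

End Cpt.

Section Stream.
Variable V : nat -> nat.

(* [V] is a stream of numbers and all locations below are indices into it. *)
Definition s_list i := mkseq (fun j => V (i.+1 + j)) (V i).
Definition list_end i := (V i + i).+1.
Definition i_fin_at := list_end 3.
Definition i_trans_at := list_end i_fin_at.
(** Here and below the summands of an index are ordered for [cpt_add], which asks the left summand
    to be small; the pointers, which may be clamped, stand on the right. *)
Definition trans_comp j c := V (c + (4 * j + i_trans_at.+1)).
Definition i_words_at := (4 * V i_trans_at + i_trans_at).+1.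
Definition word_at m := iter m list_end i_words_at.+1.
Definition inst_end := word_at (V i_words_at).

Definition s_inst : naa_inst := NaaInst (V 0) (V 1) (V 2) (s_list 3) (s_list i_fin_at)
  (mkseq (fun j => (trans_comp j 0, trans_comp j 1, trans_comp j 2, trans_comp j 3)) (V i_trans_at))
  (mkseq (fun m => s_list (word_at m)) (V i_words_at)).

(* The separator is read as the number at index [inst_end]. *)
Definition cert := inst_end.+1.
Definition run_len := V cert.
Definition start := V cert.+1.
Definition step_idx t := V (t + cert.+2).
Definition step_comp t c := trans_comp (step_idx t) c.
Definition word_idx x := V (x + (run_len + cert.+2)).
Definition word_off x := V (V 1 + (x + (run_len + cert.+2))).
Definition dir_count x t := count (fun t' => step_comp t' 2 == x) (iota 0 t).
Definition state_at t := if t == 0 then start else step_comp t.-1 3.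

(** In the last conjunct, the letter of a step is found in the word of its direction at the offset
    plus the number of earlier steps in that direction, so no projection is ever stored. *)
Definition check : bool :=
  [&& inst_wf s_inst,
      all (fun t => step_idx t < V i_trans_at) (iota 0 run_len),
      all (fun t => step_comp t 0 == state_at t) (iota 0 run_len),
      has (fun j => V (j + 4) == start) (iota 0 (V 3)),
      has (fun j => V (j + i_fin_at.+1) == state_at run_len) (iota 0 (V i_fin_at)),
      all (fun x => (word_idx x < V i_words_at) &&
        (word_off x + dir_count x run_len <= V (word_at (word_idx x)))) (iota 0 (V 1))
    & all (fun t => step_comp t 1 ==
        V (dir_count (step_comp t 2) t +
           (word_off (step_comp t 2) + (word_at (word_idx (step_comp t 2))).+1)))
        (iota 0 run_len)].

End Stream.

(** The first conjunct puts the separator exactly where the parsed instance ends, so that the parse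
    cannot stop short of the end of [x] or run into the certificate. *)
Definition verify (z : word) : bool :=
  (onth z (iter (inst_end (num z)) (next_num z) 0) == Some None) && check (num z).

(** It dominates the constants used as operands, the numbers of the stream, which are at most [n],
    and the sum of two of these. *)
Definition vBd n := 4 * n + 10.

Lemma vBd_gt n : n + 1 < vBd n. Proof. by rewrite /vBd; lia. Qed.

Lemma vBd_poly : polyb vBd.
Proof. by rewrite /vBd; polyb. Qed.

Section VerifyCpt.
Notation cpt := (cpt vBd).
Notation cptb := (cptb vBd).
Notation small := (small vBd).
Implicit Types k : nat.

Lemma num_size z j : num z j <= size z.
Proof. by apply: leq_trans (val_at_size _ _) (leq_subr _ _). Qed.

Lemma small_numV k (f : word -> ctx k -> nat) : small (fun z e => num z (f z e)).
Proof. exact: small_num vBd_gt _ _. Qed.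

Lemma cpt_numV k (f : word -> ctx k -> nat) : cpt f -> cpt (fun z e => num z (f z e)).
Proof. exact: cpt_num vBd_gt _ _. Qed.

Lemma cpt_list_end k (f : word -> ctx k -> nat) :
  cpt f -> cpt (fun z e => list_end (num z) (f z e)).
Proof. by move=> Hf; apply: cpt_succ (cpt_add (@small_numV _ f) (cpt_numV Hf) Hf). Qed.

Lemma cpt_i_fin_at k : cpt (fun z (e : ctx k) => i_fin_at (num z)).
Proof. exact: cpt_list_end (cpt_const _ _ _). Qed.

Lemma cpt_i_trans_at k : cpt (fun z (e : ctx k) => i_trans_at (num z)).
Proof. exact: cpt_list_end (cpt_i_fin_at _). Qed.

Lemma small_const k c : c < 10 -> small (fun z (e : ctx k) => c).
Proof. by move=> Hc z N e; rewrite /vBd; lia. Qed.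

Lemma cpt_4add k (f g : word -> ctx k -> nat) : small f -> cpt f -> cpt g ->
  cpt (fun z e => 4 * f z e + g z e).
Proof.
move=> sf Hf Hg; do 4 have := cpt_add sf Hf Hg => {}Hg.
by apply: cpt_ext Hg => z e; lia.
Qed.

Lemma cpt_trans_comp k (f : word -> ctx k -> nat) c : c < 4 -> small f -> cpt f ->
  cpt (fun z e => trans_comp (num z) (f z e) c).
Proof.
move=> Hc sf Hf; apply: cpt_numV; apply: cpt_add (cpt_const _ _ _) _.
  by apply: small_const; lia.
by apply: cpt_4add => //; apply: cpt_succ; exact: cpt_i_trans_at.
Qed.

Lemma cpt_i_words_at k : cpt (fun z (e : ctx k) => i_words_at (num z)).
Proof.
apply: cpt_succ; apply: cpt_4add; [exact: small_numV| |exact: cpt_i_trans_at].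
exact: cpt_numV (cpt_i_trans_at _).
Qed.

Lemma cpt_word_at k (f : word -> ctx k -> nat) : small f -> cpt f ->
  cpt (fun z e => word_at (num z) (f z e)).
Proof.
move=> sf Hf; apply: cpt_iter sf Hf _ _ => [z x||].
- by rewrite /list_end ltnS leq_addl.
- exact: cpt_succ (cpt_i_words_at _).
- exact: cpt_list_end (cpt_var _ _).
Qed.

Lemma cpt_inst_end k : cpt (fun z (e : ctx k) => inst_end (num z)).
Proof. by apply: cpt_word_at; [exact: small_numV|exact: cpt_numV (cpt_i_words_at _)]. Qed.

Lemma cpt_cert k : cpt (fun z (e : ctx k) => cert (num z)).
Proof. exact: cpt_succ (cpt_inst_end _). Qed.

Lemma cpt_run_len k : cpt (fun z (e : ctx k) => run_len (num z)).
Proof. exact: cpt_numV (cpt_cert _). Qed.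

Lemma cpt_start k : cpt (fun z (e : ctx k) => start (num z)).
Proof. exact: cpt_numV (cpt_succ (cpt_cert _)). Qed.

Lemma cpt_step_idx k (f : word -> ctx k -> nat) : small f -> cpt f ->
  cpt (fun z e => step_idx (num z) (f z e)).
Proof.
by move=> sf Hf; apply: cpt_numV; apply: cpt_add sf Hf _; do 2 apply: cpt_succ; exact: cpt_cert.
Qed.

Lemma cpt_step_comp k (f : word -> ctx k -> nat) c : c < 4 -> small f -> cpt f ->
  cpt (fun z e => step_comp (num z) (f z e) c).
Proof.
by move=> Hc sf Hf; apply: cpt_trans_comp => //; [exact: small_numV|exact: cpt_step_idx].
Qed.

Lemma cpt_word_idx k (f : word -> ctx k -> nat) : small f -> cpt f ->
  cpt (fun z e => word_idx (num z) (f z e)).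
Proof.
move=> sf Hf; apply: cpt_numV; apply: cpt_add sf Hf _; apply: cpt_add (cpt_run_len _) _.
  exact: small_numV.
by do 2 apply: cpt_succ; exact: cpt_cert.
Qed.

Lemma cpt_word_off k (f : word -> ctx k -> nat) : small f -> cpt f ->
  cpt (fun z e => word_off (num z) (f z e)).
Proof.
move=> sf Hf; apply: cpt_numV; apply: cpt_add (cpt_numV (cpt_const _ _ _)) _.
  exact: small_numV.
apply: cpt_add sf Hf _; apply: cpt_add (cpt_run_len _) _.
  exact: small_numV.
by do 2 apply: cpt_succ; exact: cpt_cert.
Qed.

Lemma cpt_dir_count k (f g : word -> ctx k -> nat) : small f -> small g -> cpt f -> cpt g ->
  cpt (fun z e => dir_count (num z) (f z e) (g z e)).
Proof.
move=> sf sg Hf Hg.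
apply: (cpt_count vBd_gt (P := fun z (e : ctx k.+1) => step_comp (num z) e.2 2 == f z e.1) sg Hg).
apply: (cptb_eq vBd_gt) => //.
- exact: small_numV.
- exact: small_weak sf.
- by apply: cpt_step_comp; [|exact: small_var|exact: cpt_var].
- exact: cpt_weak.
Qed.

Lemma small_pred k (f : word -> ctx k -> nat) : small f -> small (fun z e => (f z e).-1).
Proof. by move=> sf z N e HN He; apply: leq_trans (leq_pred _) (sf _ _ _ HN He). Qed.

Lemma cpt_state_at k (f : word -> ctx k -> nat) : small f -> cpt f ->
  cpt (fun z e => state_at (num z) (f z e)).
Proof.
move=> sf Hf; apply: (cpt_if vBd_gt).
- by apply: (cptb_eq vBd_gt sf _ Hf (cpt0 _ _)).
- exact: cpt_start.
- by apply: cpt_step_comp => //; [exact: small_pred|exact: cpt_pred].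
Qed.

Lemma small_state_at k (f : word -> ctx k -> nat) : small (fun z e => state_at (num z) (f z e)).
Proof.
move=> z N e; rewrite /vBd => HN _; rewrite /state_at; case: ifP => _;
  apply: leq_trans (num_size _ _) _; lia.
Qed.

Lemma cptb_ltV k (f : word -> ctx k -> nat) g : cpt f -> cpt g ->
  cptb (fun z e => f z e < num z (g z e)).
Proof. by move=> Hf Hg; apply: (cptb_lt vBd_gt) => //; [exact: small_numV|exact: cpt_numV]. Qed.

Lemma cptb_allV k (P : word -> ctx k.+1 -> bool) f : cpt f -> cptb P ->
  cptb (fun z e => all (fun i => P z (e, i)) (iota 0 (num z (f z e)))).
Proof. by move=> Hf HP; apply: (cptb_all vBd_gt) HP; [exact: small_numV|exact: cpt_numV]. Qed.

Lemma cptb_s_list k f g : cpt f -> cpt g ->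
  cptb (fun z (e : ctx k) => all (fun s => s < num z (g z e)) (s_list (num z) (f z e))).
Proof.
move=> Hf Hg; have H : cptb (fun z e => all (fun i => num z (i + (f z e).+1) < num z (g z e))
  (iota 0 (num z (f z e)))).
  apply: (cptb_allV (P := fun z (e : ctx k.+1) => num z (e.2 + (f z e.1).+1) < num z (g z e.1)) Hf).
  apply: cptb_ltV; last exact: cpt_weak.
  apply: cpt_numV; apply: cpt_add (@small_var _ _) (cpt_var _ _) _.
  exact: cpt_succ (cpt_weak Hf).
apply: cpt_ext H => z e; congr nat_of_bool; rewrite /s_list all_map.
by apply: eq_all => i /=; rewrite addnC.
Qed.

Lemma cptb_inst_wf k : cptb (fun z (e : ctx k) => inst_wf (s_inst (num z))).
Proof.
apply: (cptb_and vBd_gt); last apply: (cptb_and vBd_gt); last apply: (cptb_and vBd_gt).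
- by apply: (cptb_s_list (g := fun z e => 2)); exact: cpt_const.
- by apply: (cptb_s_list (g := fun z e => 2)); [exact: cpt_i_fin_at|exact: cpt_const].
- have H : cptb (fun z (e : ctx k) => all (fun j => [&& trans_comp (num z) j 0 < num z 2,
      trans_comp (num z) j 1 < num z 0, trans_comp (num z) j 2 < num z 1
      & trans_comp (num z) j 3 < num z 2]) (iota 0 (num z (i_trans_at (num z))))).
    apply: (cptb_allV (P := fun z (e : ctx k.+1) => [&& trans_comp (num z) e.2 0 < num z 2,
      trans_comp (num z) e.2 1 < num z 0, trans_comp (num z) e.2 2 < num z 1
      & trans_comp (num z) e.2 3 < num z 2]) (cpt_i_trans_at _)).
    have H c : c < 4 -> cpt (fun z (e : ctx k.+1) => trans_comp (num z) e.2 c).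
      by move=> Hc; apply: cpt_trans_comp => //; [exact: small_var|exact: cpt_var].
    by apply: (cptb_and vBd_gt); last apply: (cptb_and vBd_gt); last apply: (cptb_and vBd_gt);
      apply: cptb_ltV; try exact: cpt_const; exact: H.
  by apply: cpt_ext H => z e; rewrite all_map.
- have H : cptb (fun z (e : ctx k) => all (fun j => all (fun a => a < num z 0)
      (s_list (num z) (word_at (num z) j))) (iota 0 (num z (i_words_at (num z))))).
    apply: (cptb_allV (P := fun z (e : ctx k.+1) => all (fun a => a < num z 0)
      (s_list (num z) (word_at (num z) e.2))) (cpt_i_words_at _)).
    apply: (cptb_s_list (g := fun z e => 0)); last exact: cpt_const.
    by apply: cpt_word_at; [exact: small_var|exact: cpt_var].
  by apply: cpt_ext H => z e; rewrite all_map.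
Qed.

Lemma cptb_hasV k (P : word -> ctx k.+1 -> bool) f : cpt f -> cptb P ->
  cptb (fun z e => has (fun i => P z (e, i)) (iota 0 (num z (f z e)))).
Proof. by move=> Hf HP; apply: (cptb_has vBd_gt) HP; [exact: small_numV|exact: cpt_numV]. Qed.

Lemma dir_count_le V x t : dir_count V x t <= t.
Proof. by rewrite -{2}(size_iota 0 t) count_size. Qed.

Lemma cptb_check k : cptb (fun z (e : ctx k) => check (num z)).
Proof.
have var k' := cpt_var vBd k'; have svar k' := @small_var vBd k'.
apply: (cptb_and vBd_gt); first exact: cptb_inst_wf.
apply: (cptb_and vBd_gt).
  apply: (cptb_allV (P := fun z (e : ctx k.+1) =>
    step_idx (num z) e.2 < num z (i_trans_at (num z))) (cpt_cert k)).
  by apply: cptb_ltV; [exact: cpt_step_idx|exact: cpt_i_trans_at].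
apply: (cptb_and vBd_gt).
  apply: (cptb_allV (P := fun z (e : ctx k.+1) =>
    step_comp (num z) e.2 0 == state_at (num z) e.2) (cpt_cert k)).
  apply: (cptb_eq vBd_gt); [exact: small_numV|exact: small_state_at|exact: cpt_step_comp|exact: cpt_state_at].
apply: (cptb_and vBd_gt).
  apply: (cptb_hasV (P := fun z (e : ctx k.+1) => num z (e.2 + 4) == start (num z))
    (cpt_const vBd k 3)).
  apply: (cptb_eq vBd_gt); [exact: small_numV|exact: small_numV| |exact: cpt_start].
  by apply: cpt_numV; apply: cpt_add => //; exact: cpt_const.
apply: (cptb_and vBd_gt).
  apply: (cptb_hasV (P := fun z (e : ctx k.+1) =>
    num z (e.2 + (i_fin_at (num z)).+1) == state_at (num z) (run_len (num z))) (cpt_i_fin_at k)).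
  apply: (cptb_eq vBd_gt); [exact: small_numV|exact: small_state_at| |].
    by apply: cpt_numV; apply: cpt_add => //; exact: cpt_succ (cpt_i_fin_at _).
  by apply: cpt_state_at; [exact: small_numV|exact: cpt_run_len].
apply: (cptb_and vBd_gt).
  apply: (cptb_allV (P := fun z (e : ctx k.+1) => (word_idx (num z) e.2 < num z (i_words_at (num z))) &&
        (word_off (num z) e.2 + dir_count (num z) e.2 (run_len (num z))
          <= num z (word_at (num z) (word_idx (num z) e.2)))) (cpt_const vBd k 1)).
  apply: (cptb_and vBd_gt); first by apply: cptb_ltV; [exact: cpt_word_idx|exact: cpt_i_words_at].
  apply: (cptb_le vBd_gt).
  (* This operand is a sum of two quantities that are bounded by [size z] each, hence the multiple
     of the length in [vBd]. *)
  - move=> z N e; rewrite /vBd => HN _; have := dir_count_le (num z) e.2 (run_len (num z)).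
    by have := num_size z (cert (num z)); rewrite -/(run_len _);
       have := num_size z (num z 1 + (e.2 + (run_len (num z) + (cert (num z)).+2)));
       rewrite -/(word_off _ _); lia.
  - apply: cpt_add; [exact: small_numV|exact: cpt_word_off|].
    by apply: cpt_dir_count => //; [exact: small_numV|exact: cpt_run_len].
  - by apply: cpt_numV; apply: cpt_word_at; [exact: small_numV|exact: cpt_word_idx].
apply: (cptb_allV (P := fun z (e : ctx k.+1) => step_comp (num z) e.2 1 ==
        num z (dir_count (num z) (step_comp (num z) e.2 2) e.2 +
           (word_off (num z) (step_comp (num z) e.2 2) +
            (word_at (num z) (word_idx (num z) (step_comp (num z) e.2 2))).+1))) (cpt_cert k)).
have sd : small (fun z (e : ctx k.+1) => step_comp (num z) e.2 2) by exact: small_numV.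
have cd : cpt (fun z (e : ctx k.+1) => step_comp (num z) e.2 2) by exact: cpt_step_comp.
apply: (cptb_eq vBd_gt); [exact: small_numV|exact: small_numV|exact: cpt_step_comp|apply: cpt_numV].
apply: cpt_add; [|exact: cpt_dir_count|].
  by move=> z N e HN [_ /= He]; exact: leq_trans (dir_count_le _ _ _) He.
apply: cpt_add; [exact: small_numV|exact: cpt_word_off|apply: cpt_succ].
by apply: cpt_word_at; [exact: small_numV|exact: cpt_word_idx].
Qed.

Lemma cptb_verify : cptb (fun z (e : ctx 0) => verify z).
Proof.
apply: (cptb_and vBd_gt); last exact: cptb_check.
apply: (cptb_onth vBd_gt).
apply: (cpt_let (f := fun z (e : ctx 1) => iter e.2 (next_num z) 0) _ (cpt_inst_end 0)).
  (* If the index exceeds [N], the pointer is at least [N] with or without clamping it. *)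
  move=> z N e HN _ /=; case: (leqP (inst_end (num z)) N) => // lt_N.
  by have := iter_next_num z N; have := iter_next_num z (inst_end (num z)); lia.
apply: cpt_iter (@small_var _ _) (cpt_var _ _) (cpt0 _ _) _; first exact: next_num_gt.
exact: (cpt_next_num vBd_gt (cpt_var _ _)).
Qed.

End VerifyCpt.

(** * Matching restated over natural numbers *)

Notation transition := (nat * nat * nat * nat)%type.

Fixpoint chain (s : nat) (r : seq transition) : bool :=
  if r is t :: r' then (t.1.1.1 == s) && chain t.2 r' else true.

Definition dproj (x : nat) (r : seq transition) : seq nat :=
  [seq t.1.1.2 | t <- r & t.1.2 == x].

(** Infixes absorb the pairs of bounds, and a run is a list of entries of [i_trans], as in a
    certificate. *)
Definition nat_match (I : naa_inst) := exists s r,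
  [/\ s \in i_init I, {subset r <= i_trans I}, chain s r, last s (map snd r) \in i_fin I
    & forall x, x < nk I -> has (infix (dproj x r)) (i_words I)].

Lemma map_val_insub n (s : seq nat) : all (fun a => a < n) s ->
  map val (pmap (insub : nat -> option 'I_n) s) = s.
Proof. by elim: s => //= a s IH /andP[lt_a /IH]; rewrite insubT /= => ->. Qed.

Lemma map_subword (T U : Type) (f : T -> U) w i j :
  map f (subword w i j) = subword (map f w) i j.
Proof. by rewrite /subword map_drop map_take. Qed.

Lemma infix_subword (w : seq nat) i j : infix (subword w i j) w.
Proof.
apply/infixP; exists (take i.-1 (take j w)), (drop j w).
by rewrite catA cat_take_drop cat_take_drop.
Qed.

Section NatMatch.
Variable I : naa_inst.
Hypothesis wfI : inst_wf I.
Notation A := (inst_naa I).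
Notation lab p := (nat_of_ord p.1, nat_of_ord p.2).

Lemma run_nat (w : seq ('I_(nsig I) * 'I_(nk I))) (s : 'I_(nst I)) : nfa_run (A := A) s w ->
  exists r, [/\ {subset r <= i_trans I}, chain s r, last (val s) (map snd r) \in i_fin I
    & [seq (t.1.1.2, t.1.2) | t <- r] = [seq lab p | p <- w]].
Proof.
elim: w s => [|[a x] w IH] s /=; first by rewrite inE => Hs; exists [::]; split.
case/existsP => s' /andP[]; rewrite inE /= => Ht /IH [r [H1 H2 H3 H4]].
exists ((val s, val a, val x, val s') :: r); split => //=; last by rewrite H4.
- by move=> t; rewrite inE => /predU1P[-> // | /H1].
- by rewrite eqxx.
Qed.

Lemma run_ord r (s : 'I_(nst I)) : {subset r <= i_trans I} -> chain s r ->
  last (val s) (map snd r) \in i_fin I -> exists w : seq ('I_(nsig I) * 'I_(nk I)),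
    nfa_run (A := A) s w /\ [seq (t.1.1.2, t.1.2) | t <- r] = [seq lab p | p <- w].
Proof.
case/and4P: wfI => _ _ /allP Htr _.
elim: r s => [|[[[s0 a] x] s'] r IH] s /= Hr; first by move=> _ Hs; exists [::]; rewrite /= inE.
have Ht : (s0, a, x, s') \in i_trans I by apply: Hr; rewrite mem_head.
have /= /and4P[Hs0 Ha Hx Hs'] := Htr _ Ht.
case/andP=> /eqP E0 Hc Hl.
have [|||w [Hw Ew]] := IH (Ordinal Hs') => //.
  by move=> t tr; apply: Hr; rewrite inE tr orbT.
exists ((Ordinal Ha, Ordinal Hx) :: w); split; last by rewrite /= Ew.
by apply/existsP; exists (Ordinal Hs'); apply/andP; split=> //; rewrite inE /= -E0.
Qed.

Lemma dproj_proj r (w : seq ('I_(nsig I) * 'I_(nk I))) (x : 'I_(nk I)) :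
  [seq (t.1.1.2, t.1.2) | t <- r] = [seq lab p | p <- w] ->
  dproj x r = map val (proj x w).
Proof.
elim: r w => [|t r IH] [|p w] //= [E1 E2 E3]; rewrite /dproj /proj /= E2.
rewrite -val_eqE; case: eqP => _ /=; last exact: (IH w).
by rewrite E1; congr (_ :: _); exact: (IH w).
Qed.

Lemma match_nat : match_set_nonempty A (inst_words I) <-> nat_match I.
Proof.
case/and4P: (wfI) => /allP Hin _ _ /allP Hw; split.
  move=> [m [Hm [w [/existsP[s /andP[]]]]]]; rewrite inE => Hs.
  move=> /run_nat [r [H1 H2 H3 H4]] Hp; exists (val s), r; split=> // x Hx.
  have [/mapP[v vW Ev] _ _] := Hm (Ordinal Hx).
  apply/hasP; exists v => //; rewrite (dproj_proj (Ordinal Hx) H4) Hp map_subword Ev.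
  by rewrite map_val_insub ?infix_subword //; exact: Hw.
move=> [s [r [Hs H1 H2 H3 Hx]]].
have [w [Rw Ew]] := @run_ord r (Ordinal (Hin _ Hs)) H1 H2 H3.
pose P x (m : seq 'I_(nsig I) * nat * nat) :=
  [/\ m.1.1 \in inst_words I, 1 <= m.1.2, m.1.2 <= m.2.+1 <= (size m.1.1).+1
    & proj x w = subword m.1.1 m.1.2 m.2].
suff [m Hm] : exists m : 'I_(nk I) -> seq 'I_(nsig I) * nat * nat, forall x, P x (m x).
  exists m; split; first by move=> x; have [] := Hm x.
  exists w; split; last by move=> x; have [] := Hm x.
  by apply/existsP; exists (Ordinal (Hin _ Hs)); rewrite inE /= Hs.
apply: (fin_all_exists (P := P)) => x.
have /hasP[v vW /infixP[p [q Ev]]] := Hx x (ltn_ord x).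
have Evv := map_val_insub (Hw _ vW).
(* In [v = p ++ u ++ q] the infix [u] occupies the positions from [size p + 1] to [size p + size u],
   counted from 1; an empty [u] gives the admissible pair with [j = i - 1]. *)
exists (pmap insub v, (size p).+1, size p + size (dproj x r)); split => //=.
- exact: map_f.
- rewrite !ltnS leq_addr /= -(size_map val) [map _ _]Evv Ev !size_cat addnA leq_addr //.
- apply: (inj_map val_inj); rewrite -(dproj_proj x Ew) map_subword [map _ _]Evv Ev.
  by rewrite /subword /= catA take_size_cat ?size_cat // drop_size_cat.
Qed.

End NatMatch.

(** Each transition reads one letter in one direction. This bounds the length of a run, as its
    projections are infixes of given words. *)
Lemma sum_dproj (r : seq transition) k : (forall t, t \in r -> t.1.2 < k) ->
  size r = \sum_(x < k) size (dproj x r).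
Proof.
elim: r => [|t r IH] Hr; first by rewrite big1.
have Ht : t.1.2 < k by apply: Hr; rewrite mem_head.
rewrite /= IH; last by move=> u ur; apply: Hr; rewrite inE ur orbT.
rewrite [RHS](eq_bigr (fun x : 'I_k => (x == Ordinal Ht) + size (dproj x r))).
  by rewrite big_split /= -big_mkcond /= big_pred1_eq.
by move=> x _; rewrite /dproj /= -val_eqE /= eq_sym; case: eqP.
Qed.

(** * Serialisation of instances and its inverse *)

Definition nums_list (l : seq nat) := size l :: l.
Definition nums_trans (t : transition) := [:: t.1.1.1; t.1.1.2; t.1.2; t.2].
Definition nums (I : naa_inst) :=
  [:: nsig I; nk I; nst I] ++ nums_list (i_init I) ++ nums_list (i_fin I) ++
  (size (i_trans I) :: flatten (map nums_trans (i_trans I))) ++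
  (size (i_words I) :: flatten (map nums_list (i_words I))).

Definition enc_nums (l : seq nat) := flatten (map enc_nat l).

Lemma enc_nums_cat l1 l2 : enc_nums (l1 ++ l2) = enc_nums l1 ++ enc_nums l2.
Proof. by rewrite /enc_nums map_cat flatten_cat. Qed.

Lemma enc_nums_flatten T (f : T -> seq nat) s :
  enc_nums (flatten (map f s)) = flatten (map (fun t => enc_nums (f t)) s).
Proof. by elim: s => //= t s IH; rewrite enc_nums_cat IH. Qed.

Lemma enc_nums_cons v l : enc_nums (v :: l) = enc_nat v ++ enc_nums l.
Proof. by []. Qed.

Lemma enc_inst_nums I : enc_inst I = enc_nums (nums I).
Proof.
rewrite /nums /nums_list !(enc_nums_cat, enc_nums_cons) !enc_nums_flatten.
rewrite /enc_inst {1 2 3}/enc_list -!catA cat0s.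
do 14 congr (_ ++ _); congr (flatten _ ++ _); last by rewrite /enc_list -catA.
by apply: eq_map => t; rewrite /enc_nums /= cats0.
Qed.

Section Segments.
Variable V : nat -> nat.

Definition seg i n := mkseq (fun j => V (i + j)) n.

Lemma seg_add i a b : seg i (a + b) = seg i a ++ seg (i + a) b.
Proof.
rewrite /seg /mkseq iotaD map_cat add0n -{2}[a]addn0 iotaDl -map_comp.
by congr (_ ++ _); apply: eq_map => j /=; rewrite addnA.
Qed.

Lemma seg_cons i n : seg i n.+1 = V i :: seg i.+1 n.
Proof. by rewrite -add1n seg_add /seg /= addn0 addn1. Qed.

Lemma seg_cat i (l1 l2 : seq nat) : seg i (size (l1 ++ l2)) = l1 ++ l2 ->
  seg i (size l1) = l1 /\ seg (i + size l1) (size l2) = l2.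
Proof.
rewrite size_cat seg_add => /eqP; rewrite eqseq_cat ?size_mkseq //.
by case/andP=> /eqP-> /eqP->.
Qed.

Lemma seg_nums_list i l : seg i (size (nums_list l)) = nums_list l ->
  [/\ V i = size l, s_list V i = l & list_end V i = i + size (nums_list l)].
Proof.
rewrite [size _]/= seg_cons => -[E1 E2]; split=> //; first by rewrite /s_list E1.
by rewrite /list_end E1 /=; lia.
Qed.

Lemma seg_list i : seg i (list_end V i - i) = nums_list (s_list V i).
Proof.
have -> : list_end V i - i = (V i).+1 by rewrite /list_end; lia.
by rewrite seg_cons /nums_list size_mkseq.
Qed.

Lemma seg_trans_inv a (ts : seq transition) :
  seg a (size (flatten (map nums_trans ts))) = flatten (map nums_trans ts) ->
  mkseq (fun j => (V (0 + (4 * j + a)), V (1 + (4 * j + a)), V (2 + (4 * j + a)),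
    V (3 + (4 * j + a)))) (size ts) = ts.
Proof.
elim: ts a => //= -[[[s x] y] s'] ts IH a /=; rewrite !seg_cons => -[E1 E2 E3 E4 E5].
rewrite /mkseq /= -[1]add1n iotaDl -map_comp; congr (_ :: _).
  by rewrite !add0n !add1n !add2n !add3n E1 E2 E3 E4.
rewrite -[RHS](IH _ E5); apply: eq_map => j /=.
by have -> : 4 * (1 + j) + a = 4 * j + a.+4 by lia.
Qed.

Lemma seg_trans a m : seg a (4 * m) = flatten (map nums_trans
  (mkseq (fun j => (V (0 + (4 * j + a)), V (1 + (4 * j + a)), V (2 + (4 * j + a)),
    V (3 + (4 * j + a)))) m)).
Proof.
elim: m => [|m IH]; first by rewrite muln0.
rewrite mkseqS map_rcons flatten_rcons -IH mulnS addnC seg_add !seg_cons /=.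
by rewrite [a + _]addnC add0n !add1n !add2n !add3n.
Qed.

Lemma seg_words_inv a (ws : seq (seq nat)) :
  seg a (size (flatten (map nums_list ws))) = flatten (map nums_list ws) ->
  mkseq (fun m => s_list V (iter m (list_end V) a)) (size ws) = ws /\
  iter (size ws) (list_end V) a = a + size (flatten (map nums_list ws)).
Proof.
elim: ws a => [|w ws IH] a; first by rewrite addn0.
rewrite -[flatten _]/(nums_list w ++ flatten (map nums_list ws)).
move=> /seg_cat[/seg_nums_list[_ E1 E2] /IH]; rewrite -E2 => -[E3 E4]; split.
  rewrite /mkseq /= E1 -[1]add1n iotaDl -map_comp; congr (_ :: _).
  by rewrite -[RHS]E3; apply: eq_map => m /=; rewrite -iterS iterSr.
by rewrite [size (_ :: _)]/= iterSr E4 E2 size_cat addnA.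
Qed.

Lemma iter_list_end a m : a <= iter m (list_end V) a.
Proof. by elim: m => //= m IH; exact: leq_trans IH (leqW (leq_addl _ _)). Qed.

Lemma seg_words a m : seg a (iter m (list_end V) a - a) =
  flatten (map nums_list (mkseq (fun m => s_list V (iter m (list_end V) a)) m)).
Proof.
elim: m => [|m IH]; first by rewrite subnn.
rewrite mkseqS map_rcons flatten_rcons -IH -seg_list iterS.
have H := iter_list_end a m; set b := iter m _ a in H *.
have H' : b < list_end V b by rewrite /list_end; lia.
have -> : list_end V b - a = (b - a) + (list_end V b - b) by lia.
by rewrite seg_add subnKC.
Qed.

(** Whatever the stream, the numbers consumed by the parse are the serialisation of the instance it
    yields; soundness then only has to locate the end of the instance. *)
Lemma seg_inst : seg 0 (inst_end V) = nums (s_inst V).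
Proof.
have L i : i < list_end V i by rewrite /list_end; lia.
have H1 := L 3; have H2 := L (i_fin_at V); rewrite -/(i_fin_at V) in H1.
rewrite -/(i_trans_at V) in H2.
have H3 : i_trans_at V < i_words_at V by rewrite /i_words_at; lia.
have H4 := iter_list_end (i_words_at V).+1 (V (i_words_at V)).
rewrite -/(word_at V _) -/(inst_end V) in H4.
have -> : inst_end V = 3 + ((i_fin_at V - 3) + ((i_trans_at V - i_fin_at V) +
   ((4 * V (i_trans_at V)).+1 + (inst_end V - (i_words_at V).+1).+1))).
  have Ew : i_words_at V = (4 * V (i_trans_at V) + i_trans_at V).+1 by [].
  by move: H1 H2 H3 H4 Ew; move: (inst_end V) (i_words_at V) (i_trans_at V) (i_fin_at V); lia.
rewrite seg_add [seg 0 3]/= add0n seg_add seg_list seg_add.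
have -> : 3 + (i_fin_at V - 3) = i_fin_at V by lia.
rewrite seg_list seg_add.
have -> : i_fin_at V + (i_trans_at V - i_fin_at V) = i_trans_at V by lia.
have -> : i_trans_at V + (4 * V (i_trans_at V)).+1 = i_words_at V by rewrite /i_words_at; lia.
by rewrite !seg_cons seg_words seg_trans /nums /= !size_mkseq.
Qed.

(** The converse direction, which serves completeness of the verifier and injectivity of the
    encoding. *)
Lemma seg_inst_inv I : seg 0 (size (nums I)) = nums I ->
  s_inst V = I /\ inst_end V = size (nums I).
Proof.
move/seg_cat=> [E0 /seg_cat[/seg_nums_list[_ E1 E1'] /seg_cat[]]].
rewrite -E1' add0n -/(i_fin_at V) => /seg_nums_list[_ E2 E2'].
rewrite -E2' -/(i_trans_at V) => /seg_cat[].
rewrite [size (_ :: _)]/= seg_cons => -[E3 E3'].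
have W : i_trans_at V + (size (flatten [seq nums_trans i | i <- i_trans I])).+1 = i_words_at V.
  rewrite /i_words_at E3; suff -> : size (flatten [seq nums_trans i | i <- i_trans I]) =
    4 * size (i_trans I) by lia.
  by elim: (i_trans I) => //= t ts ->; lia.
rewrite W [size (_ :: _)]/= seg_cons => -[E4 /seg_words_inv[E5 E5']].
move: E0 => /= [V0 V1 V2]; rewrite !addn0 !add0n in V0 V1 V2.
split.
  rewrite /s_inst V0 V1 V2 E1 E2 E3 E4 /word_at E5.
  by rewrite (seg_trans_inv E3'); case: (I).
rewrite /inst_end /word_at E4 E5' /nums !size_cat.
move: W E1' E2'; rewrite -/(i_fin_at V) -/(i_trans_at V) /= size_cat /= size_cat /=.
move: (size (flatten [seq nums_trans i | i <- i_trans I])) (size (i_init I)) (size (i_fin I)).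
move: (size (flatten _)) (i_words_at V) (i_trans_at V) (i_fin_at V) => *; lia.
Qed.

End Segments.

Lemma bits_cat x y : bits (x ++ y) = bits x ++ bits y.
Proof. exact: map_cat. Qed.

Lemma val_at_read z p v c rest : drop p z = nseq v (Some true) ++ c :: rest -> c != Some true ->
  val_at z p = v /\ drop (next_num z p) z = rest.
Proof.
move=> E Hc; have Ev : val_at z p = v.
  rewrite /val_at E find_cat has_nseq /= andbF size_nseq Hc addn0 //.
split=> //; rewrite /next_num Ev -addSn -drop_drop E -cat_rcons drop_size_cat //.
by rewrite size_rcons size_nseq.
Qed.

Lemma read_nums z p l rest : drop p z = bits (enc_nums l) ++ rest ->
  mkseq (fun j => val_at z (iter j (next_num z) p)) (size l) = l /\
  drop (iter (size l) (next_num z) p) z = rest.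
Proof.
elim: l p => [|v l IH] p //=.
rewrite /enc_nums /= -/(enc_nums l) bits_cat /enc_nat bits_cat /bits map_nseq -!catA.
move=> /val_at_read[//|E1 /IH[E2 E3]]; split; last by rewrite -iterS iterSr.
rewrite /mkseq /= E1 -[1]add1n iotaDl -map_comp; congr (_ :: _).
by rewrite -[RHS]E2; apply: eq_map => m /=; rewrite -iterS iterSr.
Qed.

(** Within [x] a number can only be ended by a bit other than [true], hence by [false], as in
    [enc_nat]; so what has been read is literally an encoding. *)
Lemma pos_enc x y j : let z := pair_input x y in iter j (next_num z) 0 <= size x ->
  take (iter j (next_num z) 0) x = enc_nums (seg (num z) 0 j).
Proof.
move=> z; elim: j => [|j IH]; first by rewrite take0.
rewrite iterS; set p := iter j _ 0 => le_x.
have lt_p := next_num_gt z p.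
rewrite /seg mkseqS -cats1 enc_nums_cat add0n /num -/p -IH -/p; last by lia.
have -> : next_num z p = p + (val_at z p).+1 by rewrite /next_num; lia.
rewrite takeD; congr (_ ++ _).
set v := val_at z p in le_x *; have Hv : p + v < size x by move: le_x; rewrite /next_num -/v; lia.
have Hz i : p + i < size x -> onth z (p + i) = Some (onth x (p + i)).
  by move=> Hi; rewrite /z onth_cat size_map Hi onthE (nth_map None) ?size_map // onthE.
rewrite /enc_nums /= cats0; apply: (@eq_from_nth _ false).
  by rewrite size_take_min size_drop /enc_nat size_cat size_nseq /=; lia.
move=> i; rewrite size_take_min size_drop => Hi; have {}Hi : i < v.+1 by lia.
rewrite nth_take // nth_drop /enc_nat nth_cat size_nseq.
have le_iv : i <= val_at z p by [].
have := onth_val_at le_iv; rewrite Hz; last by lia.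
rewrite (onthE x) (nth_map false); last by lia.
rewrite -/v; case: ltnP => [lt_iv|ge_iv]; first by rewrite nth_nseq lt_iv => /eqP[->].
by have -> : i - v = 0 by [lia]; case: nth.
Qed.

(** * Correctness of the certificate check *)

Notation t0 := ((0, 0, 0, 0) : transition).

Definition state_before (s : nat) (r : seq transition) (t : nat) : nat :=
  if t == 0 then s else (nth t0 r t.-1).2.

Lemma chainP s r : reflect (forall t, t < size r -> (nth t0 r t).1.1.1 = state_before s r t)
  (chain s r).
Proof.
elim: r s => [|u r IH] s /=; first by constructor.
apply: (iffP andP) => [[/eqP E /IH H] [|[|t]] //|H].
- by move=> Ht; have := H 0 Ht.
- by move=> Ht; have := H t.+1 Ht.
- split; first by apply/eqP; exact: (H 0).
  by apply/IH => -[|t] Ht; [exact: (H 1) | exact: (H t.+2)].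
Qed.

Lemma last_state s r : last s (map snd r) = state_before s r (size r).
Proof.
case/lastP: r => // r u.
by rewrite map_rcons last_rcons size_rcons /state_before /= nth_rcons ltnn eqxx.
Qed.

(** Justifies the letter test of [check], which uses a count of earlier steps in place of a
    projection. *)
Lemma nth_dproj r t : t < size r ->
  nth 0 (dproj (nth t0 r t).1.2 r) (size (dproj (nth t0 r t).1.2 (take t r))) = (nth t0 r t).1.1.2.
Proof.
move=> Ht; set u := nth t0 r t; set r1 := take t r.
have -> : dproj u.1.2 r = dproj u.1.2 r1 ++ u.1.1.2 :: dproj u.1.2 (drop t.+1 r).
  rewrite -{1}[r](cat_take_drop t) (drop_nth t0 Ht) -/u -/r1.
  by rewrite /dproj filter_cat map_cat /= eqxx.
by rewrite nth_cat ltnn subnn.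
Qed.

(** The layout is that expected by [run_len], [start], [step_idx], [word_idx] and [word_off]; of the
    suitable words and offsets the first ones are taken. *)
Definition certificate (I : naa_inst) s (r : seq transition) : seq nat :=
  [:: size r; s] ++ [seq index t (i_trans I) | t <- r] ++
  mkseq (fun x => find (infix (dproj x r)) (i_words I)) (nk I) ++
  mkseq (fun x => infix_index (dproj x r)
     (nth [::] (i_words I) (find (infix (dproj x r)) (i_words I)))) (nk I).

Section Check.
Variable V : nat -> nat.
Notation I := (s_inst V).

Definition run_step t := (step_comp V t 0, step_comp V t 1, step_comp V t 2, step_comp V t 3).
Definition s_run := mkseq run_step (run_len V).

Lemma dir_countE x t : dir_count V x t = size (dproj x (mkseq run_step t)).
Proof. by rewrite size_map size_filter count_map. Qed.

Lemma state_atE t : t <= run_len V -> state_at V t = state_before (start V) s_run t.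
Proof.
by case: t => [|t] // lt_t; rewrite /state_at /state_before /= nth_mkseq.
Qed.

Lemma take_s_run t : t <= run_len V -> take t s_run = mkseq run_step t.
Proof. by move=> le_t; rewrite -map_take take_iota (minn_idPl le_t). Qed.

Lemma nth_s_words m : m < V (i_words_at V) -> nth [::] (i_words I) m = s_list V (word_at V m).
Proof. by move=> Hm; rewrite /= nth_mkseq. Qed.

Lemma nth_s_trans j : j < V (i_trans_at V) -> nth t0 (i_trans I) j =
  (trans_comp V j 0, trans_comp V j 1, trans_comp V j 2, trans_comp V j 3).
Proof. by move=> Hm; rewrite /= nth_mkseq. Qed.

Lemma check_sound : check V -> inst_wf I /\ nat_match I.
Proof.
case/and5P=> wfI /allP Hidx /allP Hsrc /hasP[j0 Hj0 /eqP E0] /and3P[/hasP[j1 Hj1 /eqP E1] /allP Hw /allP Hl].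
rewrite mem_iota /= in Hj0; rewrite mem_iota /= in Hj1.
split => //; exists (start V), s_run; split.
- by apply/mapP; exists j0; rewrite ?mem_iota // -E0 addnC.
- move=> u /mapP[t Ht ->]; have := Hidx t Ht => Hi.
  rewrite -[run_step t]/(trans_comp V (step_idx V t) 0, trans_comp V (step_idx V t) 1,
    trans_comp V (step_idx V t) 2, trans_comp V (step_idx V t) 3).
  by rewrite -nth_s_trans // mem_nth // size_mkseq.
- apply/chainP => t; rewrite size_mkseq => Ht; rewrite -state_atE 1?ltnW // nth_mkseq //=.
  by apply/eqP/Hsrc; rewrite mem_iota.
- rewrite last_state size_mkseq -state_atE // -E1.
  by apply/mapP; exists j1; rewrite ?mem_iota // addnC.
move=> x Hx; have /andP[Hu Ho] : (word_idx V x < V (i_words_at V)) &&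
        (word_off V x + dir_count V x (run_len V) <= V (word_at V (word_idx V x))).
  by apply: Hw; rewrite mem_iota.
(* What direction [x] reads in the first [t] steps is a segment of its chosen word: each further
   step in that direction extends it by the next letter. *)
have Hd t : t <= run_len V -> dproj x (mkseq run_step t) = mkseq (fun k =>
    V (k + (word_off V x + (word_at V (word_idx V x)).+1))) (dir_count V x t).
  elim: t => [|t IH] // lt_t; rewrite mkseqS -cats1 /dproj filter_cat map_cat -/(dproj _ _) IH 1?ltnW //.
  rewrite /dir_count -[t.+1]addn1 iotaD count_cat /= addn0.
  case: eqP => [E|_] /=; last by rewrite addn0 cats0.
  rewrite addn1 mkseqS cats1; congr rcons.
  have := Hl t; rewrite mem_iota /= add0n => /(_ lt_t)/eqP.
  by rewrite E.
apply/hasP; exists (nth [::] (i_words I) (word_idx V x)); first by rewrite mem_nth // size_mkseq.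
rewrite nth_s_words // [dproj _ _]Hd //.
suff -> : mkseq (fun k => V (k + (word_off V x + (word_at V (word_idx V x)).+1)))
   (dir_count V x (run_len V)) =
   subword (s_list V (word_at V (word_idx V x))) (word_off V x).+1
     (word_off V x + dir_count V x (run_len V)) by exact: infix_subword.
apply: (@eq_from_nth _ 0).
  by rewrite size_mkseq size_drop size_take_min size_mkseq /=; lia.
move=> k; rewrite size_mkseq => Hk; rewrite nth_mkseq // nth_drop nth_take /=; last by lia.
by rewrite nth_mkseq; [congr V; lia | lia].
Qed.

Lemma check_complete s r : inst_wf I ->
  s \in i_init I -> {subset r <= i_trans I} -> chain s r -> last s (map snd r) \in i_fin I ->
  (forall x, x < nk I -> has (infix (dproj x r)) (i_words I)) ->
  seg V (cert V) (size (certificate I s r)) = certificate I s r -> check V.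
Proof.
move=> wfI Hs Hr Hc Hf Hx /seg_cat[E0 /seg_cat[E1 /seg_cat[E2 E3]]].
move: E0 => /= [/=]; rewrite addn0 addn1 -/(run_len V) -/(start V) => El Es.
rewrite /= addn2 size_map in E1 E2 E3; rewrite !size_mkseq in E2 E3.
have Hstep t : t < size r -> step_idx V t = index (nth t0 r t) (i_trans I).
  move=> Ht; have := congr1 (nth 0 ^~ t) E1; rewrite nth_mkseq // (nth_map t0) //.
  by rewrite /step_idx addnC.
have Hmem t : t < size r -> nth t0 r t \in i_trans I by move=> Ht; apply/Hr/mem_nth.
have Hlt t : t < size r -> step_idx V t < V (i_trans_at V).
  by move=> Ht; rewrite Hstep //; have := Hmem t Ht; rewrite -index_mem size_mkseq.
have Er : s_run = r.
  apply: (@eq_from_nth _ t0); rewrite size_mkseq El // => t Ht.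
  rewrite nth_mkseq ?El // -[RHS](nth_index t0 (Hmem t Ht)) -Hstep //.
  by rewrite nth_s_trans ?Hlt.
have Hnth t : t < size r -> nth t0 r t = run_step t.
  by move=> Ht; rewrite -Er nth_mkseq // El.
have Hu x : x < nk I -> word_idx V x = find (infix (dproj x r)) (i_words I).
  move=> lt_x; have := congr1 (nth 0 ^~ x) E2; rewrite !nth_mkseq //.
  by rewrite /word_idx El => <-; congr V; lia.
have Ho x : x < nk I -> word_off V x = infix_index (dproj x r)
     (nth [::] (i_words I) (word_idx V x)).
  move=> lt_x; have := congr1 (nth 0 ^~ x) E3; rewrite !(nth_mkseq 0) // Hu // => <-.
  by rewrite /word_off El; congr V => /=; lia.
have Hwd x : x < nk I -> word_idx V x < V (i_words_at V).
  by move=> lt_x; rewrite Hu //; have := Hx x lt_x; rewrite has_find size_mkseq.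
have Hin x : x < nk I -> let w := s_list V (word_at V (word_idx V x)) in
    word_off V x <= size w /\ take (size (dproj x r)) (drop (word_off V x) w) = dproj x r.
  move=> lt_x w; rewrite Ho //; have := nth_find [::] (Hx x lt_x).
  rewrite -Hu // nth_s_words ?Hwd // -/w => Hi; split; first by rewrite infixTindex.
  by apply/eqP; rewrite -infixE.
rewrite /check El wfI /=; apply/and5P; split.
- by apply/allP => t; rewrite mem_iota => Ht; exact: Hlt.
- apply/allP => t; rewrite mem_iota => /andP[_ /= Ht]; apply/eqP.
  rewrite state_atE ?El 1?ltnW // Er Es; have /chainP/(_ t Ht) <- := Hc.
  by rewrite Hnth.
- case/mapP: Hs => j Hj E; apply/hasP; exists j => //.
  by rewrite Es E addnC.
- case/mapP: Hf => j Hj E; apply/hasP; exists j => //.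
  by rewrite state_atE ?El // Er Es -last_state E addnC.
apply/andP; split.
  apply/allP => x; rewrite mem_iota => /andP[_ lt_x]; rewrite Hwd //=.
  rewrite dir_countE -{1}El -/s_run Er; have [H1 H2] := Hin x lt_x.
  have := congr1 size H2; rewrite size_take_min size_drop; rewrite size_mkseq in H1 *; lia.
apply/allP => t; rewrite mem_iota => /andP[_ /= Ht]; apply/eqP.
have lt_x : step_comp V t 2 < nk I.
  case/and4P: wfI => _ _ /allP/(_ _ (Hmem t Ht)); rewrite Hnth // => /and4P[_ _ H _] _; exact: H.
have [H1 H2] := Hin _ lt_x.
rewrite dir_countE -take_s_run ?El 1?ltnW // Er.
have := nth_dproj Ht; have -> : (nth t0 r t).1.2 = step_comp V t 2 by rewrite Hnth.
have -> : (nth t0 r t).1.1.2 = step_comp V t 1 by rewrite Hnth.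
move=> <-; set x := step_comp V t 2 in lt_x H1 H2 *; set k := size (dproj x (take t r)).
have lt_k : k < size (dproj x r).
  rewrite /k -{2}[r](cat_take_drop t) /dproj filter_cat map_cat size_cat -/(dproj _ _).
  rewrite (drop_nth t0 Ht) /= Hnth //= eqxx /=; lia.
rewrite -H2 nth_take // nth_drop nth_mkseq; first by congr V; lia.
have := congr1 size H2; rewrite size_take_min size_drop size_mkseq; lia.
Qed.

End Check.

Lemma verify_sound x y : verify (pair_input x y) -> NAA_MATCH_NONEMPTY x.
Proof.
set z := pair_input x y; set V := num z; case/andP=> /eqP Hend /check_sound[wfI Hm].
(* The separator is the only symbol [None] of the input, and it stands at position [size x]. *)
have Epos : iter (inst_end V) (next_num z) 0 = size x.
  move: Hend; set p := iter _ _ _; rewrite /z onth_cat size_map.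
  case: ltnP => [lt_p|le_p]; first by rewrite onth_map; case: onth.
  case E: (p - size x) => [|j] /=; first by lia.
  by rewrite onth_map; case: onth.
exists (s_inst V); split => //; last by apply/(match_nat wfI).
rewrite enc_inst_nums -seg_inst -[x in LHS]take_size -Epos.
by apply: pos_enc; rewrite Epos.
Qed.

Lemma size_enc_nums l : size (enc_nums l) = sumn l + size l.
Proof.
elim: l => // v l IH; rewrite enc_nums_cons size_cat IH size_cat size_nseq /=; lia.
Qed.

Lemma mem_le_sumn v l : v \in l -> v <= sumn l.
Proof. by elim: l => //= u l IH; rewrite inE => /predU1P[->|/IH]; lia. Qed.

Lemma nums_le I v : v \in nums I -> v <= size (enc_inst I).
Proof. by move/mem_le_sumn; rewrite enc_inst_nums size_enc_nums; lia. Qed.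

(** A run has at most [n * n] steps, so there are at most [n * n + 2 * n + 2] numbers, each at most
    [n * n + n + 1]. With one terminator per number the product stays within the fourth power of
    [n + 2]. *)
Lemma certificate_size I s r : inst_wf I -> s \in i_init I -> {subset r <= i_trans I} ->
  (forall x, x < nk I -> has (infix (dproj x r)) (i_words I)) ->
  size (enc_nums (certificate I s r)) <= (size (enc_inst I)).+2 ^ 4.
Proof.
move=> wfI Hs Hr Hx; set n := size (enc_inst I).
have Hnk : nk I <= n by apply: nums_le; rewrite !inE eqxx orbT.
have Hsn : s <= n by apply: nums_le; rewrite /nums !mem_cat [_ \in nums_list (i_init I)]inE Hs !orbT.
have Ht : size (i_trans I) <= n by apply: nums_le; rewrite /nums !mem_cat mem_head !orbT.
have Hws : size (i_words I) <= n by apply: nums_le; rewrite /nums !mem_cat mem_head !orbT.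
have Hw w : w \in i_words I -> size w <= n.
  move=> wI; apply: nums_le; rewrite /nums !mem_cat [_ \in size (i_words I) :: _]inE; do 5 (apply/orP; right).
  by apply/flattenP; exists (nums_list w); [exact: map_f | exact: mem_head].
clearbody n.
have Hd x : x < nk I -> size (dproj x r) <= n.
  by move=> /Hx /hasP[w wI /size_infix H]; exact: leq_trans H (Hw w wI).
have Hrn : size r <= n * n.
  rewrite (sum_dproj (k := nk I)); last first.
    by move=> t /Hr tI; case/and4P: wfI => _ _ /allP/(_ t tI)/and4P[].
  apply: (@leq_trans (\sum_(x < nk I) n)); first by apply: leq_sum => x _; exact: Hd.
  by rewrite sum_nat_const card_ord leq_mul2r Hnk orbT.
have Hall v : v \in certificate I s r -> v <= n * n + n + 1.
  rewrite /certificate !mem_cat !inE => /or4P[|||].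
  - by case/orP=> /eqP->; [apply: leq_trans Hrn _|apply: leq_trans Hsn _]; lia.
  - by case/mapP=> t /Hr; rewrite -index_mem => /ltnW/leq_trans/(_ Ht) Hi ->; apply: leq_trans Hi _; lia.
  - by case/mapP=> x _ ->; apply: leq_trans (leq_trans (find_size _ _) Hws) _; lia.
  case/mapP=> x; rewrite mem_iota => /andP[_ /= lt_x] ->.
  have := Hx x lt_x; rewrite has_find => /(mem_nth [::])/Hw.
  move: (nth _ _ _) => w Hn; apply: leq_trans (infix_index_le _ _) _.
  by apply: leq_ltn_trans Hn _; lia.
have Hsz : size (certificate I s r) <= n * n + 2 * n + 2.
  by rewrite /certificate !size_cat size_map !size_mkseq /=; move: (size r) Hrn => m; lia.
have Hsum l B : (forall v, v \in l -> v <= B) -> sumn l <= size l * B.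
  elim: l => //= v l IH H; rewrite mulSn leq_add ?H ?mem_head // IH // => u ul.
  by apply: H; rewrite inE ul orbT.
rewrite size_enc_nums; have := Hsum _ _ Hall; move: (sumn _) (size _) Hsz => a b Hb Ha.
have -> : n.+2 ^ 4 = (n.+2 * n.+2) * (n.+2 * n.+2) by rewrite !mulnn -expnM.
apply: (@leq_trans (b * (n * n + n + 2))); first by lia.
by apply: leq_mul; lia.
Qed.

Lemma verify_complete x : NAA_MATCH_NONEMPTY x ->
  exists2 y, size y <= (size x).+2 ^ 4 & verify (pair_input x y).
Proof.
case=> I [wfI Ex /(match_nat wfI)[s [r [Hs Hr Hc Hf Hx]]]].
exists (enc_nums (certificate I s r)); first by rewrite Ex; exact: certificate_size.
set z := pair_input _ _.
have Ez : drop 0 z = bits (enc_nums (nums I)) ++ None :: bits (enc_nums (certificate I s r)).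
  by rewrite drop0 /z /pair_input Ex enc_inst_nums.
have [E1 E2] := read_nums Ez.
have [EI Eend] := @seg_inst_inv (num z) I E1.
rewrite -Eend in E2; set p := iter _ _ _ in E2.
apply/andP; split.
  by rewrite -/p -[p]addn0 !onthE -nth_drop -map_drop E2.
have [//|_ E3] := @val_at_read z p 0 None _ E2.
have E4 : drop (next_num z p) z = bits (enc_nums (certificate I s r)) ++ [::] by rewrite cats0.
have [E5 _] := read_nums E4; rewrite -{}EI in Hs Hr Hc Hf Hx wfI E5.
apply: check_complete Hs Hr Hc Hf Hx _ => //.
rewrite -[RHS]E5; apply: eq_map => j.
by rewrite /num /cert addnC iterD.
Qed.

(** * Membership in NP *)

Lemma halts_uniq (M : TM) z t t' (c c' : config M) :
  halts_within z t c -> halts_within z t' c' -> c = c'.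
Proof.
move=> [n [_ E S]] [n' [_ E' S']].
wlog le_n : n n' c c' E S E' S' / n <= n'.
  by move=> H; case: (leqP n n') => [|/ltnW] ?; [|symmetry]; apply: H; eassumption.
elim: n n' (init_config M z) E E' le_n => [|n IH] [|n'] c0 //=.
- by move=> [->] [->].
- by move=> [->]; rewrite S.
- by case: (step c0) => // c1 E E'; exact: IH E E'.
Qed.

(** Brings bounds into the shape [d * m ^ d + d] of the definitions. For [m > 0] it uses
    [m + 3 <= 4 * m]; the additive constant covers [m = 0]. *)
Lemma poly_form p q m : p <= q -> (m + 3) ^ p <= 4 ^ q * m ^ (4 ^ q) + 4 ^ q.
Proof.
move=> le_pq; case: m => [|m].
  apply: leq_trans (leq_addl _ _); apply: (@leq_trans (4 ^ p)); last by rewrite leq_pexp2l.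
  by case: (p) => // k; rewrite leq_exp2r.
apply: leq_trans (leq_addr _ _); apply: (@leq_trans ((4 * m.+1) ^ p)).
  by case: (p) => // k; rewrite leq_exp2r //; lia.
rewrite expnMn leq_mul ?leq_pexp2l //.
by apply: leq_trans le_pq (ltnW (ltn_expl _ _)).
Qed.

Theorem naa_match_in_NP : in_NP NAA_MATCH_NONEMPTY.
Proof.
have [M [p HM]] := decider vBd_gt vBd_poly cptb_verify.
(* One constant for the running time, of exponent [p], and for the certificate length, of exponent
   4. *)
exists M, (4 ^ (p + 4)).
have Hrun x y : exists c, @halts_within M (pair_input x y)
    (4 ^ (p + 4) * (size x + size y) ^ (4 ^ (p + 4)) + 4 ^ (p + 4)) c /\
    accepting c = verify (pair_input x y).
  have [c [[n [Hn E S]] Ha]] := HM (pair_input x y); exists c; split => //.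
  exists n; split => //; apply: leq_trans Hn _.
  have -> : (size (pair_input x y)).+2 = size x + size y + 3.
    by rewrite size_cat /= !size_map; lia.
  by apply: poly_form; exact: leq_addr.
split=> [x y|x]; first by have [c [H _]] := Hrun x y; exists c.
split.
  case/verify_complete=> y Hy Hv; have [c [Hc Ha]] := Hrun x y.
  exists y, c; split => //; last by rewrite Ha.
  apply: leq_trans Hy _; apply: (@leq_trans ((size x + 3) ^ 4)).
    by rewrite leq_exp2r //; lia.
  by apply: poly_form; exact: leq_addl.
(* By determinism the accepting configuration given here is the one whose verdict is known. *)
move=> [y [c [_ Hc Ha]]]; have [c' [Hc' Ha']] := Hrun x y.
by apply: (@verify_sound x y); rewrite -Ha' -(halts_uniq Hc Hc').
Qed.

(** * From constraint satisfaction to automata *)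

(* Clause [j] is a disjunction of equations [variable = letter], and each of its literals
   gives a transition from state [j] to [j.+1] that reads the letter in the direction of
   the variable.  As the words are powers of a letter, a direction reads only one letter. *)
Section CSP.
Variables (ns nv C : nat) (cl : nat -> seq (nat * nat)) (I : naa_inst).
Hypotheses (ns_gt0 : 0 < ns) (sigI : nsig I = ns) (kI : nk I = nv) (stI : nst I = C.+1)
  (initI : i_init I = [:: 0]) (finI : i_fin I = [:: C])
  (wordsI : i_words I = mkseq (fun a => nseq C a) ns)
  (transI : forall t, t \in i_trans I <->
     exists j l, [/\ j < C, l \in cl j & t = (j, l.2, l.1, j.+1)])
  (cl_lt : forall j l, j < C -> l \in cl j -> (l.1 < nv) && (l.2 < ns)).

Lemma csp_wf : inst_wf I.
Proof.
apply/and4P; split; rewrite ?initI ?finI ?stI /= ?ltnSn //.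
- apply/allP => t /transI[j [l [lt_j lj ->]]] /=.
  by have /andP[] := cl_lt lt_j lj; rewrite ?stI sigI kI => -> ->; rewrite !ltnS ltnW.
- apply/allP => w; rewrite wordsI => /mapP[a]; rewrite mem_iota => /andP[_ lt_a] ->.
  by apply/allP => b /nseqP[-> _]; rewrite sigI.
Qed.

(** Every transition raises the state by one, so no state on the way to [C] can be skipped. *)
Lemma chain_visits s r : {subset r <= i_trans I} -> chain s r -> last s (map snd r) = C ->
  forall j, s <= j < C -> exists2 t, t \in r & t.1.1.1 = j.
Proof.
elim: r s => [|t r IH] s Hr /=; first by move=> _ -> j; lia.
case/andP=> /eqP Et Hc Hl j Hj.
have /transI[i [l [_ _ E]]] : t \in i_trans I by apply: Hr; rewrite mem_head.
case: (ltnP s j) => lt_j; last by exists t; [exact: mem_head | rewrite Et; lia].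
have [||u ur Eu] := IH t.2 _ Hc Hl j.
- by move=> u ur; apply: Hr; rewrite inE ur orbT.
- by move: Et; rewrite E /=; lia.
by exists u => //; rewrite inE ur orbT.
Qed.

(** Given a match, [v x] is the letter that direction [x] reads, and 0 if it reads none. Conversely,
    one true literal per clause yields a run of [C] steps; no direction reads more than [C] letters,
    which is why the words have length [C]. *)
Lemma csp_match : nat_match I <-> exists v : nat -> nat, (forall x, v x < ns) /\
  forall j, j < C -> exists2 l, l \in cl j & v l.1 = l.2.
Proof.
split=> [[s [r [Hs Hr Hc Hf Hx]]]|[v [Hv Hcl]]].
  rewrite initI inE in Hs; rewrite finI inE in Hf; move/eqP: Hs Hc Hf => -> Hc /eqP Hf.
  have Hall x : x < nv -> exists2 a, a < ns & forall b, b \in dproj x r -> b = a.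
    rewrite -kI => /Hx/hasP[w]; rewrite wordsI => /mapP[a]; rewrite mem_iota => /andP[_ lt_a] ->.
    by move=> /infixW/mem_subseq H; exists a => // b /H /nseqP[].
  exists (fun x => if x < nv then head 0 (dproj x r) else 0); split=> [x|j lt_j].
    case: (ltnP x nv) => [lt_x|_] //; have [a lt_a Ha] := Hall _ lt_x.
    case: (dproj x r) Ha => [|b l] Hb /=; first exact: ns_gt0.
    by rewrite (Hb b) ?mem_head.
  have [t tr Et] := chain_visits Hr Hc Hf (j := j) lt_j.
  have /transI[i [l [lt_i li E]]] := Hr t tr; exists l; first by rewrite -Et E.
  have /andP[lt_l _] := cl_lt lt_i li; rewrite lt_l.
  have [a _ Ha] := Hall _ lt_l.
  have Hl : l.2 \in dproj l.1 r by apply/mapP; exists t; rewrite ?mem_filter E //= eqxx -E.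
  by rewrite (Ha _ Hl); case: (dproj l.1 r) Ha Hl => //= b l' Hb _; rewrite (Hb b) ?mem_head.
pose lit j := nth (0, 0) (cl j) (find (fun l => v l.1 == l.2) (cl j)).
have Hhas j : j < C -> has (fun l => v l.1 == l.2) (cl j).
  by move=> /Hcl[l lj E]; apply/hasP; exists l => //; apply/eqP.
have lit_in j : j < C -> lit j \in cl j.
  by move=> Hj; apply: mem_nth; rewrite -has_find; exact: Hhas.
have lit_eq j : j < C -> v (lit j).1 = (lit j).2 by move=> Hj; apply/eqP; exact: (nth_find (0, 0) (Hhas j Hj)).
pose f j := (j, (lit j).2, (lit j).1, j.+1).
exists 0, (mkseq f C); split.
- by rewrite initI inE.
- move=> t /mapP[j]; rewrite mem_iota => /andP[_ lt_j] ->; apply/transI.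
  by exists j, (lit j); split => //; exact: lit_in.
- apply/chainP => t; rewrite size_mkseq => Ht; rewrite nth_mkseq // /state_before.
  by case: eqP => [->|] //; case: t Ht => // t Ht _; rewrite nth_mkseq //= ltnW.
- rewrite finI inE last_state size_mkseq /state_before; case: (C) => //= C'.
  by rewrite nth_mkseq.
move=> x; rewrite kI => Hx; rewrite wordsI; apply/hasP; exists (nseq C (v x)).
  by apply/mapP; exists (v x) => //; rewrite mem_iota /= Hv.
have Ed : all (pred1 (v x)) (dproj x (mkseq f C)).
  apply/allP => a /mapP[t]; rewrite mem_filter => /andP[/eqP Ex].
  case/mapP=> j; rewrite mem_iota => /andP[_ lt_j] Et ->; move: Ex; rewrite Et /= => <-.
  by rewrite lit_eq.
have le_C : size (dproj x (mkseq f C)) <= C.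
  by rewrite size_map size_filter -{2}(size_mkseq f C) count_size.
move: (dproj _ _) Ed le_C => u /all_pred1P Eu le_C.
by rewrite -(subnKC le_C) nseqD -Eu; apply: prefixW; exact: prefix_prefix.
Qed.

End CSP.

(** * Computation tableaux *)

Section Tableau.
Variables (M : TM) (d : nat).
Notation G := (tG M).
Notation Q := (tQ M).
Notation blk := (tblank M).

(* [inl None] pads row 0 on the left, [inl (Some None)] on the right, and
   [inl (Some (Some s))] is an input symbol; [inr] letters are tape cells of later rows. *)
Definition letter := (option (option (option bool)) + G * option Q)%type.

(** The first input cell is recognised by the left padding next to it and receives the initial
    state, so row 1 is the initial configuration. A halted head stays as it is. *)
Definition nextl (a b c : letter) : letter :=
  match b with
  | inl None => inr (blk, None)
  | inl (Some o) => inr (if o is Some s then tin M s else blk,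
                         if a is inl None then Some (tq0 M) else None)
  | inr (g, Some q) =>
      match tdelta q g with
      | None => b
      | Some (q', g', mv) => inr (g', if mv is Stay then Some q' else None)
      end
  | inr (g, None) =>
      let from_right := if c is inr (g2, Some q2) then
          if tdelta q2 g2 is Some (q', _, MoveL) then Some q' else None else None in
      inr (g, if a is inr (g1, Some q1) then
          if tdelta q1 g1 is Some (q', _, MoveR) then Some q' else from_right
        else from_right)
  end.

(** No input symbol may follow right padding; this makes the guessed certificate contiguous. *)
Definition legal (a b c : letter) : bool :=
  if b is inl (Some None) then if c is inl (Some (Some _)) then false else true else true.

(** The number is the absolute column of the head, of which a configuration keeps no record. *)
Definition ch := (config M * nat)%type.

Definition cells (e : ch) (p : nat) : G :=
  let: ((q, l, g, r), h) := e in
  if p < h then nth blk l (h - p.+1) else if p == h then g else nth blk r (p - h.+1).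

Definition cellst (e : ch) (p : nat) : letter :=
  inr (cells e p, if p == e.2 then Some e.1.1.1.1 else None).

(** A halted configuration is repeated, so the last row shows the final configuration whenever the
    machine halted. *)
Definition adv (e : ch) : ch :=
  let: ((q, l, g, r), h) := e in
  match tdelta q g with
  | None => e
  | Some (q', g', mv) => (do_move mv (q', l, g', r),
      match mv with MoveL => h.-1 | MoveR => h.+1 | Stay => h end)
  end.

(** In column 0 a move to the left would leave [h.-1] at 0 and shift the tape instead; hence
    [0 < e.2]. *)
Lemma cells_adv e p : 0 < e.2 -> p != e.2 -> cells (adv e) p = cells e p.
Proof.
case: e => -[[[q l] g] r] h /= h0 ph; case: (tdelta q g) => [[[q' g'] mv]|] //.
case: mv => /=.
- case: l => [|a l] /=; rewrite ?nth_nil.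
  + case: (ltnP p h.-1) => H1; first by rewrite ifT //; lia.
    case: eqP => H2; first by rewrite ifT //; lia.
    rewrite ifF; last by lia.
    rewrite (negbTE ph); have -> : p - h.-1.+1 = (p - h.+1).+1 by lia.
    by [].
  + case: (ltnP p h.-1) => H1.
      rewrite ifT; last by lia.
      by have -> : h - p.+1 = (h.-1 - p.+1).+1 by lia.
    case: eqP => H2; first by rewrite ifT; [have -> : h - p.+1 = 0 by lia | lia].
    rewrite ifF; last by lia.
    by rewrite (negbTE ph); have -> : p - h.-1.+1 = (p - h.+1).+1 by lia.
- case: r => [|a r] /=.
  + case: (ltnP p h.+1) => H1.
      rewrite ifT; last by lia.
      by have -> : h.+1 - p.+1 = (h - p.+1).+1 by lia.
    by have -> : (p < h) = false by [lia]; rewrite (negbTE ph) !nth_nil if_same.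
  + case: (ltnP p h.+1) => H1.
      rewrite ifT; last by lia.
      by have -> : h.+1 - p.+1 = (h - p.+1).+1 by lia.
    have -> : (p < h) = false by lia.
    rewrite (negbTE ph); case: eqP => [->|H2]; first by rewrite subnn.
    by have -> : p - h.+1 = (p - h.+2).+1 by lia.
- by rewrite (negbTE ph).
Qed.

Lemma cells_adv_head e : 0 < e.2 -> cells (adv e) e.2 =
  if tdelta e.1.1.1.1 e.1.1.2 is Some (_, g', _) then g' else e.1.1.2.
Proof.
case: e => -[[[q l] g] r] h /= h0; case: (tdelta q g) => [[[q' g'] mv]|] /=; last first.
  by rewrite ltnn eqxx.
case: mv => /=.
- case: l => [|a l] /=; rewrite ifF ?ifF; try lia;
    by have -> : h - h.-1.+1 = 0 by lia.
- by case: r => [|a r] /=; rewrite ltnSn subnn.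
- by rewrite ltnn eqxx.
Qed.

Lemma adv_local e p : 0 < e.2 ->
  cellst (adv e) p.+1 = nextl (cellst e p) (cellst e p.+1) (cellst e p.+2).
Proof.
move=> h0; rewrite /cellst.
have [E1|N1] := eqVneq p.+1 e.2.
  rewrite E1 cells_adv_head //=.
  case: e h0 E1 => -[[[q l] g] r] h /= h0 E1; rewrite ltnn eqxx.
  case: (tdelta q g) => [[[q' g'] mv]|] /=; last by rewrite eqxx.
  case: mv => /=; [case: (l) => [|? ?] /=|case: (r) => [|? ?] /=|by rewrite eqxx]; by rewrite ifF //; lia.
rewrite cells_adv //; congr (inr (_, _)).
have Eg : e.1.1.2 = cells e e.2 by case: (e) => -[[[q l] g] r] h /=; rewrite ltnn eqxx.
have HQ : (if p.+1 == (adv e).2 then Some (adv e).1.1.1.1 else None) =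
  if tdelta e.1.1.1.1 e.1.1.2 is Some (q', _, mv) then
    match mv with
    | MoveL => if p.+2 == e.2 then Some q' else None
    | MoveR => if p == e.2 then Some q' else None
    | Stay => None end else None.
  case: (e) h0 N1 => -[[[q l] g] r] h /= h0 N1.
  case: (tdelta q g) => [[[q' g'] mv]|] /=; last by rewrite (negbTE N1).
  case: mv => /=; last by rewrite (negbTE N1).
  + have -> : (p.+1 == h.-1) = (p.+2 == h) by lia.
    by case: (l).
  + by rewrite eqSS; case: (r).
rewrite {}HQ Eg.
have [E2|N2] := eqVneq p e.2.
  rewrite -E2; have -> : (p.+2 == p) = false by lia.
  by case: tdelta => [[[q' g'] []]|].
have [E3|N3] := eqVneq p.+2 e.2; rewrite -?E3; case: tdelta => [[[q' g'] []]|] //.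
Qed.

Variable x : seq bool.
Notation n := (size x).

Definition ylen m := d * m ^ d + d.
Definition tlen m := d * (m + ylen m) ^ d + d.
(** The head starts in this column and makes at most [tlen m] moves, and the input extends over at
    most [m + ylen m + 1] columns from there. Three halves thus contain the whole run with both ends
    of each row untouched, and there are enough rows to pass the halting time. *)
Definition tab_half m := tlen m + ylen m + m + 2.
Definition tab_width m := 3 * tab_half m.
Definition tab_size m := (tab_half m).+1 * tab_width m.

Notation Y := (ylen n).
Notation T := (tlen n).
Notation D := (tab_half n).
Notation W := (tab_width n).

(* Row 0: left padding, the word [x], the separator, at most [ylen] certificate bits. *)
Definition init_ok (z : word) (i : nat) (a : letter) : bool :=
  let m := size z in
  if i < tab_half m then a == inl None
  else if i - tab_half m < m then a == inl (Some (onth z (i - tab_half m)))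
  else if i - tab_half m == m then a == inl (Some (Some None))
  else if i - tab_half m <= m + ylen m then
    if a is inl (Some (Some None)) then false else if a is inl (Some _) then true else false
  else a == inl (Some None).

Definition accept_ok (a : letter) : bool :=
  if a is inr (g, Some q) then if tdelta q g is None then tacc q else false else true.

(** Position [tab_width] is fixed here because it is the only one after row 0 that the local rule
    misses: its window would start at -1. *)
Definition cell_ok (z : word) (i : nat) (a : letter) : bool :=
  let m := size z in
  if i < tab_width m then init_ok z i a
  else if i == tab_width m then a == inr (blk, None)
  else if i < tab_half m * tab_width m then true
  else accept_ok a.

(* Rows of width [tab_width] are written one after the other; row boundaries stay blank
   and headless, so the local rule may ignore them. *)
Definition tableau (v : nat -> letter) := forall i, i < tab_size n ->
  [/\ cell_ok (bits x) i (v i), legal (v i) (v i.+1) (v i.+2)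
    & v (i + tab_width n).+1 = nextl (v i) (v i.+1) (v i.+2)].

Section Run.
Variable y : seq bool.
Hypothesis ylen_y : size y <= Y.
Notation z := (pair_input x y).

Definition row0 p : letter := if p < D then inl None else inl (Some (onth z (p - D))).

Definition conf t : ch := iter t adv (init_config M z, D).

Definition tau i : letter :=
  if i %/ W == 0 then row0 (i %% W) else cellst (conf (i %/ W).-1) (i %% W).

Variables (k : nat) (c : config M).
Hypotheses (k_le : k <= T) (exec_k : exec k (init_config M z) = Some c) (halt_c : step c = None).

Lemma adv_step (c0 : config M) h : adv (c0, h) =
  match step c0 with None => (c0, h) | Some c1 => (c1, (adv (c0, h)).2) end.
Proof.
by case: c0 => [[[q l] g] r] /=; case: tdelta => [[[q' g'] mv]|].
Qed.

Lemma adv_head e : (e.2 <= (adv e).2.+1) && ((adv e).2 <= e.2.+1).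
Proof.
by case: e => -[[[q l] g] r] h /=; case: tdelta => [[[q' g'] []]|] /=; lia.
Qed.

Lemma adv_halt h : adv (c, h) = (c, h).
Proof. by rewrite adv_step halt_c. Qed.

Lemma conf_c : (conf k).1 = c.
Proof.
rewrite /conf; move: D => h; elim: k (init_config M z) h exec_k => [|m IH] c0 h /=; first by case.
case E: (step c0) => [c1|] // Hm.
by rewrite -iterS iterSr adv_step E; exact: IH.
Qed.

Lemma conf_after t : k <= t -> conf t = conf k.
Proof.
move=> le_t; rewrite -(subnK le_t) /conf iterD -/(conf k).
elim: (t - k) => //= m ->; case: (conf k) conf_c => c0 h /= ->; exact: adv_halt.
Qed.

Lemma conf_head t : D - T <= (conf t).2 <= D + T.
Proof.
have H m : D - m <= (conf m).2 <= D + m.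
  elim: m => [|m IH]; first by rewrite /= subn0 addn0 leqnn.
  have := adv_head (conf m); rewrite -/(conf m.+1).
  by move: IH; rewrite /conf /=; move: (adv _).2 (iter _ _ _).2 => *; lia.
case: (leqP k t) => [/conf_after->|lt_t]; first by have := H k; lia.
by have := H t; lia.
Qed.

Lemma D_gt : T + Y + n + 1 < D. Proof. by rewrite /tab_half; lia. Qed.
Lemma WE : W = 3 * D. Proof. by []. Qed.

Lemma conf_head_gt0 t : 0 < (conf t).2.
Proof. by have := conf_head t; have := D_gt; lia. Qed.

Lemma size_z : size z = n + size y + 1.
Proof. by rewrite size_cat /= !size_map; lia. Qed.

(** These four columns are the ones seen by windows that cross a row boundary. *)
Lemma far_nohead t p : (p <= 1) || (W - 2 <= p) -> cellst (conf t) p = inr (cells (conf t) p, None).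
Proof.
by move=> Hp; rewrite /cellst ifF //; have := conf_head t; have := D_gt; have := WE; lia.
Qed.

Lemma cells0 p : cells (conf 0) p = if p < D then blk else
  if onth z (p - D) is Some s then tin M s else blk.
Proof.
rewrite /conf /= /init_config; have : size z != 0 by rewrite size_z; lia.
case: z => //= s z' _; rewrite nth_nil; case: ltnP => // le_p.
case: eqP => [->|ne_p]; first by rewrite subnn.
have -> : p - D = (p - D.+1).+1 by lia.
rewrite /=; case: (ltnP (p - D.+1) (size z')) => H.
  by rewrite (nth_map s) // onthE (nth_map s).
by rewrite nth_default ?size_map // onth_default.
Qed.

Lemma far_blank t p : (p == 0) || (p == W.-1) -> cells (conf t) p = blk.
Proof.
move=> Hp; elim: t => [|t IH].
  rewrite cells0; case: ltnP => // le_p; rewrite onth_default //.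
  by move: Hp; rewrite size_z; have := D_gt; have := WE; lia.
rewrite -IH [conf t.+1]iterS cells_adv ?conf_head_gt0 //.
by have := conf_head t; have := D_gt; have := WE; rewrite -/(conf t); lia.
Qed.

(** On row 0 the rule depends on two letters only, so [l] may also be a letter of row 1, as in the
    window that starts in column [W - 2]. *)
Lemma row0_next p : p.+2 < W.+1 ->
  forall l, cellst (conf 0) p.+1 = nextl (row0 p) (row0 p.+1) l.
Proof.
move=> Hp l; rewrite /cellst cells0 /row0 [(conf 0).2]/= [(conf 0).1.1.1.1]/=.
case: (ltnP p.+1 D) => H1; first by rewrite ifF //; lia.
case: (ltnP p D) => H2 /=.
  have -> : p.+1 == D by lia.
  congr (inr (_, Some _)); rewrite /init_config; by case: map.
by rewrite ifF //; lia.
Qed.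

Lemma tau_row t p : p < W -> tau (t * W + p) = if t == 0 then row0 p else cellst (conf t.-1) p.
Proof.
move=> lt_p; have W0 : 0 < W by lia.
by rewrite /tau divnMDl // modnMDl divn_small // modn_small // addn0.
Qed.

(** Three cases: the window lies in one row, or its last letter or its last two letters belong to
    the next row. In the crossing cases no head is near, and the blank outer columns reproduce
    themselves. *)
Lemma tau_legal i : legal (tau i) (tau i.+1) (tau i.+2) /\
  tau (i + W).+1 = nextl (tau i) (tau i.+1) (tau i.+2).
Proof.
have W5 : 5 < W by have := D_gt; have := WE; lia.
have W0 : 0 < W by lia.
rewrite (divn_eq i W); set t := i %/ W; have lt_p := ltn_pmod i W0; set p := i %% W in lt_p *.
case: (ltnP p.+2 W) => H2.
  have -> : (t * W + p).+2 = t * W + p.+2 by lia.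
  have -> : (t * W + p).+1 = t * W + p.+1 by lia.
  have -> : (t * W + p + W).+1 = t.+1 * W + p.+1 by lia.
  rewrite !tau_row //; [|lia..]; rewrite [t.+1 == 0]/= [t.+1.-1]/=.
  case: t => [|t].
    split; last by apply: row0_next; lia.
    rewrite /legal /row0; case: (ltnP p.+1 D) => // H3.
    case E: (onth z (p.+1 - D)) => [//|]; rewrite ifF; last by lia.
    have := onthTE z (p.+1 - D); rewrite E => /esym/negbT; rewrite -leqNgt => H.
    by rewrite onth_default //; lia.
  by split=> //; rewrite /= adv_local ?conf_head_gt0.
case: (ltnP p.+1 W) => H1.
  have Ep : p = W.-2 by lia.
  have -> : (t * W + p).+2 = t.+1 * W + 0 by lia.
  have -> : (t * W + p).+1 = t * W + W.-1 by lia.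
  have -> : (t * W + p + W).+1 = t.+1 * W + W.-1 by lia.
  rewrite !tau_row //; [|lia..]; rewrite [t.+1 == 0]/= [t.+1.-1]/=.
  case: t => [|t].
    split; first by rewrite /legal /row0; case: ifP => // _; case: onth.
    have -> : W.-1 = p.+1 by lia.
    by apply: row0_next; lia.
  rewrite [t.+1 == 0]/= [t.+1.-1]/= !far_nohead ?(far_blank _ (p := W.-1)) ?eqxx ?orbT //; lia.
have Ep : p = W.-1 by lia.
have -> : (t * W + p).+2 = t.+1 * W + 1 by lia.
have -> : (t * W + p).+1 = t.+1 * W + 0 by lia.
have -> : (t * W + p + W).+1 = t.+2 * W + 0 by lia.
rewrite !tau_row //; [|lia..]; rewrite [t.+1 == 0]/= [t.+2 == 0]/= [t.+1.-1]/= [t.+2.-1]/=.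
rewrite !(far_nohead _ (p := 0)) // (far_nohead _ (p := 1)) // !(far_blank _ (p := 0)) //.
split=> //; case: t => [|t].
  by rewrite /= /row0; case: ifP.
by rewrite [t.+1 == 0]/= far_nohead //; lia.
Qed.

Lemma init_ok_row0 i : init_ok (bits x) i (row0 i).
Proof.
rewrite /init_ok /row0 size_map; case: ltnP => // le_D; move: (i - D) => j {i le_D}.
case: ltnP => [lt_j|le_n]; first by rewrite onth_cat size_map lt_j.
case: eqP => [->|ne_n]; first by rewrite onth_cat size_map ltnn subnn.
rewrite onth_cat size_map; have -> : (j < n) = false by lia.
have -> : j - n = (j - n).-1.+1 by lia.
rewrite [onth (None :: _) _]/=; case: leqP => H; first by rewrite /bits onth_map; case: (onth y _).
by rewrite onth_default // size_map; lia.
Qed.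

Lemma tau_row0 i : i < W -> tau i = row0 i.
Proof. by move=> Hi; rewrite -[i]add0n -(mul0n W) tau_row // mul0n. Qed.

Lemma tau_W : tau W = inr (blk, None).
Proof.
have := D_gt; have := WE => ? ?.
rewrite -[W in tau W]addn0 -{1}[W]mul1n tau_row; last by lia.
by rewrite [1 == 0]/= far_nohead // far_blank.
Qed.

Lemma tau_last p : p < W -> tau (D * W + p) = cellst (conf k) p.
Proof.
move=> lt_p; have := D_gt => lt_D; rewrite tau_row //.
by rewrite ifF 1?conf_after //; lia.
Qed.

Lemma accept_cellst p : accepting c -> accept_ok (cellst (conf k) p).
Proof.
rewrite /cellst; case E: (conf k) conf_c => [c0 h] /= -> {E c0}.
case: c halt_c => [[[q l] g] r] /= Hst; case: eqP => // ->; rewrite ltnn.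
by case: tdelta Hst => [[[? ?] ?]|].
Qed.

Lemma tau_tableau : accepting c -> tableau tau.
Proof.
move=> Hacc i lt_i; have [H1 H2] := tau_legal i; split=> //.
rewrite /cell_ok size_map; case: ltnP => [lt_W|le_W].
  by rewrite tau_row0 // init_ok_row0.
case: eqP => [->|_]; first by rewrite tau_W.
case: ltnP => // le_D; rewrite -(subnKC le_D) tau_last ?accept_cellst //.
by move: lt_i; rewrite /tab_size mulSn; lia.
Qed.

(** The local rule computes every position after [W] from smaller ones, and [cell_ok] fixes position
    [W] itself. *)
Lemma tableau_tau v : tableau v -> (forall i, i < W -> v i = row0 i) ->
  forall i, i < tab_size n -> v i = tau i.
Proof.
move=> Hv Hrow i; elim/ltn_ind: i => i IH lt_i.
case: (ltnP i W) => [lt_W|]; first by rewrite Hrow // tau_row0.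
rewrite leq_eqVlt => /predU1P[Ei|lt_W].
  have [Hc _ _] := Hv i lt_i; move: Hc.
  by rewrite /cell_ok size_map -Ei ltnn eqxx tau_W => /eqP.
have := D_gt; have := WE => EW HD.
have Ei : i = ((i - W.+1) + W).+1 by lia.
have [|_ _ E] := Hv (i - W.+1); first by lia.
have [_ E'] := tau_legal (i - W.+1).
by rewrite Ei E E' !IH //; lia.
Qed.

(** The last row comes after halting, so [accept_ok] inspects the halting state in the cell of the
    head. *)
Lemma tableau_accept v : tableau v -> (forall i, i < W -> v i = row0 i) -> accepting c.
Proof.
move=> Hv Hrow; have := conf_head k; have HD := D_gt; have EW := WE => Hh.
have lt_h : (conf k).2 < W by lia.
have lt_i : D * W + (conf k).2 < tab_size n by rewrite /tab_size mulSn; lia.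
have [Hc _ _] := Hv _ lt_i; move: Hc; rewrite (tableau_tau Hv Hrow) // tau_last //.
have H0 : 1 < D by lia.
rewrite /cell_ok size_map !ifF; [|nia..].
rewrite /cellst eqxx; case E: (conf k) conf_c => [c0 h] /= -> {E c0}.
case: c halt_c => [[[q l] g] r] /= Hst; rewrite ltnn eqxx.
by case: tdelta Hst => [[[? ?] ?]|].
Qed.

End Run.

(** The certificate ends at the first right padding, at index [m]. Such an [m] exists and is at most
    [Y] because [init_ok] forces padding at index [Y]; by [legal] only padding follows. *)
Lemma tableau_row0 v : tableau v -> exists2 y, size y <= Y & forall i, i < W -> v i = row0 y i.
Proof.
move=> Hv; have HD : T + Y + n + 1 < D by rewrite /tab_half; lia.
have EW : W = 3 * D by [].
have Hok i : i < W -> init_ok (bits x) i (v i).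
  move=> lt_W; have [|H _ _] := Hv i; first by rewrite /tab_size mulSn; lia.
  by move: H; rewrite /cell_ok size_map lt_W.
pose E : letter := inl (Some None); pose P j := v (D + n.+1 + j) == E.
have PY : P Y.
  have := Hok (D + n.+1 + Y); rewrite /init_ok size_map.
  have -> : D + n.+1 + Y - D = n.+1 + Y by lia.
  rewrite !ifF; [|lia..]; by apply; lia.
case: (ex_minnP (ex_intro P Y PY)) => m Pm min_m; have le_m := min_m _ PY.
have PE j : m <= j -> D + n.+1 + j < W -> v (D + n.+1 + j) = E.
  move=> le_mj; rewrite -(subnKC le_mj); elim: (j - m) => [|i IH].
    by rewrite addn0 => _; exact/eqP.
  move=> lt_W; have {}IH : v (D + n.+1 + (m + i)) = E by apply: IH; lia.
  have [|_ Hleg _] := Hv (D + n + (m + i)); first by rewrite /tab_size mulSn; lia.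
  have := Hok _ lt_W; move: Hleg.
  have -> : (D + n + (m + i)).+1 = D + n.+1 + (m + i) by lia.
  have -> : (D + n.+1 + (m + i)).+1 = D + n.+1 + (m + i.+1) by lia.
  rewrite IH /init_ok size_map /legal.
  have -> : D + n.+1 + (m + i.+1) - D = n.+1 + (m + i.+1) by lia.
  have -> : (D + n.+1 + (m + i.+1) < D) = false by lia.
  have -> : (n.+1 + (m + i.+1) < n) = false by lia.
  have -> : (n.+1 + (m + i.+1) == n) = false by lia.
  case: ifP => _; last by move=> _ /eqP.
  by case: (v _) => [[[[b|]|]|]|].
pose bit (a : letter) := if a is inl (Some (Some (Some b))) then b else false.
exists (mkseq (fun j => bit (v (D + n.+1 + j))) m); first by rewrite size_mkseq.
move=> i lt_W; have := Hok i lt_W; rewrite /init_ok /row0 size_map.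
case: ltnP => [_ /eqP //|le_D].
have [j Ej] : exists j, i = D + j by exists (i - D); lia.
rewrite {i le_D}Ej in lt_W *; have -> : D + j - D = j by lia.
case: ltnP => [lt_j /eqP->|le_j]; first by rewrite onth_cat size_map lt_j.
case: eqP => [-> /eqP->|ne_j]; first by rewrite onth_cat size_map ltnn subnn.
have [i Ej] : exists i, j = n.+1 + i by exists (j - n.+1); lia.
rewrite {}Ej in lt_W le_j ne_j *; move=> Hi.
have -> : onth (pair_input x (mkseq (fun j => bit (v (D + n.+1 + j))) m)) (n.+1 + i) =
    omap Some (onth (mkseq (fun j => bit (v (D + n.+1 + j))) m) i).
  rewrite onth_cat size_map ltnNge ifF; last by lia.
  by have -> : n.+1 + i - n = i.+1 by [lia]; rewrite /= onth_map.
rewrite !(addnA D) in lt_W Hi *; case: (ltnP i m) => [lt_m|ge_m]; last first.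
  by rewrite onth_default ?size_mkseq // PE.
rewrite onthE (nth_map false) ?size_mkseq // nth_mkseq //.
move: Hi; have -> : n.+1 + i <= n + Y by lia.
have : ~~ P i by apply: contraL lt_m => /min_m; lia.
by rewrite /P; case: (v _) => [[[[b|]|]|]|] //; rewrite eqxx.
Qed.

Hypothesis halts : forall y, exists c,
  @halts_within M (pair_input x y) (d * (size x + size y) ^ d + d) c.

Lemma tableauP : (exists v, tableau v) <-> exists y c, [/\ size y <= d * size x ^ d + d,
  @halts_within M (pair_input x y) (d * (size x + size y) ^ d + d) c & accepting c].
Proof.
have le_T (y : seq bool) k : size y <= Y -> k <= d * (size x + size y) ^ d + d -> k <= T.
  move=> le_y /leq_trans; apply; rewrite leq_add2r leq_mul2l; apply/orP; right.
  by case: (posnP d) => [->|d0] //; rewrite leq_exp2r // leq_add2l.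
split=> [[v Hv]|[y [c [le_y [k [le_k Hk Hc]] Ha]]]]; last first.
  by exists (tau y); exact: (tau_tableau le_y (le_T _ _ le_y le_k) Hk Hc Ha).
(* Whatever certificate row 0 contains, the verifier halts on it, and this determines the remaining
   rows. *)
have [y le_y Hrow] := tableau_row0 Hv; have [c Hc] := halts y.
exists y, c; split => //; case: Hc => k [le_k Hk Hc].
exact: (tableau_accept le_y (le_T _ _ le_y le_k) Hk Hc Hv Hrow).
Qed.

End Tableau.

(** * The reduction *)

(** The language consists of strings, so a match for some instance with the given encoding has to be
    a match for the instance that was produced. *)
Lemma enc_inst_inj : injective enc_inst.
Proof.
move=> I J E; pose z := bits (enc_inst I).
have [EI _] : s_inst (num z) = I /\ inst_end (num z) = size (nums I).
  apply: seg_inst_inv; have [] := @read_nums z 0 (nums I) [::] => //.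
  by rewrite drop0 cats0 -enc_inst_nums.
have [EJ _] : s_inst (num z) = J /\ inst_end (num z) = size (nums J).
  apply: seg_inst_inv; have [] := @read_nums z 0 (nums J) [::] => //.
  by rewrite drop0 cats0 -enc_inst_nums -E.
by rewrite -EI EJ.
Qed.

Section Reduction.
Variables (M : TM) (d : nat).
Definition alph : finType :=
  (option (option (option bool)) + tG M * option (tQ M))%type.
Notation A := alph.

Definition code (a : A) : nat := index a (enum A).
Definition decode (m : nat) : A := nth (inl None) (enum A) m.

Lemma codeK : cancel code decode.
Proof. by move=> a; rewrite /decode nth_index ?mem_enum. Qed.

Lemma code_lt a : code a < #|A|.
Proof. by rewrite cardE index_mem mem_enum. Qed.

Definition windows : seq (A * A * A) := enum {: A * A * A}.
Definition nclauses := (size windows).+1.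

(* For [k > 0] the clause says that window [k.-1] at position [i], if it occurs, is legal
   and has the right successor; [v != a] is expanded into [v = a'] for all [a' != a]. *)
Definition clause (z : word) (i k : nat) : seq (nat * nat) :=
  if k is k'.+1 then
    let w := nth (inl None, inl None, inl None) windows k' in
    [seq (i, code a) | a <- enum A & a != w.1.1] ++
    [seq (i.+1, code a) | a <- enum A & a != w.1.2] ++
    [seq (i.+2, code a) | a <- enum A & a != w.2] ++
    (if legal w.1.1 w.1.2 w.2
     then [:: ((i + tab_width d (size z)).+1, code (nextl w.1.1 w.1.2 w.2))] else [::])
  else [seq (i, code a) | a <- enum A & cell_ok d z i a].

Definition clauses z j := clause z (j %/ nclauses) (j %% nclauses).

Definition step_of (s : nat) (l : nat * nat) : transition := (s, l.2, l.1, s.+1).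

Definition block z i : seq transition :=
  flatten [seq [seq step_of (i * nclauses + k) l | l <- clause z i k] | k <- iota 0 nclauses].

Notation tot z := (tab_size d (size z)).
Notation wid z := (tab_width d (size z)).

Definition ctotal (z : word) := tot z * nclauses.

Definition red_inst (z : word) : naa_inst :=
  NaaInst #|A| (tot z + wid z).+2 (ctotal z).+1 [:: 0] [:: ctotal z]
    (flatten [seq block z i | i <- iota 0 (tot z)])
    (mkseq (fun a => nseq (ctotal z) a) #|A|).

Lemma red_trans z t : t \in i_trans (red_inst z) <->
  exists j l, [/\ j < ctotal z, l \in clauses z j & t = (j, l.2, l.1, j.+1)].
Proof.
split.
  case/flatten_mapP=> i; rewrite mem_iota => /andP[_ lt_i].
  case/flatten_mapP=> k; rewrite mem_iota => /andP[_ lt_k] /mapP[l lk ->].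
  exists (i * nclauses + k), l; split => //.
  - rewrite /ctotal; apply: (@leq_trans (i.+1 * nclauses)); last by rewrite leq_mul2r lt_i orbT.
    by rewrite mulSn addnC ltn_add2r.
  - by rewrite /clauses divnMDl // divn_small // addn0 modnMDl modn_small.
move=> [j [l [lt_j lj ->]]]; apply/flatten_mapP; exists (j %/ nclauses).
  by rewrite mem_iota /= add0n ltn_divLR.
apply/flatten_mapP; exists (j %% nclauses); first by rewrite mem_iota /= add0n ltn_pmod.
by rewrite -divn_eq; apply/mapP; exists l.
Qed.

Lemma clauses_lt z j l : j < ctotal z -> l \in clauses z j ->
  (l.1 < (tot z + wid z).+2) && (l.2 < #|A|).
Proof.
move=> lt_j; rewrite /clauses; have : j %/ nclauses < tot z by rewrite ltn_divLR.
move: (j %/ _) (j %% _) => i [|k] lt_i /=.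
  by case/mapP=> a _ -> /=; rewrite code_lt andbT; lia.
rewrite !mem_cat => /or4P[||| ].
- by case/mapP=> a _ -> /=; rewrite code_lt andbT; lia.
- by case/mapP=> a _ -> /=; rewrite code_lt andbT; lia.
- by case/mapP=> a _ -> /=; rewrite code_lt andbT; lia.
- by case: ifP => // _; rewrite inE => /eqP-> /=; rewrite code_lt andbT; lia.
Qed.

Lemma mem_lits (i : nat) (P : pred A) a : P a -> (i, code a) \in [seq (i, code a') | a' <- enum A & P a'].
Proof. by move=> Pa; apply/mapP; exists a; rewrite // mem_filter Pa mem_enum. Qed.

Lemma red_csp x : (exists v : nat -> nat, (forall i, v i < #|A|) /\
    forall j, j < ctotal (bits x) -> exists2 l, l \in clauses (bits x) j & v l.1 = l.2) <->
  exists v : nat -> A, @tableau M d x v.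
Proof.
rewrite /tableau; set z := bits x; have Ez : size x = size z by rewrite size_map.
rewrite Ez; split=> [[v [Hv Hcl]]|[v Hv]].
  exists (fun i => decode (v i)) => i lt_i.
  have Hk k : k < nclauses -> exists2 l, l \in clause z i k & v l.1 = l.2.
    move=> lt_k; have [|l] := Hcl (i * nclauses + k).
      rewrite /ctotal; apply: (@leq_trans (i.+1 * nclauses)); last by rewrite leq_mul2r lt_i orbT.
      by rewrite mulSn addnC ltn_add2r.
    by rewrite /clauses divnMDl // divn_small // addn0 modnMDl modn_small //; exists l.
  have [//|l /mapP[a]] := Hk 0; rewrite mem_filter => /andP[Ha _] -> /= E0.
  (* In the clause of the window that occurs at [i], all literals of the first three groups are
     false, which leaves the last one. *)
  pose w : A * A * A := (decode (v i), decode (v i.+1), decode (v i.+2)).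
  have lt_w : index w windows < size windows by rewrite index_mem mem_enum.
  have [|l'] := Hk (index w windows).+1; first exact: lt_w.
  rewrite /= nth_index ?mem_enum // !mem_cat => Hl El.
  suff [H1 H2] : legal (decode (v i)) (decode (v i.+1)) (decode (v i.+2)) /\
     l' = ((i + wid z).+1, code (nextl (decode (v i)) (decode (v i.+1)) (decode (v i.+2)))).
    by split => //; [rewrite E0 codeK|move: El; rewrite H2 /= => ->; rewrite codeK].
  move: Hl => /or4P[||| ].
  - by case/mapP=> b; rewrite mem_filter => /andP[Hb _] E; move: El Hb; rewrite E /= => ->; rewrite codeK eqxx.
  - by case/mapP=> b; rewrite mem_filter => /andP[Hb _] E; move: El Hb; rewrite E /= => ->; rewrite codeK eqxx.
  - by case/mapP=> b; rewrite mem_filter => /andP[Hb _] E; move: El Hb; rewrite E /= => ->; rewrite codeK eqxx.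
  - by case: ifP => // Hleg; rewrite inE => /eqP->.
exists (fun i => code (v i)); split=> [i|j lt_j]; first exact: code_lt.
rewrite /clauses; have /Hv[H1 H2 H3] : j %/ nclauses < tot z by rewrite ltn_divLR.
move: (j %/ _) (j %% _) H1 H2 H3 => i [|k] H1 H2 H3 /=.
  by exists (i, code (v i)) => //; exact: (@mem_lits i (cell_ok d z i)).
move: (nth _ _ _) => -[[a b] c] /=.
have [Ea|Na] := eqVneq (v i) a; last first.
  exists (i, code (v i)) => //; rewrite mem_cat; apply/orP; left.
  exact: (@mem_lits i (predC1 a)).
have [Eb|Nb] := eqVneq (v i.+1) b; last first.
  exists (i.+1, code (v i.+1)) => //; rewrite !mem_cat; apply/orP; right; apply/orP; left.
  exact: (@mem_lits i.+1 (predC1 b)).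
have [Ec|Nc] := eqVneq (v i.+2) c; last first.
  exists (i.+2, code (v i.+2)) => //; rewrite !mem_cat; do 2 (apply/orP; right); apply/orP; left.
  exact: (@mem_lits i.+2 (predC1 c)).
exists ((i + wid z).+1, code (v (i + wid z).+1)) => //.
by rewrite !mem_cat -Ea -Eb -Ec H2 H3 mem_head !orbT.
Qed.

Lemma red_inst_correct x :
  NAA_MATCH_NONEMPTY (enc_inst (red_inst (bits x))) <-> exists v : nat -> A, @tableau M d x v.
Proof.
set I := red_inst (bits x); rewrite -red_csp.
have A0 : 0 < #|A| by apply/card_gt0P; exists (inl None).
have wfI : inst_wf I by apply: (csp_wf (C := ctotal (bits x)) (cl := clauses (bits x))
  (ns := #|A|) (nv := (tot (bits x) + wid (bits x)).+2)) => //;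
  [exact: red_trans | exact: clauses_lt].
have -> : (exists v : nat -> nat, (forall i, v i < #|A|) /\
    forall j, j < ctotal (bits x) -> exists2 l, l \in clauses (bits x) j & v l.1 = l.2)
  <-> nat_match I.
  apply: iff_sym; apply: (csp_match (nv := (tot (bits x) + wid (bits x)).+2)) => //.
  - exact: red_trans.
  - exact: clauses_lt.
rewrite -(match_nat wfI); split=> [[J [wfJ EJ HJ]]|HI]; last by exists I.
by rewrite (enc_inst_inj EJ).
Qed.

End Reduction.

(** * Computability of the reduction *)

Section ClosureMore.
Variable Bd : nat -> nat.
Hypothesis Bd_gt : forall n, n + 1 < Bd n.
Notation cpt := (cpt Bd).
Notation cptb := (cptb Bd).
Notation cgen := (cgen Bd).
Notation small := (small Bd).

Lemma cpt_addn k (f g : word -> ctx k -> nat) : cpt f -> cpt g -> cpt (fun z e => f z e + g z e).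
Proof.
move=> Hf Hg; apply: (cpt_let (f := fun z (e : ctx k.+1) => e.2 + g z e.1) _ Hf).
  by move=> z N e _ _ /=; lia.
exact: (cpt_add (@small_var _ _) (cpt_var _ _) (cpt_weak Hg)).
Qed.

Lemma cpt_muln k (f g : word -> ctx k -> nat) : cpt f -> cpt g -> cpt (fun z e => f z e * g z e).
Proof.
(* If [a] exceeds [N], so does the product with any [b > 0], both before and after clamping [a] down
   to [N], up to equality. *)
have clamp N a b : minn N (minn N a * b) = minn N (a * b).
  by case: (leqP a N) => // lt_a; case: b => [|b]; rewrite ?muln0 //; nia.
move=> Hf Hg; apply: (cpt_let (f := fun z (e : ctx k.+1) => e.2 * g z e.1) _ Hf).
  by move=> z N e _ _ /=.
apply: (cpt_let (f := fun z (e : ctx k.+2) => e.1.2 * e.2) _ (cpt_weak Hg)).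
  by move=> z N e _ _ /=; rewrite ![e.2 * _]mulnC.
apply: cpt_mul; [|exact: small_var| |exact: cpt_var].
  exact: small_weak (@small_var _ _).
exact: cpt_weak (cpt_var _ _).
Qed.

Lemma cpt_exp k (f : word -> ctx k -> nat) p : cpt f -> cpt (fun z e => f z e ^ p).
Proof.
move=> Hf; elim: p => [|p IH]; first exact: cpt_const.
by apply: cpt_ext (cpt_muln Hf IH) => z e; rewrite expnS.
Qed.

Lemma cgen_bits k (s : seq bool) : cgen (fun z (e : ctx k) => s).
Proof.
elim: s => [|b s IH]; first exact: cgen_nil.
exact: cgen_cat (cgen_bit _ _ b) IH.
Qed.

(** The list [s] does not depend on the input, so this loop is unrolled in the program, in contrast
    to [cgen_for]. *)
Lemma cgen_flat k (T : Type) (s : seq T) (F : T -> word -> ctx k -> seq bool) :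
  (forall a, cgen (F a)) -> cgen (fun z e => flatten [seq F a z e | a <- s]).
Proof.
move=> HF; elim: s => [|a s IH]; first exact: cgen_nil.
exact: cgen_cat (HF a) IH.
Qed.

(** Unary printing replaces computation for numbers such as [ctotal], which may exceed the clamp:
    sums and constant multiples are printed in pieces. *)
Definition cones k (f : word -> ctx k -> nat) := cgen (fun z e => nseq (f z e) true).

Lemma cones_const k c : cones (fun z (e : ctx k) => c).
Proof. exact: cgen_bits. Qed.

Lemma cones_add k (f g : word -> ctx k -> nat) : cones f -> cones g ->
  cones (fun z e => f z e + g z e).
Proof. by move=> Hf Hg; apply: cgen_ext (cgen_cat Hf Hg) => z e; rewrite nseqD. Qed.

Lemma cones_succ k (f : word -> ctx k -> nat) : cones f -> cones (fun z e => (f z e).+1).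
Proof.
by move=> Hf; apply: cgen_ext (cones_add (cones_const _ 1) Hf) => z e; rewrite add1n.
Qed.

Lemma cones_mul k (f : word -> ctx k -> nat) c : small f -> cpt f -> cones (fun z e => f z e * c).
Proof.
move=> sf Hf; apply: cgen_ext (cgen_for sf Hf (cones_const _ c)) => z e /=.
by elim: (f z e) 0 => //= m IH i; rewrite IH mulSn nseqD.
Qed.

Lemma cgen_nat k (f : word -> ctx k -> nat) : cones f -> cgen (fun z e => enc_nat (f z e)).
Proof. by move=> Hf; exact: cgen_cat Hf (cgen_bit _ _ false). Qed.

(* The list and its length: an encoded list is prefixed with its length. *)
Definition clist k (G : word -> ctx k -> seq transition) :=
  cgen (fun z e => flatten (map enc_trans (G z e))) /\ cones (fun z e => size (G z e)).

Lemma clist_ext k (F G : word -> ctx k -> seq transition) :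
  (forall z e, F z e = G z e) -> clist F -> clist G.
Proof.
by move=> E [H1 H2]; split; [apply: cgen_ext H1|apply: cgen_ext H2] => z e; rewrite E.
Qed.

Lemma clist_nil k : clist (fun z (e : ctx k) => [::]).
Proof. by split; [exact: cgen_nil | exact: cones_const]. Qed.

Lemma clist_one k s a x : cones s -> cones x ->
  clist (fun z (e : ctx k) => [:: (s z e, a, x z e, (s z e).+1)]).
Proof.
move=> Hs Hx; split; last exact: cones_const.
apply: cgen_cat; last exact: cgen_nil.
apply: cgen_cat (cgen_nat Hs) (cgen_cat (cgen_bits _ _) (cgen_cat (cgen_nat Hx) _)).
exact: cgen_nat (cones_succ Hs).
Qed.

Lemma clist_cat k (F G : word -> ctx k -> seq transition) :
  clist F -> clist G -> clist (fun z e => F z e ++ G z e).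
Proof.
move=> [F1 F2] [G1 G2]; split.
  by apply: cgen_ext (cgen_cat F1 G1) => z e; rewrite map_cat flatten_cat.
by apply: cgen_ext (cones_add F2 G2) => z e; rewrite size_cat.
Qed.

Lemma clist_if k P (F : word -> ctx k -> seq transition) :
  cptb P -> clist F -> clist (fun z e => if P z e then F z e else [::]).
Proof.
move=> HP [F1 F2]; split.
  by apply: cgen_ext (cgen_if Bd_gt HP F1 (cgen_nil _ _)) => z e; case: ifP.
by apply: cgen_ext (cgen_if Bd_gt HP F2 (cgen_nil _ _)) => z e; case: ifP.
Qed.

Lemma clist_flat k (T : Type) (s : seq T) (F : T -> word -> ctx k -> seq transition) :
  (forall a, clist (F a)) -> clist (fun z e => flatten [seq F a z e | a <- s]).
Proof.
move=> HF; elim: s => [|a s IH]; first exact: clist_nil.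
exact: clist_cat (HF a) IH.
Qed.

Lemma clist_for k (m : word -> ctx k -> nat) (G : word -> ctx k.+1 -> seq transition) :
  small m -> cpt m -> clist G ->
  clist (fun z e => flatten [seq G z (e, i) | i <- iota 0 (m z e)]).
Proof.
move=> sm Hm [G1 G2]; split.
  apply: cgen_ext (cgen_for sm Hm G1) => z e /=.
  by elim: (iota _ _) => //= i s ->; rewrite map_cat flatten_cat.
apply: cgen_ext (cgen_for sm Hm G2) => z e /=.
by elim: (iota _ _) => //= i s ->; rewrite size_cat nseqD.
Qed.

End ClosureMore.

Section ReductionCpt.
Variables (M : TM) (d : nat).
Notation A := (alph M).

(** Positions of the tableau fit in a counter; state numbers, larger by the factor [nclauses], need
    not. *)
Definition rBd m := tab_size d m + m + 2.

Lemma rBd_gt m : m + 1 < rBd m. Proof. by rewrite /rBd; lia. Qed.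

Lemma rBd_poly : polyb rBd.
Proof.
have Hh : polyb (tab_half d) by rewrite /tab_half /tlen /ylen; polyb.
rewrite /rBd /tab_size /tab_width.
by apply: polybW (polybD (polybD (polybM (polybD Hh (polyb_const 1)) (polybM (polyb_const 3) Hh))
  polyb_id) (polyb_const 2)) => m; rewrite addn1.
Qed.

Notation cpt := (cpt rBd).
Notation cptb := (cptb rBd).
Notation cgen := (cgen rBd).
Notation small := (small rBd).
Notation clist := (clist rBd).
Notation cones := (cones rBd).

Lemma cpt_ylen k : cpt (fun z (e : ctx k) => ylen d (size z)).
Proof.
have Hs := cpt_size rBd_gt k; have Hc := cpt_const rBd k d.
exact: (cpt_addn (cpt_muln Hc (cpt_exp d Hs)) Hc).
Qed.

Lemma cpt_half k : cpt (fun z (e : ctx k) => tab_half d (size z)).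
Proof.
have Hs := cpt_size rBd_gt k; have Hc := cpt_const rBd k d; have Hy := cpt_ylen k.
exact: (cpt_addn (cpt_addn (cpt_addn
  (cpt_addn (cpt_muln Hc (cpt_exp d (cpt_addn Hs Hy))) Hc) Hy) Hs) (cpt_const _ _ 2)).
Qed.

Lemma cpt_width k : cpt (fun z (e : ctx k) => tab_width d (size z)).
Proof. exact: (cpt_muln (cpt_const _ _ 3) (cpt_half k)). Qed.

Lemma cpt_tab_size k : cpt (fun z (e : ctx k) => tab_size d (size z)).
Proof. exact: (cpt_muln (cpt_succ (cpt_half k)) (cpt_width k)). Qed.

Lemma small_size_le k (f : nat -> nat) : (forall m, f m <= tab_size d m + m + 2) ->
  small (fun z (e : ctx k) => f (size z)).
Proof. by move=> Hf z N e HN _; apply: leq_trans (Hf _) HN. Qed.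

Lemma half_le m : tab_half d m <= tab_size d m.
Proof. by rewrite /tab_size /tab_width; nia. Qed.

Lemma width_le m : tab_width d m <= tab_size d m.
Proof. by rewrite /tab_size mulSn leq_addr. Qed.

Lemma cptb_cell_ok k (a : A) : cptb (fun z (e : ctx k.+1) => @cell_ok M d z e.2 a).
Proof.
have Hi := cpt_var rBd k; have si := @small_var rBd k.
have sh : small (fun z (e : ctx k.+1) => tab_half d (size z)).
  by apply: small_size_le => m; have := half_le m; lia.
have sw : small (fun z (e : ctx k.+1) => tab_width d (size z)).
  by apply: small_size_le => m; have := width_le m; lia.
have ss := @small_size _ rBd_gt k.+1.
have Hj := cpt_sub rBd_gt si sh Hi (cpt_half k.+1).
have sj : small (fun z (e : ctx k.+1) => e.2 - tab_half d (size z)).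
  by move=> z N e HN He; apply: leq_trans (leq_subr _ _) (si _ _ _ HN He).
have cb := cptb_const rBd k.+1.
apply: (cptb_if rBd_gt (cptb_lt rBd_gt sw Hi (cpt_width _))).
  apply: (cptb_if rBd_gt (cptb_lt rBd_gt sh Hi (cpt_half _)) (cb _)).
  apply: (cptb_if rBd_gt (cptb_lt rBd_gt ss Hj (cpt_size rBd_gt _))).
    case: a => [[o|]|gq]; [|exact: cb..].
    apply: cpt_ext (cptb_onth rBd_gt o Hj) => z e; congr nat_of_bool.
    by apply/eqP/eqP => [->|[->]].
  apply: (cptb_if rBd_gt (cptb_eq rBd_gt sj ss Hj (cpt_size rBd_gt _)) (cb _)).
  apply: (cptb_if rBd_gt (cptb_le rBd_gt sj Hj (cpt_addn (cpt_size rBd_gt _) (cpt_ylen _)))); exact: cb.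
apply: (cptb_if rBd_gt (cptb_eq rBd_gt si sw Hi (cpt_width _)) (cb _)).
apply: (cptb_if rBd_gt _ (cb _) (cb _)).
apply: (cptb_lt rBd_gt) => //; last exact: (cpt_muln (cpt_half _) (cpt_width _)).
by apply: (small_size_le (f := fun m => tab_half d m * tab_width d m)) => m; rewrite /tab_size; lia.
Qed.

Lemma clist_lits k s x (P : A -> word -> ctx k -> bool) : cones s -> cones x ->
  (forall a, cptb (P a)) -> clist (fun z e => [seq step_of (s z e) l |
     l <- [seq (x z e, code a) | a <- enum A & P a z e]]).
Proof.
move=> Hs Hx HP.
apply: clist_ext (clist_flat (enum A) (F := fun a z e => if P a z e then
  [:: (s z e, code a, x z e, (s z e).+1)] else [::]) _) => [z e|a].
  by elim: (enum A) => //= a l IH; case: ifP => /= _; rewrite IH.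
by apply: (clist_if rBd_gt) => //; exact: clist_one.
Qed.

Lemma clist_clause k s c : cones s -> clist (fun z (e : ctx k.+1) =>
  [seq step_of (s z e) l | l <- @clause M d z e.2 c]).
Proof.
move=> Hs; have Hi : cones (fun z (e : ctx k.+1) => e.2).
  exact: cgen_num (@small_var _ _) (cpt_var _ _).
case: c => [|c]; first by apply: clist_lits => // a; exact: cptb_cell_ok.
set w := nth (inl None, inl None, inl None) (windows M) c.
have cb := cptb_const rBd k.+1.
have H := clist_cat (clist_lits (P := fun a z e => a != w.1.1) Hs Hi (fun a => cb _))
  (clist_cat (clist_lits (P := fun a z e => a != w.1.2) Hs (cones_succ Hi) (fun a => cb _))
  (clist_cat (clist_lits (P := fun a z e => a != w.2) Hs (cones_succ (cones_succ Hi)) (fun a => cb _))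
  (clist_if rBd_gt (P := fun z e => legal w.1.1 w.1.2 w.2) (cb _)
    (clist_one (code (nextl w.1.1 w.1.2 w.2)) Hs (cones_succ (cones_add Hi
       (cgen_num (small_size_le (f := tab_width d) _) (cpt_width k.+1)))))))).
apply: clist_ext (H _) => [z e|m]; last by have := width_le m; lia.
by rewrite /clause -/w !map_cat; case: legal.
Qed.

Lemma cgen_red : cgen (fun z (e : ctx 0) => enc_inst (red_inst M d z)).
Proof.
have st k : small (fun z (e : ctx k) => tab_size d (size z)).
  by apply: small_size_le => m; lia.
have sw k : small (fun z (e : ctx k) => tab_width d (size z)).
  by apply: small_size_le => m; have := width_le m; lia.
have HC k : cones (fun z (e : ctx k) => ctotal M d z) by exact: cones_mul (st k) (cpt_tab_size k).
have [T1 T2] : clist (fun z (e : ctx 0) => i_trans (red_inst M d z)).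
  apply: (clist_for (G := fun z (e : ctx 1) => block M d z e.2)) => //; first exact: cpt_tab_size.
  apply: clist_flat => c; apply: clist_clause.
  by apply: cones_add (cones_const _ _ _); apply: cones_mul; [exact: small_var|exact: cpt_var].
apply: cgen_cat; first exact: cgen_bits.
apply: cgen_cat.
  apply: cgen_nat; do 2 apply: cones_succ; apply: cones_add; apply: cgen_num => //.
    exact: cpt_tab_size.
  exact: cpt_width.
apply: cgen_cat; first exact: cgen_nat (cones_succ (HC 0)).
apply: cgen_cat; first exact: (cgen_bits rBd 0 (enc_list enc_nat [:: 0])).
apply: cgen_cat; first exact: (cgen_cat (cgen_bits _ _ _) (cgen_cat (cgen_nat (HC 0)) (cgen_nil _ _))).
apply: cgen_cat; first exact: (cgen_cat (cgen_nat T2) T1).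
(* As [ctotal] may exceed the clamp, the letters of a word are printed in [tab_size] rounds of
   [nclauses] copies each. *)
suff H : cgen (fun z (e : ctx 0) => enc_nat #|A| ++ flatten [seq enc_nat (ctotal M d z) ++
    flatten [seq flatten (nseq (nclauses M) (enc_nat a)) | i <- iota 0 (tab_size d (size z))]
    | a <- iota 0 #|A|]).
  apply: cgen_ext H => z e; rewrite /enc_list size_mkseq -map_comp; congr (_ ++ flatten _).
  apply: eq_map => a /=; rewrite size_nseq map_nseq; congr (_ ++ _); rewrite /ctotal.
  have {}H m c i : flatten [seq flatten (nseq c (enc_nat a)) | _ <- iota i m] =
      flatten (nseq (m * c) (enc_nat a)).
    by elim: m i => // m IH i; rewrite mulSn nseqD flatten_cat -(IH i.+1).
  exact: (H _ (nclauses M)).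
apply: cgen_cat; first exact: cgen_bits.
apply: cgen_flat => a; apply: cgen_cat; first exact: cgen_nat (HC 0).
exact: (cgen_for (G := fun z (e : ctx 1) => flatten (nseq (nclauses M) (enc_nat a))) (st 0)
  (cpt_tab_size 0) (cgen_bits _ _ _)).
Qed.

End ReductionCpt.

Theorem naa_match_NP_hard : NP_hard NAA_MATCH_NONEMPTY.
Proof.
move=> L [M [d [Hhalt HL]]].
have [M' [p HM']] := generator (rBd_poly d) (cgen_red M d).
exists (fun x => enc_inst (red_inst M d (bits x))); split.
  exists M', (4 ^ p) => x; have [c [[m [Hm E S]] Hc]] := HM' (bits x).
  exists c; split => //; exists m; split => //; apply: leq_trans Hm _.
  rewrite size_map; apply: leq_trans (poly_form _ (leqnn p)).
  by case: (p) => // q; rewrite leq_exp2r //; lia.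
by move=> x; rewrite HL (red_inst_correct M d x) (tableauP (Hhalt x)).
Qed.

Theorem theorem1 : NP_complete NAA_MATCH_NONEMPTY.
Proof. split; [exact: naa_match_in_NP | exact: naa_match_NP_hard]. Qed.
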